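(* Let $r$ be a sufficiently large constant, let $(\tau_K,E,D)$ be a $2^{-rn}$-non-malleable ($2^{-rn}$-NM) symmetric-key quantum encryption scheme with $n$-qubit plaintext space $\mathcal H_A$, and choose an integer $d$ dividing $|A|=2^n$. Then there exist a decomposition $\mathcal H_A=\mathcal H_T\otimes\mathcal H_{A'}$ and a state vector $|\psi\rangle_T$ such that $|T|=d$ and the scheme $(\tau_K,E^t,D^t)$ with plaintext space $\mathcal H_{A'}$ defined by $$E^t(X)=E(X\otimes|\psi\rangle\langle\psi|_T),$$ $$D^t(Y)=\langle\psi|_TD(Y)|\psi\rangle_T+\mathrm{tr}\big[(1_T-|\psi\rangle\langle\psi|_T)D(Y)\big]\,|\bot\rangle\langle\bot|$$ is $\big(\frac4{|T|}+2^{-\Omega(n)}\big)$-DNS-authenticating.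
   Context: All Hilbert spaces are finite-dimensional; $H$ is the von Neumann entropy (base 2), $I(X:Y)=H(X)+H(Y)-H(XY)$, $h$ the binary entropy; $|\phi^+\rangle_{CC'}=|C|^{-1/2}\sum_i|i\rangle|i\rangle$, $\phi^+=|\phi^+\rangle\langle\phi^+|$; a tensor factor on which a map is not specified to act carries the identity. A symmetric-key quantum encryption scheme (QES) is a triple $(\tau_K,E,D)$ of the uniform classical key state $\tau_K=\frac1{|K|}\sum_k|k\rangle\langle k|$ and channels $E:\mathrm{End}(\mathcal H_A\otimes\mathcal H_K)\to\mathrm{End}(\mathcal H_C\otimes\mathcal H_K)$, $D:\mathrm{End}(\mathcal H_C\otimes\mathcal H_K)\to\mathrm{End}((\mathcal H_A\oplus\mathbb C|\bot\rangle)\otimes\mathcal H_K)$ (key register unchanged) with $(D\circ E)(X\otimes|k\rangle\langle k|)=(X\oplus0_\bot)\otimes|k\rangle\langle k|$ for all $k$. The output space of $D$ is, by slight abuse, also denoted $A$. In the definition of $D^t$, the trace in the second term is over everything except the key register, and a rejection $|\bot\rangle$ already output by $D$ is kept as $|\bot\rangle$ (it counts as lying in the complement of $|\psi\rangle_T$). For a CPTP attack map $\Lambda_{CB\to C\tilde B}$, the effective channel is $\tilde\Lambda_{AB\to A\tilde B}=\mathrm{tr}_K[(D\circ\Lambda\circ E)((\cdot)\otimes\tau_K)]$, and $p_=(\Lambda,\rho)=\mathrm{tr}[(\phi^+_{CC'}\otimes1_{\tilde B})\Lambda(\phi^+_{CC'}\otimes\rho_B)]$. The scheme is $\varepsilon$-NM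 if for any state $\rho_{ABR}$ and any CPTP map $\Lambda_{CB\to C\tilde B}$, $I(AR:\tilde B)_{\tilde\Lambda(\rho)}\le I(AR:B)_\rho+h(p_=(\Lambda,\rho))+\varepsilon$. $\varepsilon$-DNS-authenticating (for a scheme with plaintext $A$, encryption $E$, decryption $D$): for any CPTP map $\Lambda_{CB\to C\tilde B}$ there exist CP maps $\Lambda^{\mathrm{acc}}_{B\to\tilde B}$, $\Lambda^{\mathrm{rej}}_{B\to\tilde B}$ with trace-preserving sum such that for all states $\rho_{AB}$, $\big\|\mathrm{tr}_KD(\Lambda(E(\rho_{AB}\otimes\tau_K)))-\big((\mathrm{id}_A\otimes\Lambda^{\mathrm{acc}})(\rho_{AB})+|\bot\rangle\langle\bot|\otimes\Lambda^{\mathrm{rej}}(\rho_B)\big)\big\|_1\le\varepsilon$. *)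

(* Defs.v *)
From mathcomp Require Import all_boot all_order all_algebra.
From mathcomp Require Import complex mxtens.
From mathcomp Require Import reals exp.

Set Implicit Arguments.
Unset Strict Implicit.
Unset Printing Implicit Defensive.

Import Order.TTheory GRing.Theory Num.Theory.

Local Open Scope ring_scope.
Local Open Scope complex_scope.
Local Open Scope sesquilinear_scope.

(** A system of dimension [n] has state space C^n, and End(C^n) is ['M_n].  The
    composite of systems of dimensions [m] and [n] has dimension [m * n], with
    the basis numbered by [mxtens_index : 'I_m * 'I_n -> 'I_(m * n)], so that
    tensor products of operators are [_ *t _]. Products associate to the left.
    The plaintext space with the rejection symbol adjoined, A (+) C|bot>, is
    C^(a + 1), the last basis vector being |bot>. *)

Section Systems.
Variable R : realType.
Local Notation op n := 'M[R[i]]_n%N.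

Definition slice1 m n (X : op (m * n)) (l l' : 'I_n) : op m :=
  \matrix_(i, j) X (mxtens_index (i, l)) (mxtens_index (j, l')).

Definition slice2 m n (X : op (m * n)) (l l' : 'I_m) : op n :=
  \matrix_(i, j) X (mxtens_index (l, i)) (mxtens_index (l', j)).

(** [trr X] traces out the right-hand factor, [trl X] the left-hand one. *)
Definition trr m n (X : op (m * n)) : op m := \sum_l slice1 X l l.
Definition trl m n (X : op (m * n)) : op n := \sum_l slice2 X l l.

(** [on1 f] is f (x) id and [on2 f] is id (x) f (for linear f). *)
Definition on1 m m' n (f : op m -> op m') (X : op (m * n)) : op (m' * n) :=
  \sum_l \sum_l' f (slice1 X l l') *t delta_mx l l'.

Definition on2 m n n' (f : op n -> op n') (X : op (m * n)) : op (m * n') :=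
  \sum_l \sum_l' delta_mx l l' *t f (slice2 X l l').

(** Reordering of tensor factors XYZ -> XZY. *)
Definition swap m n p (X : op (m * n * p)) : op (m * p * n) :=
  let s (i : 'I_(m * p * n)) : 'I_(m * n * p) :=
    let: (xz, y) := mxtens_unindex i in
    let: (x, z) := mxtens_unindex xz in
    mxtens_index (mxtens_index (x, y), z) in
  \matrix_(i, j) X (s i) (s j).

(** Over [R[i]], [0 <= z] entails that z is real, so that [psd X] forces X to be
    Hermitian. *)
Definition psd n (X : op n) : Prop :=
  forall v : 'cV[R[i]]_n, 0 <= (v^t* *m X *m v) 0 0.

Definition state n (X : op n) : Prop := psd X /\ \tr X = 1.

Definition completely_positive m n (f : op m -> op n) : Prop :=
  linear f /\ forall p (X : op (m * p)), psd X -> psd (on1 f X).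

Definition trace_preserving m n (f : op m -> op n) : Prop :=
  forall X, \tr (f X) = \tr X.

Definition cptp m n (f : op m -> op n) : Prop :=
  completely_positive f /\ trace_preserving f.

Definition log2 (x : R) : R := ln x / ln 2.

(** [ln 0 = 0], hence 0 log 0 = 0 here and in [entropy]. *)
Definition binary_entropy (p : R) : R :=
  - (p * log2 p) - (1 - p) * log2 (1 - p).

(** Used on Hermitian X only, for which [spectral_diag X] lists the eigenvalues
    of X with multiplicity. *)
Definition eigval n (X : op n) (i : 'I_n) : R :=
  complex.Re (spectral_diag X 0 i).

Definition entropy n (X : op n) : R :=
  - \sum_i eigval X i * log2 (eigval X i).

Definition mutual_info m n (X : op (m * n)) : R :=
  entropy (trr X) + entropy (trl X) - entropy X.

(** The trace norm: the sum of the singular values of X. *)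
Definition norm1 n (X : op n) : R :=
  \sum_i Num.sqrt (eigval (X^t* *m X) i).

Definition ketbra n (i : 'I_n) : op n := delta_mx i i.

Definition mixed n : op n := n%:R^-1 *: 1%:M.

(** phi^+, with entries <ij|phi^+|i'j'> = [i = j][i' = j'] / c. *)
Definition phi_plus c : op (c * c) :=
  let diag (x : 'I_(c * c)) : bool :=
    (mxtens_unindex x).1 == (mxtens_unindex x).2 in
  \matrix_(x, y) ((diag x && diag y)%:R / c%:R).

(** X |-> X (+) 0_bot, and |bot><bot|. *)
Definition dsum0 a (X : op a) : op (a + 1) := block_mx X 0 0 0.
Definition bot a : op (a + 1) := block_mx 0 0 0 1%:M.

(** A scheme with plaintext, key and ciphertext dimensions a, k, c; the key
    state is [mixed k].  [qes_enc_key] and [qes_dec_key] say that the key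
    register is left unchanged. *)
Record qes a k c (E : op (a * k) -> op (c * k))
    (D : op (c * k) -> op ((a + 1) * k)) : Prop := Qes {
  qes_key_gt0 : (0 < k)%N;
  qes_enc : cptp E;
  qes_dec : cptp D;
  qes_enc_key : forall X (i : 'I_k),
    exists Y, E (X *t ketbra i) = Y *t ketbra i;
  qes_dec_key : forall Y (i : 'I_k),
    exists X, D (Y *t ketbra i) = X *t ketbra i;
  qes_correct : forall X (i : 'I_k),
    D (E (X *t ketbra i)) = dsum0 X *t ketbra i
}.

(** tr_K[(D o L o E)((.) (x) tau_K)]; the factors are successively ordered as
    ABK, AKB, CKB, CBK, CB'K, CKB', (A+bot)KB', (A+bot)B'K. *)
Definition effective a k c b b' (E : op (a * k) -> op (c * k))
    (D : op (c * k) -> op ((a + 1) * k)) (L : op (c * b) -> op (c * b'))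
    (X : op (a * b)) : op ((a + 1) * b') :=
  trr (swap (on1 D (swap (on1 L (swap (on1 E (swap (X *t mixed k)))))))).

Definition p_eq c b b' (L : op (c * b) -> op (c * b')) (rhoB : op b) : R :=
  complex.Re (\tr ((phi_plus c *t 1%:M) *m
    swap (on1 L (swap (phi_plus c *t rhoB))))).

Definition non_malleable (eps : R) a k c (E : op (a * k) -> op (c * k))
    (D : op (c * k) -> op ((a + 1) * k)) : Prop :=
  forall b r b' (rho : op (a * b * r)) (L : op (c * b) -> op (c * b')),
    state rho -> cptp L ->
    mutual_info (swap (on1 (effective E D L) rho))
      <= mutual_info (swap rho) + binary_entropy (p_eq L (trl (trr rho))) + eps.

Definition dns_authenticating (eps : R) a k c (E : op (a * k) -> op (c * k))
    (D : op (c * k) -> op ((a + 1) * k)) : Prop :=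
  forall b b' (L : op (c * b) -> op (c * b')), cptp L ->
    exists Lacc Lrej : op b -> op b',
      [/\ completely_positive Lacc, completely_positive Lrej,
          trace_preserving (fun X => Lacc X + Lrej X) &
          forall rho : op (a * b), state rho ->
            norm1 (effective E D L rho
                   - (on1 (@dsum0 a) (on2 Lacc rho) + bot a *t Lrej (trl rho)))
              <= eps].

Section Tagging.
(** [U] is the identification of T (x) A' with A, and [psi] the tag. *)
Variables (a t a' : nat) (U : 'M[R[i]]_(a, t * a')) (psi : 'cV[R[i]]_t).

(** The operator A' -> A, |x> |-> |psi>_T |x>. *)
Definition ket_tag : 'M[R[i]]_(a, a') :=
  U *m castmx (erefl _, mul1n a') (psi *t (1%:M : op a')).

Definition tag_proj : op a := U *m ((psi *m psi^t* ) *t 1%:M) *m U^t*.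

Definition tag_enc k c (E : op (a * k) -> op (c * k)) (X : op (a' * k)) :
    op (c * k) :=
  E (on1 (fun Z : op a' => U *m ((psi *m psi^t* ) *t Z) *m U^t*) X).

(** <psi|Z|psi> for Z in End(A (+) bot): |bot> is orthogonal to |psi>_T, and the
    result is regarded as an element of End(A' (+) bot). *)
Definition tag_accept (Z : op (a + 1)) : op (a' + 1) :=
  dsum0 (ket_tag^t* *m ulsubmx Z *m ket_tag).

Definition tag_dec k c (D : op (c * k) -> op ((a + 1) * k)) (Y : op (c * k)) :
    op ((a' + 1) * k) :=
  on1 tag_accept (D Y)
  + bot a' *t trl (((1%:M - dsum0 tag_proj) *t 1%:M) *m D Y).
End Tagging.

End Systems.

(* Main.v *)
Require Import Defs.
From mathcomp Require Import all_boot all_order all_algebra.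
From mathcomp Require Import complex mxtens.
From mathcomp Require Import reals exp ring lra.

(** Let [W_j] be Kraus operators of an attack on ciphertext and side register,
    and split [W_j = W0_j + 1 (x) M_j] with [W0_j] of vanishing partial trace
    over the ciphertext. The simulator accepts with the Kraus operators [M_j],
    and rejects with the output of the [W0_j] on a maximally mixed ciphertext.

    Non-malleability speaks about channels with [p_= = 0], that is, whose Kraus
    operators all have vanishing partial trace. By Pinsker's inequality the
    effective channel of such an attack is close to a product channel. A
    family [W0_j], once scaled down, is completed to such a channel by
    depolarizing branches without identity component, flagged in the side
    register; comparing the branches identifies the plaintext factor of the
    product as the effective channel of the depolarizing attack, whatever the
    [W0_j] are. Its output essentially is the state [omega] obtained by
    decrypting noise, and for one of the [d] basis vectors of T the
    probability of finding the tag in [omega] is at most [1 / d].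

    The same product form, for the attack which swaps the ciphertext out to the
    side register, shows that the encryption of every plaintext is close to a
    fixed state; for an attack with a single Kraus operator on the ciphertext it
    shows that this state is close to the maximally mixed one. Hence the
    rejection branch is simulated correctly. The cross terms between [W0_j] and
    [1 (x) M_j] are small on acceptance: all products of decryption with
    encryption Kraus operators are multiples of the embedding of A into
    A (+) C|bot>, so that the decryption cancels against the encryption and only
    traces of [W0_j] against encrypted operators remain; these are nearly traces
    against a maximally mixed ciphertext, which vanish. *)

Set Implicit Arguments.
Unset Strict Implicit.
Unset Printing Implicit Defensive.

Import Order.TTheory GRing.Theory Num.Theory.

Local Open Scope ring_scope.
Local Open Scope complex_scope.
Local Open Scope sesquilinear_scope.

(** * Contractions and positive matrices *)

Section Norms.
Variable R : realType.
Local Notation C := R[i].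

(** The term h(p_=) dwarfs eps as soon as an attack has a noticeable identity component, so
    non-malleability is invoked only at p_= = 0, where it bounds mutual information alone. The
    obstacle is that the traceless part of a channel is not a channel: the missing weight must be
    supplied by operators that are traceless too, hence a completion by traceless matrix units
    instead of an arbitrary square root. Errors are of three kinds. Those from mutual information
    are a power of a = |A| times sqrt eps, since matrix units of A are tested one by one; r >= 12
    gives a^6 sqrt eps <= 1 and absorbs them. Errors of order 1/a come from comparing the mean
    ciphertext with the maximally mixed one, and must enter without a further factor a. The third is
    the weight with which the traceless part passes the tag test, about 4/3 times 1/d; it is an
    excess on acceptance and a deficit on rejection, hence counted twice, and 8/3 <= 4. All
    comparisons are made through |tr(V X)| for contractions V and become trace norms only at the
    very end. *)

Definition abs (z : C) : R := complex.Re `|z|.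

Lemma absE (z : C) : (abs z)%:C = `|z|.
Proof. by rewrite /abs RRe_real ?normr_real. Qed.

Lemma abs_ge0 z : 0 <= abs z.
Proof. by rewrite -ler0c absE. Qed.

Lemma absM z w : abs (z * w) = abs z * abs w.
Proof. by apply: complexI; rewrite rmorphM /= !absE normrM. Qed.

Lemma abs_conj z : abs z^*%R = abs z.
Proof. by rewrite /abs norm_conjC. Qed.

Lemma ler_absD z w : abs (z + w) <= abs z + abs w.
Proof. by rewrite -lecR rmorphD /= !absE ler_normD. Qed.

Lemma absN z : abs (- z) = abs z.
Proof. by rewrite /abs normrN. Qed.

Lemma abs0 : abs 0 = 0.
Proof. by rewrite /abs normr0. Qed.

Lemma ler_abs_sum (I : Type) (r : seq I) (P : pred I) (F : I -> C) :
  abs (\sum_(i <- r | P i) F i) <= \sum_(i <- r | P i) abs (F i).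
Proof.
elim/big_rec2: _ => [|i x y _ le_xy]; first by rewrite abs0.
by apply: le_trans (ler_absD _ _) _; rewrite lerD2l.
Qed.

Lemma Re_le_abs z : complex.Re z <= abs z.
Proof. by rewrite -lecR absE (le_trans _ (normc_ge_Re z)) // lecR ler_norm. Qed.

Lemma abs_real (x : R) : abs x%:C = `|x|.
Proof.
apply: complexI; rewrite absE; case: (lerP 0 x) => hx.
  by rewrite !ger0_norm ?ler0c.
by rewrite !ltr0_norm ?rmorphN //= ltcR.
Qed.

Lemma conjC_complex (z : C) : z^*%R = conjc z.
Proof. by []. Qed.

Lemma sqr_abs z : (abs z ^+ 2)%:C = z^*%R * z.
Proof. by rewrite rmorphXn /= absE sqr_normc mulrC. Qed.

(** The squared Hilbert-Schmidt norm. Keeping the square makes it additive over blocks and over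
    Kraus families. *)
Definition hs m n (X : 'M[C]_(m, n)) : R := \sum_i \sum_j abs (X i j) ^+ 2.

Lemma hs_ge0 m n (X : 'M[C]_(m, n)) : 0 <= hs X.
Proof. by apply: sumr_ge0 => i _; apply: sumr_ge0 => j _; exact: sqr_ge0. Qed.

Lemma adjE m n (X : 'M[C]_(m, n)) i j : X^t* i j = (X j i)^*%R.
Proof. by rewrite !mxE. Qed.

Lemma adjM m n p (X : 'M[C]_(m, n)) (Y : 'M[C]_(n, p)) :
  (X *m Y)^t* = Y^t* *m X^t*.
Proof. by rewrite trmx_mul map_mxM. Qed.

Lemma adjD m n (X Y : 'M[C]_(m, n)) : (X + Y)^t* = X^t* + Y^t*.
Proof. by rewrite linearD map_mxD. Qed.

Lemma adjB m n (X Y : 'M[C]_(m, n)) : (X - Y)^t* = X^t* - Y^t*.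
Proof. by rewrite linearB map_mxB. Qed.

Lemma adjCZ m n (z : C) (X : 'M[C]_(m, n)) : (z *: X)^t* = z^*%R *: X^t*.
Proof. by rewrite linearZ map_mxZ. Qed.

Lemma adj_sum m n (I : finType) (F : I -> 'M[C]_(m, n)) :
  (\sum_i F i)^t* = \sum_i (F i)^t*.
Proof. by apply/matrixP => i j; rewrite !(mxE, summxE) rmorph_sum; apply: eq_bigr => l _; rewrite !mxE. Qed.

Lemma adjC1 n : (1%:M : 'M[C]_n)^t* = 1%:M.
Proof. by rewrite trmx1 map_mx1. Qed.

Lemma adj_tens m n p q (X : 'M[C]_(m, n)) (Y : 'M[C]_(p, q)) :
  (X *t Y)^t* = X^t* *t Y^t*.
Proof. by rewrite trmx_tens map_mxT. Qed.

Lemma adj_delta m n i j : (delta_mx i j : 'M[C]_(m, n))^t* = delta_mx j i.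
Proof. by rewrite trmx_delta map_delta_mx. Qed.

Lemma tr_adj n (X : 'M[C]_n) : \tr (X^t*) = (\tr X)^*%R.
Proof. by rewrite raddf_sum; apply: eq_bigr => i _; rewrite adjE. Qed.

Lemma trace_adj_mul m n (X : 'M[C]_(m, n)) : \tr (X^t* *m X) = (hs X)%:C.
Proof.
rewrite /hs exchange_big rmorph_sum; apply: eq_bigr => j _.
rewrite mxE rmorph_sum; apply: eq_bigr => i _.
by rewrite adjE /= -sqr_abs.
Qed.

Lemma trace_mul_adj m n (X : 'M[C]_(m, n)) : \tr (X *m X^t*) = (hs X)%:C.
Proof. by rewrite mxtrace_mulC trace_adj_mul. Qed.

Lemma hs_adj m n (X : 'M[C]_(m, n)) : hs (X^t*) = hs X.
Proof. by apply: complexI; rewrite -!trace_adj_mul trmxCK mxtrace_mulC. Qed.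

Lemma hsZ m n (z : C) (X : 'M[C]_(m, n)) : hs (z *: X) = abs z ^+ 2 * hs X.
Proof.
rewrite /hs mulr_sumr; apply: eq_bigr => i _; rewrite mulr_sumr.
by apply: eq_bigr => j _; rewrite mxE absM exprMn.
Qed.

Lemma hs_eq0 m n (X : 'M[C]_(m, n)) : hs X = 0 -> X = 0.
Proof.
move=> /eqP; rewrite psumr_eq0; last first.
  by move=> i _; apply: sumr_ge0 => j _; exact: sqr_ge0.
move=> /allP X0; apply/matrixP => i j; rewrite mxE.
have := X0 i (mem_index_enum _); rewrite psumr_eq0; last first.
  by move=> l _; exact: sqr_ge0.
move=> /allP/(_ j (mem_index_enum _)); rewrite sqrf_eq0 => /eqP Xij0.
by apply/eqP; rewrite -normr_eq0 -absE Xij0.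
Qed.

(** Cauchy-Schwarz in its AM-GM form, entry by entry; unlike the product form it can be summed over
    families of operators. *)
Lemma abs_tr m n (X Y : 'M[C]_(m, n)) :
  2 * abs (\tr (X^t* *m Y)) <= hs X + hs Y.
Proof.
have -> : \tr (X^t* *m Y) = \sum_i \sum_j (X i j)^*%R * Y i j.
  rewrite /mxtrace exchange_big; apply: eq_bigr => j _; rewrite mxE.
  by apply: eq_bigr => i _; rewrite adjE.
rewrite /hs -big_split (le_trans (ler_wpM2l _ (ler_abs_sum _ _ _))) // mulr_sumr.
apply: ler_sum => i _; rewrite -big_split.
rewrite (le_trans (ler_wpM2l _ (ler_abs_sum _ _ _))) // mulr_sumr.
apply: ler_sum => j _ /=; rewrite absM abs_conj.
have := sqr_ge0 (abs (X i j) - abs (Y i j)); nra.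
Qed.

(** Operator norm at most 1. Arbitrary width p makes stability under tensoring with an identity a
    matter of cutting X into blocks. *)
Definition contr m n (V : 'M[C]_(m, n)) : Prop :=
  forall p (X : 'M[C]_(n, p)), hs (V *m X) <= hs X.

(** Choosing H = V X turns the hypothesis into 2 hs (V X) <= hs X + hs (V X). *)
Lemma contr_bil m n (V : 'M[C]_(m, n)) :
  (forall p (G : 'M[C]_(n, p)) (H : 'M[C]_(m, p)),
    2 * abs (\tr (H^t* *m (V *m G))) <= hs G + hs H) -> contr V.
Proof.
move=> hV p X; have := hV p X (V *m X).
rewrite trace_adj_mul abs_real ger0_norm ?hs_ge0 //; lra.
Qed.

Lemma contr_tr m n p (V : 'M[C]_(m, n)) (G : 'M[C]_(n, p)) (H : 'M[C]_(m, p)) :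
  contr V -> 2 * abs (\tr (H^t* *m (V *m G))) <= hs G + hs H.
Proof.
move=> cV; apply: le_trans (abs_tr _ _) _; rewrite addrC lerD2r; exact: cV.
Qed.

Lemma contr_adj m n (V : 'M[C]_(m, n)) : contr V -> contr (V^t*).
Proof.
move=> cV; apply: contr_bil => p G H.
have -> : \tr (H^t* *m (V^t* *m G)) = (\tr (G^t* *m (V *m H)))^*%R.
  by rewrite -tr_adj !adjM trmxCK mulmxA.
by rewrite abs_conj addrC; apply: contr_tr.
Qed.

Lemma contrM m n p (V : 'M[C]_(m, n)) (W : 'M[C]_(n, p)) :
  contr V -> contr W -> contr (V *m W).
Proof. by move=> cV cW q X; rewrite -mulmxA (le_trans (cV _ _)). Qed.

Lemma hs_isometry m n p (V : 'M[C]_(m, n)) (X : 'M[C]_(n, p)) :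
  V^t* *m V = 1%:M -> hs (V *m X) = hs X.
Proof.
move=> VV; apply: complexI.
by rewrite -!trace_adj_mul adjM -mulmxA (mulmxA (V^t*)) VV mul1mx.
Qed.

Lemma contr_isometry m n (V : 'M[C]_(m, n)) : V^t* *m V = 1%:M -> contr V.
Proof. by move=> VV p X; rewrite hs_isometry. Qed.

Lemma contr1 n : contr (1%:M : 'M[C]_n).
Proof. by move=> p X; rewrite mul1mx. Qed.

Lemma hsD_le m n (X Y : 'M[C]_(m, n)) : hs (X + Y) <= 2 * hs X + 2 * hs Y.
Proof.
rewrite /hs !mulr_sumr -big_split; apply: ler_sum => i _ /=.
rewrite !mulr_sumr -big_split; apply: ler_sum => j _ /=; rewrite mxE.
have h1 := ler_absD (X i j) (Y i j).
have h2 := sqr_ge0 (abs (X i j) - abs (Y i j)).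
have h3 := abs_ge0 (X i j + Y i j).
have h4 : abs (X i j + Y i j) ^+ 2 <= (abs (X i j) + abs (Y i j)) ^+ 2.
  by rewrite lerXn2r // nnegrE ?addr_ge0 ?abs_ge0.
nra.
Qed.

Lemma contr_delta m n i j : contr (delta_mx i j : 'M[C]_(m, n)).
Proof.
move=> p X; rewrite {2}/hs (bigD1 j) //= {1}/hs (bigD1 i) //=.
have e k l : (delta_mx i j *m X) k l = (k == i)%:R * X j l.
  rewrite mxE (bigD1 j) //= big1 ?addr0 => [|q qj].
    by rewrite mxE eqxx andbT.
  by rewrite mxE (negbTE qj) andbF mul0r.
rewrite [X in _ + X <= _]big1 ?addr0 => [|k ki]; last first.
  by rewrite big1 // => l _; rewrite e (negbTE ki) mul0r abs0 expr0n.
under eq_bigr do rewrite e eqxx mul1r.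
rewrite lerDl; apply: sumr_ge0 => k _; apply: sumr_ge0 => l _; exact: sqr_ge0.
Qed.

Lemma sum_mxtens (V : nmodType) m n (F : 'I_(m * n) -> V) :
  \sum_k F k = \sum_i \sum_j F (mxtens_index (i, j)).
Proof.
rewrite pair_big (reindex (@mxtens_index m n)) /=.
  by apply: eq_bigr => -[i j].
by exists (@mxtens_unindex m n) => i _; rewrite (mxtens_indexK, mxtens_unindexK).
Qed.

Lemma hs_sum_blocks1 m n p (X : 'M[C]_(m * n, p)) :
  hs X = \sum_l hs (\matrix_(i, q) X (mxtens_index (i, l)) q).
Proof.
rewrite /hs sum_mxtens exchange_big; apply: eq_bigr => l _.
by apply: eq_bigr => i _; apply: eq_bigr => j _; rewrite mxE.
Qed.

Lemma hs_sum_blocks2 m n p (X : 'M[C]_(m * n, p)) :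
  hs X = \sum_l hs (\matrix_(i, q) X (mxtens_index (l, i)) q).
Proof.
rewrite /hs sum_mxtens; apply: eq_bigr => l _.
by apply: eq_bigr => i _; apply: eq_bigr => j _; rewrite mxE.
Qed.

Lemma contr_tens1 m n p (V : 'M[C]_(m, n)) :
  contr V -> contr (V *t (1%:M : 'M_p)).
Proof.
move=> cV q X; rewrite !hs_sum_blocks1; apply: ler_sum => l _.
apply: le_trans (cV _ _); rewrite le_eqVlt; apply/orP; left; apply/eqP; congr hs.
apply/matrixP => i k; rewrite !mxE sum_mxtens; apply: eq_bigr => j _.
rewrite (bigD1 l) //= tensmxE !mxE eqxx mulr1 big1 ?addr0 // => r rl.
by rewrite tensmxE mxE eq_sym (negbTE rl) mulr0 mul0r.
Qed.

Lemma contr_1tens m n p (V : 'M[C]_(m, n)) :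
  contr V -> contr ((1%:M : 'M_p) *t V).
Proof.
move=> cV q X; rewrite !hs_sum_blocks2; apply: ler_sum => l _.
apply: le_trans (cV _ _); rewrite le_eqVlt; apply/orP; left; apply/eqP; congr hs.
apply/matrixP => i k; rewrite !mxE sum_mxtens (bigD1 l) //=.
rewrite [X in _ + X]big1 ?addr0 => [|r rl].
  by apply: eq_bigr => j _; rewrite tensmxE !mxE eqxx mul1r.
rewrite big1 // => j _.
by rewrite tensmxE mxE eq_sym (negbTE rl) mul0r mul0r.
Qed.

Lemma contr_tens m n p q (V : 'M[C]_(m, n)) (W : 'M[C]_(p, q)) :
  contr V -> contr W -> contr (V *t W).
Proof.
move=> cV cW; rewrite -[V]mulmx1 -[W]mul1mx -tensmx_mul.
by apply: contrM; [exact: contr_tens1 | exact: contr_1tens].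
Qed.

Lemma psd_adj_mul m n (X : 'M[C]_(m, n)) : psd (X^t* *m X).
Proof.
move=> v; have -> : v^t* *m (X^t* *m X) *m v = (X *m v)^t* *m (X *m v).
  by rewrite adjM !mulmxA.
by have := trace_adj_mul (X *m v); rewrite /mxtrace big_ord1 => ->; rewrite ler0c hs_ge0.
Qed.

Lemma psd_mul_adj m n (X : 'M[C]_(m, n)) : psd (X *m X^t*).
Proof. by rewrite -{1}[X]trmxCK; apply: psd_adj_mul. Qed.

Lemma psdD n (X Y : 'M[C]_n) : psd X -> psd Y -> psd (X + Y).
Proof. by move=> hX hY v; rewrite mulmxDr mulmxDl mxE addr_ge0 ?hX ?hY. Qed.

Lemma psd0 n : psd (0 : 'M[C]_n).
Proof. by move=> v; rewrite mulmx0 mul0mx mxE. Qed.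

Lemma psd_sum n (I : finType) (P : pred I) (F : I -> 'M[C]_n) :
  (forall i, psd (F i)) -> psd (\sum_(i | P i) F i).
Proof.
by move=> hF; elim/big_ind: _ => [||i _]; [exact: psd0 | exact: psdD | exact: hF].
Qed.

Lemma psdZ n (z : R) (X : 'M[C]_n) : 0 <= z -> psd X -> psd (z%:C *: X).
Proof.
move=> z0 hX v; rewrite -scalemxAr -scalemxAl mxE mulr_ge0 ?ler0c //; exact: hX.
Qed.

Lemma psd_conj m n (X : 'M[C]_n) (K : 'M[C]_(m, n)) : psd X -> psd (K *m X *m K^t*).
Proof.
move=> hX v; have := hX (K^t* *m v).
by rewrite adjM trmxCK !mulmxA.
Qed.

Lemma mxE_form n (X : 'M[C]_n) i j :
  (delta_mx 0 i : 'rV_n) *m X *m (delta_mx j 0 : 'cV_n) = (X i j)%:M.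
Proof.
rewrite -rowE -colE; apply/matrixP => k l; rewrite !mxE.
by rewrite !ord1.
Qed.

Lemma psd_diag_ge0 n (X : 'M[C]_n) i : psd X -> 0 <= X i i.
Proof.
move=> hX; have := hX (delta_mx i 0); rewrite adj_delta mxE_form.
by rewrite mxE mulr1n.
Qed.

Lemma psd_herm n (X : 'M[C]_n) : psd X -> X^t* = X.
Proof.
move=> hX; apply/matrixP => i j; rewrite adjE.
(* The form is real at e_i + z e_j; the vanishing imaginary parts at z = 1 and z = i determine
   [X j i] from [X i j]. *)
have f (z : C) : 0 <= X i i + z * X i j + z^*%R * X j i + z^*%R * z * X j j.
  have := hX (delta_mx i 0 + z *: delta_mx j 0).
  rewrite adjD adjCZ !adj_delta !(mulmxDl, mulmxDr) -!(scalemxAl, scalemxAr).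
  rewrite !mxE_form !mxE !mulr1n.
  by congr (0 <= _); ring.
have hi := ger0_Im (psd_diag_ge0 i hX); have hj := ger0_Im (psd_diag_ge0 j hX).
have := ger0_Im (f 1); have := ger0_Im (f 'i%C).
rewrite !conjC_complex.
case: (X i j) (X j i) hi hj => a b [c d]; case: (X i i) => e1 e2; case: (X j j) => e3 e4 /=.
simpc => /= -> -> h1 h2; apply/eqP; rewrite eq_complex /=; apply/andP; split; apply/eqP; lra.
Qed.

Definition cvec n (l : 'I_n -> R) : 'rV[C]_n := \row_i (l i)%:C.

Lemma herm_spectral n (X : 'M[C]_n) : X^t* = X ->
  exists P : 'M[C]_n, [/\ P^t* *m P = 1%:M, P *m P^t* = 1%:M &
    X = P^t* *m diag_mx (cvec (eigval X)) *m P].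
Proof.
move=> hX; exists (spectralmx X).
have hU := spectral_unitarymx X.
have HX : X \is hermsymmx.
  by apply/is_hermitianmxP; rewrite expr0 scale1r hX.
split; last first.
- have -> : cvec (eigval X) = spectral_diag X.
    apply/matrixP => i j; rewrite !mxE /eigval !ord1 RRe_real //.
    by have /mxOverP := hermitian_spectral_diag_real HX.
  have /orthomx_spectralP {1}-> := hermitian_normalmx HX.
  by rewrite invmx_unitary.
- exact/unitarymxP.
- by rewrite -invmx_unitary // mulVmx // unitarymx_unit.
Qed.

Lemma psd_eigval_ge0 n (X : 'M[C]_n) i : psd X -> 0 <= eigval X i.
Proof.
move=> hX; have [P [PP PP' XE]] := herm_spectral (psd_herm hX).
have := psd_diag_ge0 i (psd_conj P hX); rewrite {1}XE !mulmxA PP' mul1mx.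
rewrite -mulmxA PP' mulmx1 mxE eqxx mulr1n mxE ler0c; exact.
Qed.

Lemma psd_factor n (X : 'M[C]_n) : psd X -> exists S : 'M[C]_n, X = S^t* *m S.
Proof.
move=> hX; have [P [PP PP' XE]] := herm_spectral (psd_herm hX).
exists (diag_mx (cvec (fun i => Num.sqrt (eigval X i))) *m P).
rewrite adjM {1}XE -!mulmxA; congr (_ *m _); rewrite !mulmxA; congr (_ *m _).
apply/matrixP => i j; rewrite !mxE (bigD1 i) //= big1 ?addr0 => [|k ki].
  rewrite !mxE eqxx mulr1n conjC_complex conjc_real.
  case: eqP => [_|]; last by rewrite mulr0n mulr0.
  by rewrite mulr1n -rmorphM -expr2 sqr_sqrtr // psd_eigval_ge0.
by rewrite !mxE (negbTE ki) mulr0n conjC0 mul0r.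
Qed.

End Norms.

(** * Tensor maps and Kraus families *)

Section Maps.
Variable R : realType.
Local Notation C := R[i].
Local Notation op n := 'M[C]_n%N.

Section Linear.
Variables (U V : lmodType C) (f : U -> V).
Hypothesis lf : linear f.

Lemma lin_0 : f 0 = 0.
Proof.
by have := lf (-1) 0 0; rewrite scaler0 addr0 scaleN1r addNr.
Qed.

Lemma lin_D x y : f (x + y) = f x + f y.
Proof. by have := lf 1 x y; rewrite !scale1r. Qed.

Lemma lin_Z a x : f (a *: x) = a *: f x.
Proof. by have := lf a x 0; rewrite lin_0 !addr0. Qed.

Lemma lin_N x : f (- x) = - f x.
Proof. by rewrite -scaleN1r lin_Z scaleN1r. Qed.

Lemma lin_B x y : f (x - y) = f x - f y.
Proof. by rewrite lin_D lin_N. Qed.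

Lemma lin_sum (I : Type) (r : seq I) (P : pred I) (F : I -> U) :
  f (\sum_(i <- r | P i) F i) = \sum_(i <- r | P i) f (F i).
Proof.
elim/big_rec2: _ => [|i x y _ <-]; first exact: lin_0.
by rewrite lin_D.
Qed.
End Linear.

Lemma linear_comp (U V W : lmodType C) (f : V -> W) (g : U -> V) :
  linear f -> linear g -> linear (fun x => f (g x)).
Proof. by move=> lf lg a x y; rewrite lg lf. Qed.

Lemma linear_bigsum (U V : lmodType C) (I : finType) (f : I -> U -> V) :
  (forall i, linear (f i)) -> linear (fun x => \sum_i f i x).
Proof.
move=> lf a x y; rewrite scaler_sumr -big_split; apply: eq_bigr => i _.
exact: lf.
Qed.

Lemma linear_scale (U V : lmodType C) z (f : U -> V) :
  linear f -> linear (fun x => z *: f x).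
Proof. by move=> lf a x y; rewrite lf scalerDr !scalerA mulrC. Qed.

Lemma tensDl m n p q (X Y : 'M[C]_(m, n)) (Z : 'M[C]_(p, q)) :
  (X + Y) *t Z = X *t Z + Y *t Z.
Proof. by apply/matrixP => i j; rewrite !mxE mulrDl. Qed.

Lemma tensDr m n p q (X Y : 'M[C]_(m, n)) (Z : 'M[C]_(p, q)) :
  Z *t (X + Y) = Z *t X + Z *t Y.
Proof. by apply/matrixP => i j; rewrite !mxE mulrDr. Qed.

Lemma tensZl m n p q z (X : 'M[C]_(m, n)) (Z : 'M[C]_(p, q)) :
  (z *: X) *t Z = z *: (X *t Z).
Proof. by apply/matrixP => i j; rewrite !mxE mulrA. Qed.

Lemma tensZr m n p q z (X : 'M[C]_(m, n)) (Z : 'M[C]_(p, q)) :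
  Z *t (z *: X) = z *: (Z *t X).
Proof. by apply/matrixP => i j; rewrite !mxE mulrCA. Qed.

Lemma linear_tensl m n p q (Z : 'M[C]_(p, q)) :
  linear (fun X : 'M[C]_(m, n) => X *t Z).
Proof. by move=> a X Y; rewrite tensDl tensZl. Qed.

Lemma linear_tensr m n p q (Z : 'M[C]_(p, q)) :
  linear (fun X : 'M[C]_(m, n) => Z *t X).
Proof. by move=> a X Y; rewrite tensDr tensZr. Qed.

Lemma tens_suml m n p q (I : finType) (P : pred I) (F : I -> 'M[C]_(m, n)) (Z : 'M[C]_(p, q)) :
  (\sum_(i | P i) F i) *t Z = \sum_(i | P i) F i *t Z.
Proof. exact: (lin_sum (linear_tensl Z)). Qed.

Lemma tens_sumr m n p q (I : finType) (P : pred I) (F : I -> 'M[C]_(m, n)) (Z : 'M[C]_(p, q)) :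
  Z *t (\sum_(i | P i) F i) = \sum_(i | P i) Z *t F i.
Proof. exact: (lin_sum (linear_tensr Z)). Qed.

Lemma tens11 m n : (1%:M : op m) *t (1%:M : op n) = 1%:M.
Proof.
apply/matrixP => i j; case: (mxtens_indexP i) => a b; case: (mxtens_indexP j) => c d.
rewrite tensmxE !mxE (can_eq (@mxtens_indexK m n)) xpair_eqE.
by case: (a == c); case: (b == d); rewrite ?mulr1 ?mulr0.
Qed.

Lemma trace_tens m n (X : op m) (Y : op n) : \tr (X *t Y) = \tr X * \tr Y.
Proof.
rewrite /mxtrace sum_mxtens mulr_suml; apply: eq_bigr => i _.
by rewrite mulr_sumr; apply: eq_bigr => j _; rewrite tensmxE.
Qed.

Lemma mulmx_deltal m n p (X : 'M[C]_(n, p)) (i : 'I_m) j k l :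
  (delta_mx i j *m X) k l = (k == i)%:R * X j l.
Proof.
rewrite mxE (bigD1 j) //= big1 ?addr0 => [|q qj].
  by rewrite mxE eqxx andbT.
by rewrite mxE (negbTE qj) andbF mul0r.
Qed.

Lemma mulmx_deltar m n p (X : 'M[C]_(n, m)) (i : 'I_m) (j : 'I_p) k l :
  (X *m delta_mx i j) k l = X k i * (l == j)%:R.
Proof.
rewrite mxE (bigD1 i) //= big1 ?addr0 => [|q qj].
  by rewrite mxE eqxx.
by rewrite mxE (negbTE qj) mulr0.
Qed.

Lemma trace_delta_mul m n (X : 'M[C]_(m, n)) i j : \tr (delta_mx j i *m X) = X i j.
Proof.
rewrite /mxtrace (bigD1 j) //= big1 => [|k kj].
  by rewrite mulmx_deltal eqxx mul1r addr0.
by rewrite mulmx_deltal (negbTE kj) mul0r.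
Qed.

Lemma sum_deltas m n (X : 'M[C]_(m, n)) :
  X = \sum_i \sum_j X i j *: delta_mx i j.
Proof. exact: matrix_sum_delta. Qed.

Lemma slice1_sum m n (X : op (m * n)) :
  X = \sum_l \sum_l' slice1 X l l' *t delta_mx l l'.
Proof.
apply/matrixP => i j; case: (mxtens_indexP i) => a b; case: (mxtens_indexP j) => c d.
rewrite summxE (bigD1 b) //= [X in _ + X]big1 ?addr0 => [|l lb]; last first.
  rewrite summxE big1 // => k _; rewrite tensmxE !mxE eq_sym (negbTE lb) mulr0; done.
rewrite summxE (bigD1 d) //= [X in _ + X]big1 ?addr0 => [|l lb]; last first.
  by rewrite tensmxE !mxE eqxx (eq_sym d) (negbTE lb) mulr0.
by rewrite tensmxE !mxE !eqxx mulr1.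
Qed.

(** Product operators span, so identities between compositions of [on1], [on2], [swap], [trr] and
    [trl] need checking on products only. *)
Lemma tens_ext m n (V : lmodType C) (f g : op (m * n) -> V) :
  linear f -> linear g -> (forall X Y, f (X *t Y) = g (X *t Y)) ->
  forall X, f X = g X.
Proof.
move=> lf lg fg X; rewrite (slice1_sum X) (lin_sum lf) (lin_sum lg).
apply: eq_bigr => l _; rewrite (lin_sum lf) (lin_sum lg).
by apply: eq_bigr => l' _.
Qed.

Lemma slice1_tens m n (X : op m) (Y : op n) l l' :
  slice1 (X *t Y) l l' = Y l l' *: X.
Proof. by apply/matrixP => i j; rewrite mxE tensmxE mxE mulrC. Qed.

Lemma slice2_tens m n (X : op m) (Y : op n) l l' :
  slice2 (X *t Y) l l' = X l l' *: Y.
Proof. by apply/matrixP => i j; rewrite mxE tensmxE mxE. Qed.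

Lemma linear_slice1 m n l l' : linear (fun X : op (m * n) => slice1 X l l').
Proof. by move=> a X Y; apply/matrixP => i j; rewrite !mxE. Qed.

Lemma linear_slice2 m n l l' : linear (fun X : op (m * n) => slice2 X l l').
Proof. by move=> a X Y; apply/matrixP => i j; rewrite !mxE. Qed.

Lemma linear_trr m n : linear (@trr R m n).
Proof. by apply: linear_bigsum => l; apply: linear_slice1. Qed.

Lemma linear_trl m n : linear (@trl R m n).
Proof. by apply: linear_bigsum => l; apply: linear_slice2. Qed.

Lemma linear_on1 m m' n (f : op m -> op m') : linear f -> linear (@on1 R m m' n f).
Proof.
move=> lf; apply: linear_bigsum => l; apply: linear_bigsum => l'.
apply: (linear_comp (linear_tensl _)); apply: linear_comp lf _.
exact: linear_slice1.
Qed.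

Lemma linear_on2 m m' n (f : op m -> op m') : linear f -> linear (@on2 R n m m' f).
Proof.
move=> lf; apply: linear_bigsum => l; apply: linear_bigsum => l'.
apply: (linear_comp (linear_tensr _)); apply: linear_comp lf _.
exact: linear_slice2.
Qed.

Lemma linear_swap m n p : linear (@swap R m n p).
Proof. by move=> a X Y; apply/matrixP => i j; rewrite !mxE. Qed.

Lemma on1_tens m m' n (f : op m -> op m') (X : op m) (Y : op n) :
  linear f -> on1 f (X *t Y) = f X *t Y.
Proof.
move=> lf; rewrite /on1 {2}(sum_deltas Y) tens_sumr; apply: eq_bigr => l _.
rewrite tens_sumr; apply: eq_bigr => l' _.
by rewrite slice1_tens (lin_Z lf) tensZl tensZr.
Qed.

Lemma on2_tens m m' n (f : op m -> op m') (X : op n) (Y : op m) :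
  linear f -> on2 f (X *t Y) = X *t f Y.
Proof.
move=> lf; rewrite /on2 {2}(sum_deltas X) tens_suml; apply: eq_bigr => l _.
rewrite tens_suml; apply: eq_bigr => l' _.
by rewrite slice2_tens (lin_Z lf) tensZl tensZr.
Qed.

Lemma trr_tens m n (X : op m) (Y : op n) : trr (X *t Y) = \tr Y *: X.
Proof.
rewrite /trr /mxtrace scaler_suml; apply: eq_bigr => l _; exact: slice1_tens.
Qed.

Lemma trl_tens m n (X : op m) (Y : op n) : trl (X *t Y) = \tr X *: Y.
Proof.
rewrite /trl /mxtrace scaler_suml; apply: eq_bigr => l _; exact: slice2_tens.
Qed.

Definition swap_idx m n p (i : 'I_(m * p * n)) : 'I_(m * n * p) :=
  let: (xz, y) := mxtens_unindex i in
  let: (x, z) := mxtens_unindex xz in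
  mxtens_index (mxtens_index (x, y), z).

Lemma swapE m n p (X : op (m * n * p)) i j : swap X i j = X (swap_idx i) (swap_idx j).
Proof. by rewrite mxE. Qed.

Lemma swap_idxE m n p (x : 'I_m) (y : 'I_n) (z : 'I_p) :
  swap_idx (mxtens_index (mxtens_index (x, z), y)) = mxtens_index (mxtens_index (x, y), z).
Proof. by rewrite /swap_idx !mxtens_indexK. Qed.

Lemma swap_idxK m n p : cancel (@swap_idx m n p) (@swap_idx m p n).
Proof.
move=> i; case: (mxtens_indexP i) => xz y; case: (mxtens_indexP xz) => x z.
by rewrite !swap_idxE.
Qed.

Lemma swap_tens m n p (X : op m) (Y : op n) (Z : op p) :
  swap (X *t Y *t Z) = X *t Z *t Y.
Proof.
apply/matrixP => i j; rewrite swapE.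
case: (mxtens_indexP i) => xz y; case: (mxtens_indexP xz) => x z {i xz}.
case: (mxtens_indexP j) => xz' y'; case: (mxtens_indexP xz') => x' z' {j xz'}.
by rewrite !swap_idxE !tensmxE mulrAC.
Qed.

Lemma swapK m n p : cancel (@swap R m n p) (@swap R m p n).
Proof. by move=> X; apply/matrixP => i j; rewrite !swapE !swap_idxK. Qed.

Lemma swapM m n p (X Y : op (m * n * p)) : swap (X *m Y) = swap X *m swap Y.
Proof.
apply/matrixP => i j; rewrite swapE !mxE.
rewrite (reindex (@swap_idx m n p)) /=; last first.
  by exists (@swap_idx m p n) => k _; rewrite swap_idxK.
by apply: eq_bigr => k _; rewrite !swapE.
Qed.

Lemma tr_swap m n p (X : op (m * n * p)) : \tr (swap X) = \tr X.
Proof.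
rewrite /mxtrace [RHS](reindex (@swap_idx m n p)) /=; last first.
  by exists (@swap_idx m p n) => k _; rewrite swap_idxK.
by apply: eq_bigr => k _; rewrite !swapE.
Qed.

Lemma swap_adj m n p (X : op (m * n * p)) : swap (X^t*) = (swap X)^t*.
Proof. by apply/matrixP => i j; rewrite !swapE !adjE !swapE. Qed.

Lemma contr_swap m n p (V : op (m * n * p)) : contr V -> contr (swap V).
Proof.
move=> cV q X.
pose s (Y : 'M[C]_(m * p * n, q)) : 'M[C]_(m * n * p, q) := \matrix_(i, j) Y (swap_idx i) j.
have hs_s Y : hs (s Y) = hs Y.
  rewrite /hs [RHS](reindex (@swap_idx m p n)) /=; last first.
    by exists (@swap_idx m n p) => k _; rewrite swap_idxK.
  by apply: eq_bigr => i _; apply: eq_bigr => j _; rewrite mxE.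
have -> : hs (swap V *m X) = hs (V *m s X).
  rewrite -hs_s; congr hs; apply/matrixP => i j; rewrite !mxE.
  rewrite (reindex (@swap_idx m p n)) /=; last first.
    by exists (@swap_idx m n p) => k _; rewrite swap_idxK.
  by apply: eq_bigr => k _; rewrite !swapE !swap_idxK mxE.
by rewrite -(hs_s X); apply: cV.
Qed.

Definition kraus (I : finType) m n (K : I -> 'M[C]_(n, m)) (X : op m) : op n :=
  \sum_i K i *m X *m (K i)^t*.

Lemma linear_kraus (I : finType) m n (K : I -> 'M[C]_(n, m)) : linear (kraus K).
Proof.
apply: linear_bigsum => i a X Y.
by rewrite mulmxDr mulmxDl -scalemxAr -scalemxAl.
Qed.

Lemma kraus_adj_mul (I : finType) m n p (K : I -> 'M[C]_(n, m)) (X : 'M[C]_(m, p)) :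
  kraus K (X *m X^t*) = \sum_i (K i *m X) *m (K i *m X)^t*.
Proof. by apply: eq_bigr => i _; rewrite adjM !mulmxA. Qed.

Lemma psd_kraus (I : finType) m n (K : I -> 'M[C]_(n, m)) X :
  psd X -> psd (kraus K X).
Proof. by move=> hX; apply: psd_sum => i; apply: psd_conj. Qed.

Lemma on1_kraus (I : finType) m n p (K : I -> 'M[C]_(n, m)) (X : op (m * p)) :
  on1 (kraus K) X = kraus (fun i => K i *t 1%:M) X.
Proof.
move: X; apply: tens_ext; [exact/linear_on1/linear_kraus | exact: linear_kraus |].
move=> X Y; rewrite on1_tens; last exact: linear_kraus.
rewrite /kraus tens_suml; apply: eq_bigr => i _.
by rewrite adj_tens adjC1 !tensmx_mul mul1mx mulmx1.
Qed.

Lemma on2_kraus (I : finType) m n p (K : I -> 'M[C]_(n, m)) (X : op (p * m)) :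
  on2 (kraus K) X = kraus (fun i => 1%:M *t K i) X.
Proof.
move: X; apply: tens_ext; [exact/linear_on2/linear_kraus | exact: linear_kraus |].
move=> X Y; rewrite on2_tens; last exact: linear_kraus.
rewrite /kraus tens_sumr; apply: eq_bigr => i _.
by rewrite adj_tens adjC1 !tensmx_mul mul1mx mulmx1.
Qed.

Lemma eq_on1 m n p (f g : op m -> op n) (X : op (m * p)) : (forall Y, f Y = g Y) -> on1 f X = on1 g X.
Proof. by move=> fg; do 2!apply: eq_bigr => ? _; rewrite fg. Qed.

Lemma cp_kraus (I : finType) m n (K : I -> 'M[C]_(n, m)) :
  completely_positive (kraus K).
Proof.
split=> [|p X hX]; first exact: linear_kraus.
by rewrite on1_kraus; apply: psd_kraus.
Qed.

Lemma eq_cp m n (f g : op m -> op n) : (forall X, f X = g X) ->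
  completely_positive f -> completely_positive g.
Proof.
move=> fg [lf cf]; split=> [a X Y|p X hX]; first by rewrite -!fg lf.
by rewrite -(eq_on1 _ fg); apply: cf.
Qed.

(** Choi's theorem: [u] is the unnormalized maximally entangled vector, [on1 f (u *m u^t* )] the
    Choi matrix, and the conjugated rows of a factor S of it, reshaped, are the Kraus operators. *)
Lemma cp_krausP m n (f : op m -> op n) : completely_positive f ->
  exists (I : finType) (K : I -> 'M[C]_(n, m)), forall X, f X = kraus K X.
Proof.
move=> [lf cf].
pose u : 'cV[C]_(m * m) := \col_x (((mxtens_unindex x).1 == (mxtens_unindex x).2)%:R).
have uE : u *m u^t* = \sum_i \sum_j delta_mx i j *t delta_mx i j.
  apply/matrixP => i j; case: (mxtens_indexP i) => a b; case: (mxtens_indexP j) => c d.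
  rewrite mxE big_ord1 adjE !mxE !mxtens_indexK /= conjC_nat summxE.
  rewrite (bigD1 a) //= [X in _ + X]big1 ?addr0 => [|k ka]; last first.
    by rewrite summxE big1 // => l _; rewrite tensmxE !mxE (eq_sym a) (negbTE ka) mul0r.
  rewrite summxE (bigD1 c) //= [X in _ + X]big1 ?addr0 => [|k ka]; last first.
    by rewrite tensmxE !mxE eqxx (eq_sym c) (negbTE ka) mul0r.
  rewrite tensmxE !mxE !eqxx mul1r (eq_sym b) (eq_sym d).
  by case: (a == b); case: (c == d); rewrite ?mulr1 ?mulr0.
have [S SE] := psd_factor (cf _ _ (psd_mul_adj u)).
exists 'I_(n * m); exists (fun t => \matrix_(i, s) (S t (mxtens_index (i, s)))^*%R).
move=> X; rewrite [in LHS](sum_deltas X) [in RHS](sum_deltas X).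
rewrite (lin_sum lf) (lin_sum (linear_kraus _)); apply: eq_bigr => s _.
rewrite (lin_sum lf) (lin_sum (linear_kraus _)); apply: eq_bigr => s' _.
rewrite (lin_Z lf) (lin_Z (linear_kraus _)); congr (_ *: _).
have -> : f (delta_mx s s') = slice1 (on1 f (u *m u^t*)) s s'.
  rewrite uE (lin_sum (linear_on1 lf)) (lin_sum (linear_slice1 _ _)).
  rewrite (bigD1 s) //= [X in _ + X]big1 ?addr0 => [|k ka]; last first.
    rewrite (lin_sum (linear_on1 lf)) (lin_sum (linear_slice1 _ _)).
    rewrite big1 // => l _; rewrite on1_tens // slice1_tens mxE (eq_sym s) (negbTE ka) /=.
    by rewrite scale0r.
  rewrite (lin_sum (linear_on1 lf)) (lin_sum (linear_slice1 _ _)).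
  rewrite (bigD1 s') //= [X in _ + X]big1 ?addr0 => [|k ka]; last first.
    by rewrite on1_tens // slice1_tens mxE (eq_sym s') (negbTE ka) andbF scale0r.
  by rewrite on1_tens // slice1_tens mxE !eqxx scale1r.
apply/matrixP => i j; rewrite SE mxE summxE mxE.
apply: eq_bigr => t _; rewrite adjE.
by rewrite mxE (bigD1 s') //= big1 ?addr0 => [|k ks]; rewrite mulmx_deltar ?(negbTE ks) ?mulr0 ?mul0r // eqxx mulr1 !mxE conjCK.
Qed.

Lemma kraus_tp (I : finType) m n (K : I -> 'M[C]_(n, m)) :
  \sum_i (K i)^t* *m K i = 1%:M <-> trace_preserving (kraus K).
Proof.
have e X : \tr (kraus K X) = \tr ((\sum_i (K i)^t* *m K i) *m X).
  rewrite /kraus mulmx_suml !raddf_sum; apply: eq_bigr => i _ /=.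
  by rewrite mxtrace_mulC !mulmxA.
split=> [h X|h]; first by rewrite e h mul1mx.
apply/matrixP => i j; have := h (delta_mx j i); rewrite e => {}e.
rewrite mxtrace_mulC trace_delta_mul in e; rewrite e.
by rewrite -[delta_mx j i]mulmx1 trace_delta_mul.
Qed.

Lemma kraus_tp_hs (I : finType) m n p (K : I -> 'M[C]_(n, m)) (X : 'M[C]_(m, p)) :
  \sum_i (K i)^t* *m K i = 1%:M -> \sum_i hs (K i *m X) = hs X.
Proof.
move=> h; apply: complexI; rewrite rmorph_sum -trace_adj_mul -[X in _ *m X]mul1mx -h.
rewrite mulmx_suml mulmx_sumr raddf_sum; apply: eq_bigr => i _ /=.
by rewrite -trace_adj_mul adjM !mulmxA.
Qed.

End Maps.

(** * Pinsker's inequality *)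

Section Entropy.
Variable R : realType.
Local Notation C := R[i].
Local Notation op n := 'M[C]_n%N.

(** With x = sqrt a and y = sqrt b this is ln (y / x) <= y / x - 1 multiplied by 2 x^2. *)
Lemma klein_scalar (a b : R) : 0 <= a -> 0 <= b -> (b = 0 -> a = 0) ->
  (Num.sqrt a - Num.sqrt b) ^+ 2 <= a * ln a - a * ln b - a + b.
Proof.
move=> a0 b0 ab; case: (eqVneq a 0) => [->|an0].
  by rewrite sqrtr0 sub0r sqrrN sqr_sqrtr // !mul0r !subr0 add0r.
have bn0 : b != 0 by apply: contra an0 => /eqP /ab ->.
have apos : 0 < a by rewrite lt_def an0.
have bpos : 0 < b by rewrite lt_def bn0.
have ha := sqr_sqrtr a0; have hb := sqr_sqrtr b0.
have x0 : 0 < Num.sqrt a by rewrite sqrtr_gt0.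
have y0 : 0 < Num.sqrt b by rewrite sqrtr_gt0.
move: ha hb x0 y0; set x := Num.sqrt a; set y := Num.sqrt b => ha hb x0 y0.
have key : ln y - ln x <= y / x - 1.
  rewrite -ln_div //; have h : 0 < y / x by rewrite divr_gt0.
  by have := @le_ln1Dx R (y / x - 1); rewrite addrCA subrr addr0; apply; rewrite ltrBrDl addrN.
rewrite -ha -hb !lnXn //.
have xy : x ^+ 2 * (y / x) = x * y by field; rewrite gt_eqF.
have h := ler_wpM2l (sqr_ge0 x) key.
rewrite !mulrBr xy mulr1 in h.
have -> : ln x *+ 2 = 2 * ln x by rewrite mulr_natl.
have -> : ln y *+ 2 = 2 * ln y by rewrite mulr_natl.
nra.
Qed.

(** Klein's inequality when w holds the squared overlaps of two eigenbases. Because ln 0 = 0 here,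
    the support hypothesis has to exclude the pairs at which relative entropy would be infinite. *)
Lemma klein_weighted (I J : finType) (a : I -> R) (b : J -> R) (w : I -> J -> R) :
  (forall i, 0 <= a i) -> (forall j, 0 <= b j) -> (forall i j, 0 <= w i j) ->
  (forall i, \sum_j w i j = 1) -> (forall j, \sum_i w i j = 1) ->
  (forall i j, b j = 0 -> w i j * a i = 0) ->
  \sum_i \sum_j w i j * (Num.sqrt (a i) - Num.sqrt (b j)) ^+ 2 <=
  \sum_i a i * ln (a i) - \sum_i \sum_j w i j * a i * ln (b j) - \sum_i a i + \sum_j b j.
Proof.
move=> a0 b0 w0 w1 w2 supp.
have -> : \sum_i a i * ln (a i) = \sum_i \sum_j w i j * (a i * ln (a i)).
  by apply: eq_bigr => i _; rewrite -mulr_suml w1 mul1r.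
have -> : \sum_i a i = \sum_i \sum_j w i j * a i.
  by apply: eq_bigr => i _; rewrite -mulr_suml w1 mul1r.
have -> : \sum_j b j = \sum_i \sum_j w i j * b j.
  by rewrite exchange_big; apply: eq_bigr => j _; rewrite -mulr_suml w2 mul1r.
rewrite -!sumrB -big_split; apply: ler_sum => i _ /=.
rewrite -!sumrB -big_split; apply: ler_sum => j _ /=.
have [-> |wn0] := eqVneq (w i j) 0; first by rewrite !mul0r !subr0 addr0.
have -> : w i j * (a i * ln (a i)) - w i j * a i * ln (b j) - w i j * a i + w i j * b j
  = w i j * (a i * ln (a i) - a i * ln (b j) - a i + b j) by ring.
apply: ler_wpM2l => //.
apply: klein_scalar => // bj0; have /eqP := supp i j bj0.
by rewrite mulf_eq0 (negbTE wn0) => /eqP.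
Qed.

Lemma sum_sqr_row n (U : op n) i : U *m U^t* = 1%:M -> \sum_j abs (U i j) ^+ 2 = 1.
Proof.
move=> h; apply: complexI; have : (U *m U^t*) i i = 1 by rewrite h mxE eqxx.
rewrite mxE => e; rewrite rmorph1 -e.
by rewrite rmorph_sum; apply: eq_bigr => j _ /=; rewrite sqr_abs adjE mulrC.
Qed.

Lemma sum_sqr_col n (U : op n) j : U^t* *m U = 1%:M -> \sum_i abs (U i j) ^+ 2 = 1.
Proof.
move=> h; apply: complexI; have : (U^t* *m U) j j = 1 by rewrite h mxE eqxx.
rewrite mxE => e; rewrite rmorph1 -e.
by rewrite rmorph_sum; apply: eq_bigr => i _ /=; rewrite sqr_abs adjE.
Qed.

Lemma contr_col m n (V : 'M[C]_(m, n)) j : contr V -> \sum_i abs (V i j) ^+ 2 <= 1.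
Proof.
move=> cV; have := cV 1%N (delta_mx j 0 : 'cV_n).
have -> : hs (V *m (delta_mx j 0 : 'cV_n)) = \sum_i abs (V i j) ^+ 2.
  by rewrite /hs; apply: eq_bigr => i _; rewrite big_ord1 mulmx_deltar eqxx mulr1.
move=> /le_trans; apply; rewrite /hs (bigD1 j) //= big_ord1 mxE !eqxx (abs_real 1) normr1.
rewrite big1 ?addr0 ?expr1n // => k kj.
by rewrite big_ord1 mxE (negbTE kj) abs0 expr0n.
Qed.

Lemma contr_row m n (V : 'M[C]_(m, n)) i : contr V -> \sum_j abs (V i j) ^+ 2 <= 1.
Proof.
move=> /contr_adj /(contr_col i); under eq_bigr do rewrite adjE abs_conj.
by [].
Qed.

(** The optimal parameter is t = 2 / x. For x = 0 it remains to see that D is not negative, which a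
    large t shows. *)
Lemma sqr_le_of_AMGM (x D : R) : 0 <= x -> (forall t, 0 < t -> x <= t * D + t^-1) ->
  x ^+ 2 <= 4 * D.
Proof.
move=> x0 h; case: (eqVneq x 0) => [->|xn0].
  rewrite expr0n /=; rewrite leNgt; apply/negP => D0.
  have D00 : D < 0 by lra.
  have t0 : 0 < 1 - D^-1 by rewrite subr_gt0 (lt_trans _ ltr01) // invr_lt0.
  have := h (1 - D^-1) t0; rewrite mulrBl mulVf ?lt_eqF // mul1r.
  have : (1 - D^-1)^-1 < 1 by rewrite invf_lt1 // ltrBrDr -ltrBrDl subrr invr_lt0.
  have := h _ ltr01; rewrite invr1 => *; lra.
have xpos : 0 < x by rewrite lt_def xn0.
have := h (2 / x); rewrite divr_gt0 // => /(_ isT).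
rewrite invf_div => h1; have := ler_wpM2l x0 h1.
have -> : x * (2 / x * D + x / 2) = 2 * D + x ^+ 2 / 2 by field.
nra.
Qed.

Lemma trB n (A B : op n) : \tr (A - B) = \tr A - \tr B.
Proof. exact: raddfB. Qed.

(** The two orthonormal eigenbases enter only through their overlap matrix
    [P *m Q^t*], whose squared moduli are the weights of [klein_weighted]. *)
Lemma trace_dist_bound n (P Q V : op n) (a b : 'I_n -> R) (D : R) :
  P^t* *m P = 1%:M -> P *m P^t* = 1%:M -> Q^t* *m Q = 1%:M -> Q *m Q^t* = 1%:M ->
  (forall i, 0 <= a i) -> (forall i, 0 <= b i) -> \sum_i a i = 1 -> \sum_i b i = 1 ->
  contr V ->
  \sum_i \sum_j abs ((P *m Q^t*) i j) ^+ 2 * (Num.sqrt (a i) - Num.sqrt (b j)) ^+ 2 <= D ->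
  abs (\tr (V *m (P^t* *m diag_mx (cvec a) *m P - Q^t* *m diag_mx (cvec b) *m Q))) ^+ 2 <= 4 * D.
Proof.
move=> PP PP' QQ QQ' a0 b0 a1 b1 cV hD.
set O := P *m Q^t*; pose N := Q *m V *m P^t*.
have cN : contr N.
  apply: contrM; last by apply: contr_isometry; rewrite trmxCK.
  by apply: contrM => //; apply: contr_isometry.
have e : \tr (V *m (P^t* *m diag_mx (cvec a) *m P - Q^t* *m diag_mx (cvec b) *m Q))
   = \sum_i \sum_j N j i * O i j * (a i - b j)%:C.
  have -> : \tr (V *m (P^t* *m diag_mx (cvec a) *m P - Q^t* *m diag_mx (cvec b) *m Q))
     = \tr (N *m (diag_mx (cvec a) *m O - O *m diag_mx (cvec b))).
    move: (diag_mx (cvec a)) (diag_mx (cvec b)) => Da Db.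
    rewrite !mulmxBr !trB; congr (_ - _).
      by rewrite /N /O !mulmxA [RHS]mxtrace_mulC !mulmxA QQ mul1mx.
    rewrite /N /O !mulmxA -(mulmxA _ (P^t*) P) PP mulmx1.
    by rewrite [LHS]mxtrace_mulC !mulmxA.
  rewrite /mxtrace; under eq_bigr do rewrite mxE; rewrite exchange_big.
  apply: eq_bigr => i _; apply: eq_bigr => j _ /=.
  by rewrite -mulrA; congr (_ * _); rewrite mul_diag_mx mul_mx_diag !mxE rmorphB /= mulrBr mulrC.
apply: sqr_le_of_AMGM; first exact: abs_ge0.
move=> t t0; rewrite e.
(* Factor a - b as (sqrt a - sqrt b)(sqrt a + sqrt b). The first factor goes with the overlaps and
   gives D; the second, by (x + y)^2 <= 2 x^2 + 2 y^2, goes with N, whose rows and columns have norm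
   at most 1. *)
have step i j : abs (N j i * O i j * (a i - b j)%:C) <=
   t * (abs (O i j) ^+ 2 * (Num.sqrt (a i) - Num.sqrt (b j)) ^+ 2)
   + (2 * t)^-1 * (abs (N j i) ^+ 2 * a i + abs (N j i) ^+ 2 * b j).
  rewrite !absM abs_real.
  have ha := sqr_sqrtr (a0 i); have hb := sqr_sqrtr (b0 j).
  have x0 := sqrtr_ge0 (a i); have y0 := sqrtr_ge0 (b j).
  move: ha hb x0 y0; set x := Num.sqrt (a i); set y := Num.sqrt (b j) => ha hb x0 y0.
  rewrite -ha -hb subr_sqr normrM (ger0_norm (addr_ge0 x0 y0)).
  have n0 := abs_ge0 (N j i); have o0 := abs_ge0 (O i j).
  set p := abs (N j i) in n0 *; set q := abs (O i j) in o0 *.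
  set z := `|x - y|.
  have zz : (x - y) ^+ 2 = z ^+ 2 by rewrite -normrX ger0_norm // sqr_ge0.
  rewrite zz.
  have h1 : p * q * (z * (x + y)) <= t * (q ^+ 2 * z ^+ 2) + (4 * t)^-1 * (p ^+ 2 * (x + y) ^+ 2).
    rewrite -subr_ge0.
    have -> : t * (q ^+ 2 * z ^+ 2) + (4 * t)^-1 * (p ^+ 2 * (x + y) ^+ 2) - p * q * (z * (x + y))
       = t * (q * z - (2 * t)^-1 * (p * (x + y))) ^+ 2 by field; rewrite gt_eqF.
    by rewrite mulr_ge0 ?sqr_ge0 ?ltW.
  apply: le_trans h1 _; rewrite lerD2l -mulrDr.
  have -> : (4 * t)^-1 * (p ^+ 2 * (x + y) ^+ 2) = (2 * t)^-1 * (p ^+ 2 * ((x + y) ^+ 2 / 2)).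
    by field; rewrite gt_eqF.
  apply: ler_wpM2l; first by rewrite invr_ge0 mulr_ge0 // ltW.
  apply: ler_wpM2l; first exact: sqr_ge0.
  have := sqr_ge0 (x - y); nra.
apply: le_trans (ler_abs_sum _ _ _) _.
have : \sum_i abs (\sum_j N j i * O i j * (a i - b j)%:C) <= \sum_i \sum_j
   (t * (abs (O i j) ^+ 2 * (Num.sqrt (a i) - Num.sqrt (b j)) ^+ 2)
   + (2 * t)^-1 * (abs (N j i) ^+ 2 * a i + abs (N j i) ^+ 2 * b j)).
  apply: ler_sum => i _; apply: le_trans (ler_abs_sum _ _ _) _.
  by apply: ler_sum => j _; exact: step.
move=> /le_trans; apply.
under eq_bigr => i _ do (rewrite big_split /= -mulr_sumr -mulr_sumr big_split /= -mulr_suml).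
rewrite big_split /= -mulr_sumr -mulr_sumr big_split /=.
apply: lerD; first by rewrite ler_pM2l.
have hA : \sum_i (\sum_j abs (N j i) ^+ 2) * a i <= 1.
  rewrite -a1; apply: ler_sum => i _; rewrite ler_piMl // contr_col //.
have hB : \sum_i \sum_j abs (N j i) ^+ 2 * b j <= 1.
  rewrite exchange_big -b1; apply: ler_sum => j _ /=.
  by rewrite -mulr_suml ler_piMl // contr_row.
have -> : t^-1 = (2 * t)^-1 * 2 by field; rewrite gt_eqF.
by rewrite ler_wpM2l ?invr_ge0 ?mulr_ge0 ?(ltW t0) //; lra.
Qed.

Lemma sum_eigval n (X : op n) : state X -> \sum_i eigval X i = 1.
Proof.
move=> [hX trX]; have [P [PP PP' XE]] := herm_spectral (psd_herm hX).
apply: complexI; rewrite rmorph1 -trX {2}XE mxtrace_mulC mulmxA PP' mul1mx mxtrace_diag.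
by rewrite rmorph_sum; apply: eq_bigr => i _; rewrite mxE.
Qed.

Lemma trr_conj m m' n (A : 'M[C]_(m', m)) (B : op n) (X : op (m * n)) : B^t* *m B = 1%:M ->
  trr ((A *t B) *m X *m (A *t B)^t*) = A *m trr X *m A^t*.
Proof.
move=> BB; move: X; apply: tens_ext.
- apply: (linear_comp (@linear_trr _ _ _)) => a X Y.
  by rewrite mulmxDr mulmxDl -scalemxAr -scalemxAl.
- move=> a X Y; rewrite (@linear_trr R m n) /= mulmxDr mulmxDl.
  by rewrite -scalemxAr -scalemxAl.
- move=> X Y; rewrite adj_tens !tensmx_mul !trr_tens mxtrace_mulC mulmxA BB mul1mx.
  by rewrite -scalemxAr -scalemxAl.
Qed.

Lemma trl_conj m n n' (A : op m) (B : 'M[C]_(n', n)) (X : op (m * n)) : A^t* *m A = 1%:M ->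
  trl ((A *t B) *m X *m (A *t B)^t*) = B *m trl X *m B^t*.
Proof.
move=> AA; move: X; apply: tens_ext.
- apply: (linear_comp (@linear_trl _ _ _)) => a X Y.
  by rewrite mulmxDr mulmxDl -scalemxAr -scalemxAl.
- move=> a X Y; rewrite (@linear_trl R m n) /= mulmxDr mulmxDl.
  by rewrite -scalemxAr -scalemxAl.
- move=> X Y; rewrite adj_tens !tensmx_mul !trl_tens mxtrace_mulC mulmxA AA mul1mx.
  by rewrite -scalemxAr -scalemxAl.
Qed.

Lemma trr_diagE m n (X : op (m * n)) i :
  trr X i i = \sum_l X (mxtens_index (i, l)) (mxtens_index (i, l)).
Proof. by rewrite summxE; apply: eq_bigr => l _; rewrite mxE. Qed.

Lemma trl_diagE m n (X : op (m * n)) i :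
  trl X i i = \sum_l X (mxtens_index (l, i)) (mxtens_index (l, i)).
Proof. by rewrite summxE; apply: eq_bigr => l _; rewrite mxE. Qed.

Lemma tr_trr m n (X : op (m * n)) : \tr (trr X) = \tr X.
Proof. by rewrite /mxtrace sum_mxtens; apply: eq_bigr => i _; rewrite trr_diagE. Qed.

Lemma tr_trl m n (X : op (m * n)) : \tr (trl X) = \tr X.
Proof. by rewrite /mxtrace sum_mxtens exchange_big; apply: eq_bigr => i _; rewrite trl_diagE. Qed.

Lemma psd_trr m n (X : op (m * n)) : psd X -> psd (trr X).
Proof.
move=> /psd_factor [S ->]; apply: psd_sum => l.
pose T := \matrix_(t, i) S t (mxtens_index (i, l)).
suff -> : slice1 (S^t* *m S) l l = T^t* *m T by exact: psd_adj_mul.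
by apply/matrixP => i j; rewrite !mxE; apply: eq_bigr => t _; rewrite !mxE.
Qed.

Lemma psd_trl m n (X : op (m * n)) : psd X -> psd (trl X).
Proof.
move=> /psd_factor [S ->]; apply: psd_sum => l.
pose T := \matrix_(t, i) S t (mxtens_index (l, i)).
suff -> : slice2 (S^t* *m S) l l = T^t* *m T by exact: psd_adj_mul.
by apply/matrixP => i j; rewrite !mxE; apply: eq_bigr => t _; rewrite !mxE.
Qed.

Lemma ln2_neq0 : ln 2 != 0 :> R.
Proof. by rewrite gt_eqF // ln_gt0 // ltr1n. Qed.

Lemma sum_eigval_ln n (X : op n) :
  \sum_i eigval X i * ln (eigval X i) = - (ln 2 * entropy X).
Proof.
rewrite /entropy mulrN opprK mulr_sumr; apply: eq_bigr => i _.
by rewrite /log2; field; exact: ln2_neq0.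
Qed.

Definition prod_eig m n (l : 'I_m -> R) (l' : 'I_n -> R) (k : 'I_(m * n)) : R :=
  l (mxtens_unindex k).1 * l' (mxtens_unindex k).2.

Lemma tens_spectral m n (P : op m) (Q : op n) l l' :
  (P^t* *m diag_mx (cvec l) *m P) *t (Q^t* *m diag_mx (cvec l') *m Q) =
  (P *t Q)^t* *m diag_mx (cvec (prod_eig l l')) *m (P *t Q).
Proof.
rewrite adj_tens -!tensmx_mul; congr (_ *m _ *m _).
apply/matrixP => i j; case: (mxtens_indexP i) => a b; case: (mxtens_indexP j) => c d.
rewrite tensmxE !mxE (can_eq (@mxtens_indexK m n)) xpair_eqE /prod_eig mxtens_indexK /=.
by case: eqP => _; case: eqP => _; rewrite ?mulr0n ?mulr1n ?mul0r ?mulr0 // rmorphM.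
Qed.

Lemma sum_prod_eig m n (l : 'I_m -> R) (l' : 'I_n -> R) :
  \sum_i l i = 1 -> \sum_i l' i = 1 -> \sum_k prod_eig l l' k = 1.
Proof.
move=> h h'; rewrite sum_mxtens -h; apply: eq_bigr => i _.
by rewrite -[RHS]mulr1 -h' mulr_sumr; apply: eq_bigr => j _; rewrite /prod_eig mxtens_indexK.
Qed.

(** ln 2 times the mutual information is the relative entropy, in nats, of X to the product of its
    marginals. The constant 4 is that of the Hellinger-type bound [trace_dist_bound]. *)
Lemma pinsker m n (X V : op (m * n)) : state X -> contr V ->
  abs (\tr (V *m (X - trr X *t trl X))) ^+ 2 <= 4 * (ln 2 * mutual_info X).
Proof.
move=> sX cV; have [hX trX] := sX.
have s1 : state (trr X) by split; [exact: psd_trr | rewrite tr_trr].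
have s2 : state (trl X) by split; [exact: psd_trl | rewrite tr_trl].
have [P [PP PP' XE]] := herm_spectral (psd_herm hX).
have [P1 [PP1 PP1' XE1]] := herm_spectral (psd_herm s1.1).
have [P2 [PP2 PP2' XE2]] := herm_spectral (psd_herm s2.1).
set Q := P1 *t P2.
have QQ : Q^t* *m Q = 1%:M by rewrite adj_tens tensmx_mul PP1 PP2 tens11.
have QQ' : Q *m Q^t* = 1%:M by rewrite adj_tens tensmx_mul PP1' PP2' tens11.
pose l1 := eigval (trr X); pose l2 := eigval (trl X).
have l10 i : 0 <= l1 i by apply: psd_eigval_ge0 s1.1.
have l20 i : 0 <= l2 i by apply: psd_eigval_ge0 s2.1.
rewrite {1}XE1 {1}XE2 tens_spectral {1}XE.
apply: trace_dist_bound => //.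
- by move=> i; apply: psd_eigval_ge0.
- by move=> i; rewrite /prod_eig mulr_ge0.
- exact: sum_eigval.
- by apply: sum_prod_eig; apply: sum_eigval.
pose w i j := abs ((P *m Q^t*) i j) ^+ 2.
(* X in the product eigenbasis of its marginals. Its diagonal is a joint distribution with marginals
   [l1] and [l2]; this gives the support condition, and splits the logarithm of the product
   eigenvalues into two entropies. *)
pose M := Q *m X *m Q^t*.
have M0 j : 0 <= M j j by apply/psd_diag_ge0/psd_conj.
have wM j : (\sum_i w i j * eigval X i)%:C = M j j.
  rewrite /M [in RHS]XE.
  have -> : Q *m (P^t* *m diag_mx (cvec (eigval X)) *m P) *m Q^t* =
     (P *m Q^t*)^t* *m (diag_mx (cvec (eigval X)) *m (P *m Q^t*)).
    by rewrite adjM trmxCK !mulmxA.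
  rewrite mxE rmorph_sum; apply: eq_bigr => i _.
  by rewrite mul_diag_mx adjE !mxE rmorphM /= sqr_abs mxE mulrAC -mulrA mulrC.
have w0 i j : 0 <= w i j by exact: sqr_ge0.
have M1 p : \sum_q M (mxtens_index (p, q)) (mxtens_index (p, q)) = (l1 p)%:C.
  rewrite -trr_diagE /M trr_conj // XE1 !mulmxA PP1' mul1mx -mulmxA PP1' mulmx1.
  by rewrite !mxE eqxx mulr1n.
have M2 q : \sum_p M (mxtens_index (p, q)) (mxtens_index (p, q)) = (l2 q)%:C.
  rewrite -trl_diagE /M trl_conj // XE2 !mulmxA PP2' mul1mx -mulmxA PP2' mulmx1.
  by rewrite !mxE eqxx mulr1n.
pose mm j := \sum_i w i j * eigval X i.
have mm0 j : 0 <= mm j by rewrite -ler0c wM.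
have mm1 p : \sum_q mm (mxtens_index (p, q)) = l1 p.
  by apply: complexI; rewrite -M1 rmorph_sum; apply: eq_bigr => q _; rewrite -wM.
have mm2 q : \sum_p mm (mxtens_index (p, q)) = l2 q.
  by apply: complexI; rewrite -M2 rmorph_sum; apply: eq_bigr => p _; rewrite -wM.
have mmz p q : l1 p = 0 \/ l2 q = 0 -> mm (mxtens_index (p, q)) = 0.
  case=> h.
    by have /eqP := mm1 p; rewrite h psumr_eq0 // => /allP/(_ q (mem_index_enum _))/eqP.
  by have /eqP := mm2 q; rewrite h psumr_eq0 // => /allP/(_ p (mem_index_enum _))/eqP.
have supp i j : prod_eig l1 l2 j = 0 -> w i j * eigval X i = 0.
  case: (mxtens_indexP j) => p q; rewrite /prod_eig mxtens_indexK /= => /eqP.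
  rewrite mulf_eq0 => /orP h.
  have : mm (mxtens_index (p, q)) = 0 by apply: mmz; case: h => /eqP; [left | right].
  move/eqP; rewrite psumr_eq0 => [/allP/(_ i (mem_index_enum _))/eqP //|k _].
  by rewrite mulr_ge0 // psd_eigval_ge0.
apply: le_trans (klein_weighted (w := w) _ _ _ _ _ supp) _ => //.
- by move=> i; apply: psd_eigval_ge0.
- by move=> i; rewrite /prod_eig mulr_ge0.
- by move=> i; apply: sum_sqr_row; rewrite adjM trmxCK -mulmxA (mulmxA (Q^t*)) QQ mul1mx.
- by move=> j; apply: sum_sqr_col; rewrite adjM trmxCK -mulmxA (mulmxA (P^t*)) PP mul1mx.
rewrite sum_eigval // sum_prod_eig ?sum_eigval // subrK.
have -> : \sum_i \sum_j w i j * eigval X i * ln (prod_eig l1 l2 j) =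
   \sum_p l1 p * ln (l1 p) + \sum_q l2 q * ln (l2 q).
  rewrite exchange_big.
  have -> : \sum_p l1 p * ln (l1 p) = \sum_p \sum_q mm (mxtens_index (p, q)) * ln (l1 p).
    by apply: eq_bigr => p _; rewrite -mulr_suml mm1.
  have -> : \sum_q l2 q * ln (l2 q) = \sum_p \sum_q mm (mxtens_index (p, q)) * ln (l2 q).
    by rewrite exchange_big; apply: eq_bigr => q _ /=; rewrite -mulr_suml mm2.
  rewrite sum_mxtens -big_split; apply: eq_bigr => p _ /=.
  rewrite -big_split; apply: eq_bigr => q _ /=; rewrite -mulr_suml -/(mm _) -mulrDr.
  rewrite /prod_eig mxtens_indexK /=.
  case: (eqVneq (l1 p) 0) => [h|h]; first by rewrite mmz ?mul0r //; left.
  case: (eqVneq (l2 q) 0) => [h'|h']; first by rewrite mmz ?mul0r //; right.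
  by rewrite lnM // posrE lt_def ?h ?h' /=.
rewrite !sum_eigval_ln /mutual_info le_eqVlt; apply/orP; left; apply/eqP; ring.
Qed.

(** [eigval (X *t Y)] lists the spectrum in an uncontrolled order, so its entropy is compared with
    the products of eigenvalues by Klein's inequality; the one-sided bound is what non-malleability
    calls for. *)
Lemma mutual_info_product m n (X : op m) (Y : op n) : state X -> state Y ->
  mutual_info (X *t Y) <= 0.
Proof.
move=> sX sY; have [hX trX] := sX; have [hY trY] := sY.
rewrite /mutual_info trr_tens trl_tens trX trY !scale1r.
have [SX XS] := psd_factor hX; have [SY YS] := psd_factor hY.
have hZ : psd (X *t Y) by rewrite XS YS -tensmx_mul -adj_tens; apply: psd_adj_mul.
have sZ : state (X *t Y) by split=> //; rewrite trace_tens trX trY mulr1.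
have [P [PP PP' XE]] := herm_spectral (psd_herm hZ).
have [P1 [PP1 PP1' XE1]] := herm_spectral (psd_herm hX).
have [P2 [PP2 PP2' XE2]] := herm_spectral (psd_herm hY).
set Q := P1 *t P2.
have QQ : Q^t* *m Q = 1%:M by rewrite adj_tens tensmx_mul PP1 PP2 tens11.
have QQ' : Q *m Q^t* = 1%:M by rewrite adj_tens tensmx_mul PP1' PP2' tens11.
pose l1 := eigval X; pose l2 := eigval Y.
have l10 i : 0 <= l1 i by apply: psd_eigval_ge0.
have l20 i : 0 <= l2 i by apply: psd_eigval_ge0.
have ZE : X *t Y = Q^t* *m diag_mx (cvec (prod_eig l1 l2)) *m Q.
  by rewrite {1}XE1 {1}XE2 tens_spectral.
pose w j i := abs ((P *m Q^t*) i j) ^+ 2.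
have w0 i j : 0 <= w i j by exact: sqr_ge0.
pose e := eigval (X *t Y).
have e0 i : 0 <= e i by apply: psd_eigval_ge0.
have b0 j : 0 <= prod_eig l1 l2 j by rewrite /prod_eig mulr_ge0.
have we i : \sum_j w j i * prod_eig l1 l2 j = e i.
  apply: complexI; transitivity ((P *m (X *t Y) *m P^t*) i i); last first.
    by rewrite [X *t Y]XE !mulmxA PP' mul1mx -mulmxA PP' mulmx1 !mxE eqxx mulr1n.
  rewrite ZE.
  have -> : P *m (Q^t* *m diag_mx (cvec (prod_eig l1 l2)) *m Q) *m P^t* =
     (P *m Q^t*) *m (diag_mx (cvec (prod_eig l1 l2)) *m (P *m Q^t*)^t*).
    by rewrite adjM trmxCK !mulmxA.
  rewrite mxE rmorph_sum; apply: eq_bigr => j _.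
  by rewrite mul_diag_mx mxE adjE !mxE rmorphM /= sqr_abs mxE mulrAC -mulrA mulrC; ring.
have supp j i : e i = 0 -> w j i * prod_eig l1 l2 j = 0.
  move=> ei0; have /eqP := we i; rewrite ei0 psumr_eq0 => [/allP/(_ j (mem_index_enum _))/eqP //|k _].
  by rewrite mulr_ge0.
have := klein_weighted (w := w) b0 e0 w0 _ _ supp.
rewrite sum_eigval // sum_prod_eig ?sum_eigval // subrK => h.
have {h} : 0 <= \sum_i prod_eig l1 l2 i * ln (prod_eig l1 l2 i)
      - \sum_i \sum_j w i j * prod_eig l1 l2 i * ln (e j).
  apply: le_trans (h _ _).
  - by apply: sumr_ge0 => i _; apply: sumr_ge0 => j _; rewrite mulr_ge0 ?sqr_ge0.
  - by move=> j; apply: sum_sqr_col; rewrite adjM trmxCK -mulmxA (mulmxA (P^t*)) PP mul1mx.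
  - by move=> i; apply: sum_sqr_row; rewrite adjM trmxCK -mulmxA (mulmxA (Q^t*)) QQ mul1mx.
have -> : \sum_i \sum_j w i j * prod_eig l1 l2 i * ln (e j) = \sum_i e i * ln (e i).
  by rewrite exchange_big; apply: eq_bigr => i _ /=; rewrite -mulr_suml we.
have -> : \sum_i prod_eig l1 l2 i * ln (prod_eig l1 l2 i) =
   \sum_p l1 p * ln (l1 p) + \sum_q l2 q * ln (l2 q).
  rewrite sum_mxtens.
  have -> : \sum_p l1 p * ln (l1 p) = \sum_p \sum_q (l1 p * l2 q) * ln (l1 p).
    by apply: eq_bigr => p _; rewrite -mulr_suml -mulr_sumr sum_eigval // mulr1.
  have -> : \sum_q l2 q * ln (l2 q) = \sum_p \sum_q (l1 p * l2 q) * ln (l2 q).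
    by rewrite exchange_big; apply: eq_bigr => q _ /=; rewrite -!mulr_suml sum_eigval // mul1r.
  rewrite -big_split; apply: eq_bigr => p _ /=.
  rewrite -big_split; apply: eq_bigr => q _ /=; rewrite -mulrDr.
  rewrite /prod_eig mxtens_indexK /=.
  case: (eqVneq (l1 p) 0) => [->|h]; first by rewrite !mul0r.
  case: (eqVneq (l2 q) 0) => [->|h']; first by rewrite mulr0 !mul0r.
  by rewrite lnM // posrE lt_def ?h ?h' /=.
rewrite !sum_eigval_ln.
have : 0 < ln 2 :> R by rewrite ln_gt0 // ltr1n.
nra.
Qed.

End Entropy.

(** * The trace norm *)

Section Norm1.
Variable R : realType.
Local Notation C := R[i].
Local Notation op n := 'M[C]_n%N.

Lemma hs_diag_le n p (l : 'I_n -> R) (Z : 'M[C]_(n, p)) :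
  (forall i, `|l i| <= 1) -> hs (diag_mx (cvec l) *m Z) <= hs Z.
Proof.
move=> hl; apply: ler_sum => i _; apply: ler_sum => j _.
rewrite mul_diag_mx !mxE absM abs_real exprMn ler_piMl ?sqr_ge0 //.
by rewrite exprn_ile1.
Qed.

Lemma hs_factor n p (X P E : op n) (Y : 'M[C]_(n, p)) :
  X^t* *m X = P^t* *m E *m P -> (hs (X *m Y))%:C = \tr ((P *m Y)^t* *m E *m (P *m Y)).
Proof.
move=> XE; rewrite -trace_adj_mul; congr mxtrace.
by rewrite [(X *m Y)^t*]adjM [(P *m Y)^t*]adjM -mulmxA (mulmxA (X^t*)) XE !mulmxA.
Qed.

(** Duality of trace and operator norm: the polar decomposition of X provides a contraction V with
    tr (V X) equal to the sum of the singular values. *)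
Lemma norm1_le n (X : op n) (c : R) :
  (forall V : op n, contr V -> complex.Re (\tr (V *m X)) <= c) -> norm1 X <= c.
Proof.
move=> h; have [P [PP PP' XE]] := herm_spectral (psd_herm (psd_adj_mul X)).
set E := diag_mx _ in XE.
pose s i := Num.sqrt (eigval (X^t* *m X) i).
have s2 i : s i ^+ 2 = eigval (X^t* *m X) i by rewrite sqr_sqrtr // psd_eigval_ge0 //; exact: psd_adj_mul.
(* As 0^-1 = 0, this is the pseudoinverse of |X| in its eigenbasis, and V below is the adjoint of
   the partial isometry of X. *)
pose d := diag_mx (cvec (fun i => (s i)^-1)).
have dd : d^t* = d.
  apply/matrixP => i j; rewrite adjE !mxE eq_sym; case: eqP => [->|_].
    by rewrite !mulr1n conjC_complex conjc_real.
  by rewrite !mulr0n conjC0.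
pose V := P^t* *m d *m P *m X^t*.
have cV : contr V.
  rewrite -[V]trmxCK; apply: contr_adj => p Z.
  have -> : V^t* = X *m (P^t* *m d *m P) by rewrite /V; move: (d) dd => d' dd'; rewrite adjM trmxCK adjM adjM trmxCK dd' !mulmxA.
  pose f := diag_mx (cvec (fun i => (s i != 0)%:R : R)).
  have ded : d *m E *m d = f^t* *m f.
    apply/matrixP => i j; rewrite mul_mx_diag /d mul_diag_mx !mxE.
    rewrite (bigD1 i) //= big1 ?addr0 => [|k ki]; last first.
      by rewrite !mxE (negbTE ki) mulr0n conjC0 mul0r.
    rewrite !mxE eqxx mulr1n conjC_complex conjc_real.
    case: (eqVneq i j) => [<-|ij]; last by rewrite !mulr0n !(mulr0, mul0r).
    rewrite !mulr1n -!rmorphM -s2; congr (_%:C).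
    case: (eqVneq (s i) 0) => [->|si0]; first by rewrite invr0 !mul0r.
    by rewrite mulr1 expr2 mulrA mulVf // mul1r mulfV.
  have -> : hs (X *m (P^t* *m d *m P) *m Z) = hs (f *m (P *m Z)).
    rewrite -mulmxA; apply: complexI; rewrite (hs_factor _ XE) -trace_adj_mul.
    have -> : P *m (P^t* *m d *m P *m Z) = d *m (P *m Z).
      by rewrite !mulmxA PP' mul1mx.
    move: (P *m Z) => W; rewrite adjM [(f *m W)^t*]adjM dd; congr (\tr _).
    by rewrite !mulmxA -(mulmxA _ d E) -(mulmxA _ (d *m E) d) ded !mulmxA.
  apply: le_trans (hs_diag_le _ _) _ => [i|]; last by rewrite hs_isometry.
  by case: eqP => _ /=; rewrite ?normr1 ?normr0 ?ler01.
apply: le_trans (h _ cV); rewrite le_eqVlt; apply/orP; left; apply/eqP.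
rewrite /norm1 -[LHS]/(complex.Re (\sum_i s i)%:C); congr complex.Re.
have -> : \tr (V *m X) = \tr (d *m E).
  rewrite /V; move: (d) => d'; rewrite -(mulmxA _ (X^t*) X) XE.
  have -> : P^t* *m d' *m P *m (P^t* *m E *m P) = P^t* *m (d' *m E *m P).
    by rewrite !mulmxA -(mulmxA _ P (P^t*)) PP' mulmx1.
  by rewrite [LHS]mxtrace_mulC -[d' *m E *m P *m P^t*]mulmxA PP' mulmx1.
rewrite rmorph_sum; apply: eq_bigr => i _; rewrite mul_diag_mx !mxE eqxx mulr1n -rmorphM -s2.
congr (_%:C); case: (eqVneq (s i) 0) => [->|si0]; first by rewrite invr0 mul0r.
by rewrite expr2 mulrA mulVf // mul1r.
Qed.

End Norm1.

(** * Keyed channels as Kraus families, one family for each key *)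

Section Scheme.
Variable R : realType.
Local Notation C := R[i].
Local Notation op n := 'M[C]_n%N.

Lemma trr_ketbra n k (X : op n) (i : 'I_k) : trr (X *t ketbra R i) = X.
Proof.
rewrite trr_tens /mxtrace (bigD1 i) //= big1 => [|j ji].
  by rewrite mxE !eqxx addr0 scale1r.
by rewrite mxE (negbTE ji).
Qed.

(** The Kraus operators of F are cut into blocks by input and output key. The output key joins the
    Kraus index, which amounts to tracing it out; since the key is left unchanged, nothing is
    lost. *)
Lemma block_kraus m n k (F : op (m * k) -> op (n * k)) : cptp F ->
  (forall X (i : 'I_k), exists Y, F (X *t ketbra R i) = Y *t ketbra R i) ->
  exists (I : finType) (K : 'I_k -> I -> 'M[C]_(n, m)),
    (forall X i, F (X *t ketbra R i) = kraus (K i) X *t ketbra R i) /\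
    (forall i, \sum_j (K i j)^t* *m K i j = 1%:M).
Proof.
move=> [cpF tpF] keyF; have [I [G FG]] := cp_krausP cpF.
pose K (i : 'I_k) (j : I * 'I_k) : 'M[C]_(n, m) :=
  \matrix_(x, s) G j.1 (mxtens_index (x, j.2)) (mxtens_index (s, i)).
have KE X i : kraus (K i) X = trr (F (X *t ketbra R i)).
  rewrite FG /trr; under [RHS]eq_bigr => l _ do rewrite /kraus (lin_sum (@linear_slice1 R n k l l)).
  rewrite exchange_big pair_big; apply: eq_bigr => -[j l] _ /=.
  apply/matrixP => x y; rewrite [RHS]mxE !mxE sum_mxtens; apply: eq_bigr => s _.
  rewrite (bigD1 i) //= [X in _ + X]big1 ?addr0 => [|r ri].
    rewrite !adjE [K i (j, l) y s]mxE; congr (_ * _); rewrite !mxE [RHS]sum_mxtens; apply: eq_bigr => t _.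
    rewrite (bigD1 i) //= [X in _ + X]big1 ?addr0 => [|r ri].
      by rewrite tensmxE !mxE !eqxx !mulr1.
    by rewrite tensmxE !mxE (negbTE ri) !mulr0.
  rewrite !mxE big1 ?mul0r // => q _; case: (mxtens_indexP q) => q1 q2.
  by rewrite tensmxE !mxE (negbTE ri) andbF !mulr0.
exists (I * 'I_k)%type, K; split=> [X i|i].
  by have [Y FY] := keyF X i; rewrite KE FY trr_ketbra.
apply/kraus_tp => X; rewrite KE tr_trr tpF trace_tens.
rewrite {2}/mxtrace (bigD1 i) //= big1 => [|j ji]; first by rewrite mxE !eqxx addr0 mulr1.
by rewrite mxE (negbTE ji).
Qed.

Lemma mixed_sum k : mixed R k = k%:R^-1 *: \sum_i ketbra R i.
Proof.
congr (_ *: _); apply/matrixP => i j; rewrite summxE mxE.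
rewrite (bigD1 i) //= big1 ?addr0 => [|l li]; first by rewrite mxE eqxx eq_sym.
by rewrite mxE eq_sym (negbTE li).
Qed.

(** L may be any map, not only a channel: the cross terms between two parts of an attack are treated
    as effective maps as well. *)
Definition eff k a c a1 (I J : finType) (e : 'I_k -> I -> 'M[C]_(c, a))
    (d : 'I_k -> J -> 'M[C]_(a1, c)) b b' (L : op (c * b) -> op (c * b')) (X : op (a * b)) :
    op (a1 * b') :=
  k%:R^-1 *: \sum_i on1 (kraus (d i)) (L (on1 (kraus (e i)) X)).

Lemma effE k a c a1 (I J : finType) (e : 'I_k -> I -> 'M[C]_(c, a))
    (d : 'I_k -> J -> 'M[C]_(a1, c)) b b' (L : op (c * b) -> op (c * b')) (X : op (a * b)) :
  eff e d L X = k%:R^-1 *: \sum_i on1 (kraus (d i)) (L (on1 (kraus (e i)) X)).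
Proof. by []. Qed.

Lemma linear_eff k a c a1 (I J : finType) (e : 'I_k -> I -> 'M[C]_(c, a))
    (d : 'I_k -> J -> 'M[C]_(a1, c)) b b' (L : op (c * b) -> op (c * b')) :
  linear L -> linear (eff e d L).
Proof.
move=> lL; apply: linear_scale; apply: linear_bigsum => i.
apply: linear_comp; first exact/linear_on1/linear_kraus.
by apply: linear_comp lL _; exact/linear_on1/linear_kraus.
Qed.

Lemma effective_keyed a k c (E : op (a * k) -> op (c * k)) (D : op (c * k) -> op ((a + 1) * k))
    (f : 'I_k -> op a -> op c) (g : 'I_k -> op c -> op (a + 1))
    b b' (L : op (c * b) -> op (c * b')) (X : op (a * b)) :
  linear E -> linear D -> linear L -> (forall i, linear (f i)) -> (forall i, linear (g i)) ->
  (forall X i, E (X *t ketbra R i) = f i X *t ketbra R i) ->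
  (forall X i, D (X *t ketbra R i) = g i X *t ketbra R i) ->
  effective E D L X = k%:R^-1 *: \sum_i on1 (g i) (L (on1 (f i) X)).
Proof.
move=> lE lD lL lf lg EE DE; pose G Y := trr (swap (on1 D (swap (on1 L (swap (on1 E (swap (Y : op (a * b * k))))))))).
have lG : linear G.
  apply: linear_comp; first exact: linear_trr.
  apply: linear_comp; first exact: linear_swap.
  apply: linear_comp; first exact: linear_on1.
  apply: linear_comp; first exact: linear_swap.
  apply: linear_comp; first exact: linear_on1.
  apply: linear_comp; first exact: linear_swap.
  apply: linear_comp; first exact: linear_on1.
  exact: linear_swap.
move: X; apply: tens_ext.
- by apply: (linear_comp lG); exact: linear_tensl.
- apply: linear_scale; apply: linear_bigsum => i.
  apply: linear_comp; first exact/linear_on1.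
  by apply: linear_comp lL _; exact/linear_on1.
move=> P Q; rewrite -[effective _ _ _ _]/(G _) mixed_sum tensZr tens_sumr.
have last_step i (Z : op (c * b')) :
    trr (swap (on1 D (swap (Z *t ketbra R i)))) = on1 (g i) Z.
  move: Z; apply: tens_ext.
  - apply: linear_comp; first exact: linear_trr.
    apply: linear_comp; first exact: linear_swap.
    apply: linear_comp; first exact: linear_on1.
    apply: linear_comp; first exact: linear_swap.
    exact: linear_tensl.
  - exact/linear_on1.
  by move=> Z1 Z2; rewrite swap_tens on1_tens // DE swap_tens trr_ketbra on1_tens.
rewrite (lin_Z lG) (lin_sum lG); congr (_ *: _); apply: eq_bigr => i _; rewrite /G.
by rewrite swap_tens on1_tens // EE swap_tens on1_tens // last_step on1_tens.
Qed.

Lemma effective_eff a k c (E : op (a * k) -> op (c * k)) (D : op (c * k) -> op ((a + 1) * k))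
    (I J : finType) (e : 'I_k -> I -> 'M[C]_(c, a)) (d : 'I_k -> J -> 'M[C]_(a + 1, c))
    b b' (L : op (c * b) -> op (c * b')) (X : op (a * b)) :
  linear E -> linear D -> linear L ->
  (forall X i, E (X *t ketbra R i) = kraus (e i) X *t ketbra R i) ->
  (forall X i, D (X *t ketbra R i) = kraus (d i) X *t ketbra R i) ->
  effective E D L X = eff e d L X.
Proof.
move=> lE lD lL EE DE; rewrite effE.
by apply: effective_keyed => // i; exact: linear_kraus.
Qed.

Definition inj_bot a : 'M[C]_(a + 1, a) := col_mx 1%:M 0.

Lemma inj_botK a : (inj_bot a)^t* *m inj_bot a = 1%:M.
Proof.
by rewrite /inj_bot tr_col_mx map_row_mx mul_row_col adjC1 mulmx1 mulmx0 addr0.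
Qed.

Lemma dsum0E a (X : op a) : dsum0 X = inj_bot a *m X *m (inj_bot a)^t*.
Proof.
rewrite /inj_bot tr_col_mx map_row_mx adjC1 mul_col_mx mul1mx mul0mx trmx0 map_mx0.
by rewrite mul_col_row mulmx1 !mulmx0 mul0mx.
Qed.

Lemma psumr_eq0_all (I : finType) (F : I -> R) : (forall i, 0 <= F i) ->
  \sum_i F i = 0 -> forall i, F i = 0.
Proof.
by move=> F0 /eqP; rewrite psumr_eq0 // => /allP h i; apply/eqP/h/mem_index_enum.
Qed.

(** The projection orthogonal to V annihilates [kraus A 1%:M], hence every A t. The V^t* *m A t are
    then Kraus operators of the identity: comparing matrix entries, the squared moduli of
    off-diagonal entries, and of differences of diagonal ones, sum to 0. *)
Lemma kraus_id_scalar a n (T : finType) (A : T -> 'M[C]_(n, a)) (V : 'M[C]_(n, a)) :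
  (0 < a)%N -> V^t* *m V = 1%:M -> (forall X, kraus A X = V *m X *m V^t*) ->
  exists z : T -> C, (forall t, A t = z t *: V) /\ \sum_t abs (z t) ^+ 2 = 1.
Proof.
move=> a0 VV AE.
have hsA t : V *m (V^t* *m A t) = A t.
  pose B t := A t - V *m (V^t* *m A t).
  have B0 : \sum_t hs (B t) = 0.
    apply: complexI; rewrite rmorph_sum rmorph0.
    under eq_bigr => s _ do rewrite /= -trace_mul_adj.
    transitivity (\tr ((1%:M - V *m V^t*) *m kraus A 1%:M *m (1%:M - V *m V^t*)^t*)).
      rewrite /kraus mulmx_sumr mulmx_suml raddf_sum; apply: eq_bigr => s _ /=.
      have -> : B s = (1%:M - V *m V^t*) *m A s by rewrite mulmxBl mul1mx -!mulmxA.
      by rewrite mulmx1 adjM !mulmxA.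
    rewrite AE mulmx1 mulmxBl mul1mx -mulmxA (mulmxA _ V) VV mul1mx subrr mul0mx.
    by rewrite mxtrace0.
  have /hs_eq0/eqP := psumr_eq0_all (fun s => hs_ge0 (B s)) B0 t.
  by rewrite subr_eq0 => /eqP <-.
pose B t := V^t* *m A t.
have BE X : kraus B X = X.
  transitivity (V^t* *m kraus A X *m V).
    rewrite /kraus mulmx_sumr mulmx_suml; apply: eq_bigr => t _.
    by rewrite /B adjM trmxCK !mulmxA.
  by rewrite AE !mulmxA VV mul1mx -mulmxA VV mulmx1.
have Bent s s' x y : \sum_t B t x s * (B t y s')^*%R = ((x == s) && (y == s'))%:R.
  transitivity ((delta_mx s s' : op a) x y); last by rewrite mxE.
  rewrite -[in RHS](BE (delta_mx s s')) summxE; apply: eq_bigr => t _.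
  rewrite [RHS]mxE (bigD1 s') //= big1 ?addr0 => [|k ks]; rewrite mulmx_deltar ?(negbTE ks) ?mulr0 ?mul0r //.
  by rewrite eqxx mulr1 adjE.
have off t x s : x != s -> B t x s = 0.
  move=> xs; have /psumr_eq0_all h : forall t, 0 <= abs (B t x s) ^+ 2 by move=> ?; apply: sqr_ge0.
  have /h/(_ t)/eqP : \sum_t abs (B t x s) ^+ 2 = 0.
    apply: complexI; rewrite rmorph_sum rmorph0.
    have := Bent s s x x; rewrite (negbTE xs) /= => h1; apply: etrans h1.
    by apply: eq_bigr => r _; rewrite /= sqr_abs mulrC.
  by rewrite sqrf_eq0 => /eqP h0; apply/eqP; rewrite -normr_eq0 -absE h0.
have dg t s s' : B t s s = B t s' s'.
  apply/eqP; rewrite -subr_eq0; apply/eqP.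
  have /psumr_eq0_all h : forall t, 0 <= abs (B t s s - B t s' s') ^+ 2 by move=> ?; apply: sqr_ge0.
  have /h/(_ t)/eqP : \sum_t abs (B t s s - B t s' s') ^+ 2 = 0.
    apply: complexI; rewrite rmorph_sum rmorph0.
    transitivity (\sum_t B t s s * (B t s s)^*%R - \sum_t B t s s * (B t s' s')^*%R
       - \sum_t B t s' s' * (B t s s)^*%R + \sum_t B t s' s' * (B t s' s')^*%R).
      rewrite -!sumrB -big_split; apply: eq_bigr => r _ /=.
      by rewrite sqr_abs rmorphB /=; ring.
    by rewrite !Bent !eqxx /=; ring.
  by rewrite sqrf_eq0 => /eqP h0; apply/eqP; rewrite -normr_eq0 -absE h0.
pose s0 := Ordinal a0; exists (fun t => B t s0 s0); split=> [t|].
  rewrite -hsA -/(B t).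
  have -> : B t = (B t s0 s0)%:M.
    apply/matrixP => x y; rewrite [RHS]mxE; case: (eqVneq x y) => [->|xy]; first by rewrite mulr1n (dg _ y s0).
    by rewrite mulr0n off.
  by rewrite mul_mx_scalar [in RHS]mxE eqxx mulr1n.
apply: complexI; rewrite rmorph_sum rmorph1.
have := Bent s0 s0 s0 s0; rewrite !eqxx /= => h1; apply: etrans h1.
by apply: eq_bigr => r _; rewrite /= sqr_abs mulrC.
Qed.

End Scheme.

(** * Effective channels and non-malleability *)

Section Product.
Variable R : realType.
Local Notation C := R[i].
Local Notation op n := 'M[C]_n%N.

Definition blk m n p q (W : 'M[C]_(m * n, p * q)) (x : 'I_m) (y : 'I_p) : 'M[C]_(n, q) :=
  \matrix_(i, j) W (mxtens_index (x, i)) (mxtens_index (y, j)).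

(** The counterpart of [trl] for rectangular operators, needed because Kraus operators of an attack
    may change the dimension of the side register. *)
Definition ptr c n q (W : 'M[C]_(c * n, c * q)) : 'M[C]_(n, q) := \sum_z blk W z z.

Lemma trace_delta n (i j : 'I_n) : \tr (delta_mx i j : op n) = (i == j)%:R.
Proof. by rewrite -[delta_mx i j]mulmx1 trace_delta_mul mxE eq_sym. Qed.

Lemma linear_blk m n p q x y : linear (fun W : 'M[C]_(m * n, p * q) => blk W x y).
Proof. by move=> a X Y; apply/matrixP => i j; rewrite !mxE. Qed.

Lemma linear_ptr c n q : linear (@ptr c n q).
Proof. by apply: linear_bigsum => z; apply: linear_blk. Qed.

Lemma blk_tens m n p q (A : 'M[C]_(m, p)) (B : 'M[C]_(n, q)) x y :
  blk (A *t B) x y = A x y *: B.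
Proof. by apply/matrixP => i j; rewrite mxE tensmxE mxE. Qed.

Lemma ptr_tens c n q (A : op c) (B : 'M[C]_(n, q)) : ptr (A *t B) = \tr A *: B.
Proof. by rewrite /ptr /mxtrace scaler_suml; apply: eq_bigr => z _; exact: blk_tens. Qed.

Lemma slice2_sandwich m n p q (W W' : 'M[C]_(m * n, p * q)) (X : op q) x y u v :
  slice2 (W *m (delta_mx x y *t X) *m W'^t*) u v = blk W u x *m X *m (blk W' v y)^t*.
Proof.
apply/matrixP => i j; rewrite !mxE sum_mxtens (bigD1 y) //= [X in _ + X]big1 ?addr0 => [|z zy].
  apply: eq_bigr => k _; rewrite !adjE [blk _ _ _ _ _]mxE; congr (_ * _).
  rewrite !mxE sum_mxtens (bigD1 x) //= [X in _ + X]big1 ?addr0 => [|z zx].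
    by apply: eq_bigr => l _; rewrite tensmxE !mxE !eqxx mul1r.
  by rewrite big1 // => l _; rewrite tensmxE !mxE (negbTE zx) mul0r mulr0.
rewrite big1 // => k _; rewrite mxE big1 ?mul0r // => l _.
by case: (mxtens_indexP l) => l1 l2; rewrite tensmxE !mxE (negbTE zy) andbF mul0r mulr0.
Qed.

Lemma tens_ext_scalar m n (f g : op (m * n) -> C) :
  (forall a X Y, f (a *: X + Y) = a * f X + f Y) ->
  (forall a X Y, g (a *: X + Y) = a * g X + g Y) ->
  (forall X Y, f (X *t Y) = g (X *t Y)) -> forall X, f X = g X.
Proof. by move=> lf lg; apply: (@tens_ext _ _ _ C^o f g). Qed.

Lemma trace_delta_tens m n (A : op n) (X : op (m * n)) u v :
  \tr ((delta_mx v u *t A) *m X) = \tr (A *m slice2 X u v).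
Proof.
move: X; apply: tens_ext_scalar.
- by move=> a X Y; rewrite mulmxDr -scalemxAr mxtraceD mxtraceZ.
- by move=> a X Y; rewrite linear_slice2 mulmxDr -scalemxAr mxtraceD mxtraceZ.
- move=> X Y; rewrite tensmx_mul trace_tens slice2_tens -scalemxAr mxtraceZ.
  by rewrite trace_delta_mul.
Qed.

Lemma phi_plusE a : phi_plus R a = a%:R^-1 *: \sum_i \sum_j delta_mx i j *t delta_mx i j.
Proof.
apply/matrixP => i j; case: (mxtens_indexP i) => x b; case: (mxtens_indexP j) => y d.
rewrite !mxE !mxtens_indexK /= mulrC; congr (_ * _).
rewrite summxE (bigD1 x) //= [X in _ + X]big1 ?addr0 => [|k ka]; last first.
  by rewrite summxE big1 // => l _; rewrite tensmxE !mxE (eq_sym x) (negbTE ka) mul0r.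
rewrite summxE (bigD1 y) //= [X in _ + X]big1 ?addr0 => [|k ka]; last first.
  by rewrite tensmxE !mxE eqxx (eq_sym y) (negbTE ka) mul0r.
by rewrite tensmxE !mxE !eqxx mul1r (eq_sym b) (eq_sym d).
Qed.

Lemma state_phi_plus a : (0 < a)%N -> state (phi_plus R a).
Proof.
move=> a0; have an0 : a%:R != 0 :> C by rewrite pnatr_eq0 -lt0n.
split; last first.
  rewrite phi_plusE mxtraceZ raddf_sum.
  under eq_bigr => i _ do (rewrite raddf_sum /=; under eq_bigr => j _ do rewrite trace_tens).
  transitivity (a%:R^-1 * \sum_(i < a) (1 : C)); last by rewrite sumr_const card_ord mulVf.
  congr (_ * _); apply: eq_bigr => i _; rewrite (bigD1 i) //= big1 ?addr0 => [|j ji].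
    by rewrite trace_delta eqxx mulr1.
  by rewrite trace_delta eq_sym (negbTE ji) mul0r.
pose u : 'cV[C]_(a * a) := \col_x (((mxtens_unindex x).1 == (mxtens_unindex x).2)%:R).
have -> : phi_plus R a = (a%:R^-1)%:C *: (u *m u^t*).
  apply/matrixP => i j; rewrite !mxE big_ord1 !mxE conjC_nat fmorphV rmorph_nat mulrC.
  by congr (_ * _); case: eqP => _; case: eqP => _; rewrite ?mulr1 ?mulr0.
by apply: psdZ; [rewrite invr_ge0 ler0n | exact: psd_mul_adj].
Qed.

Lemma trace_swap_tens m n p (A : op m) (B : op p) (D : op n) (Y : op (m * n)) (Z : op p) :
  \tr ((A *t B *t D) *m swap (Y *t Z)) = \tr ((A *t D) *m Y) * \tr (B *m Z).
Proof.
move: Y; apply: tens_ext_scalar.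
- by move=> a X Y; rewrite tensDl tensZl linear_swap mulmxDr -scalemxAr mxtraceD mxtraceZ.
- by move=> a X Y; rewrite mulmxDr -scalemxAr mxtraceD mxtraceZ mulrDl mulrA.
- move=> X Y; rewrite swap_tens !tensmx_mul !trace_tens; ring.
Qed.

Lemma trr_swap_tens m n p (Y : op (m * n)) (Z : op p) : trr (swap (Y *t Z)) = trr Y *t Z.
Proof.
move: Y; apply: tens_ext.
- apply: linear_comp; first exact: linear_trr.
  by apply: linear_comp; [exact: linear_swap | exact: linear_tensl].
- by apply: (linear_comp (linear_tensl Z)); exact: linear_trr.
- by move=> X Y; rewrite swap_tens !trr_tens tensZl.
Qed.

Lemma trl_swap_tens m n p (Y : op (m * n)) (Z : op p) : trl (swap (Y *t Z)) = \tr Z *: trl Y.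
Proof.
move: Y; apply: tens_ext.
- apply: linear_comp; first exact: linear_trl.
  by apply: linear_comp; [exact: linear_swap | exact: linear_tensl].
- by apply: linear_scale; exact: linear_trl.
- by move=> X Y; rewrite swap_tens !trl_tens trace_tens scalerA mulrC.
Qed.

Lemma psd_swap m n p (X : op (m * n * p)) : psd X -> psd (swap X).
Proof. by move=> /psd_factor [S ->]; rewrite swapM swap_adj; exact: psd_adj_mul. Qed.

Lemma psd_tens m n (X : op m) (Y : op n) : psd X -> psd Y -> psd (X *t Y).
Proof.
move=> /psd_factor [S ->] /psd_factor [T ->].
by rewrite -tensmx_mul -adj_tens; exact: psd_adj_mul.
Qed.

(** Overlap with phi^+ sees a Kraus operator only through its partial trace: up to 1 / c^2, p_= is
    the sum of tr (M rho M^t* ) over M = ptr (W j). *)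
Lemma p_eq_traceless c b b' (I : finType) (W : I -> 'M[C]_(c * b', c * b)) (rho : op b) :
  (forall j, ptr (W j) = 0) -> p_eq (kraus W) rho = 0.
Proof.
move=> W0; rewrite /p_eq phi_plusE.
suff -> : \tr (((c%:R^-1 *: \sum_(i < c) \sum_(j < c) (delta_mx i j *t delta_mx i j : op (c * c))) *t (1%:M : op b')) *m
   swap (on1 (kraus W) (swap ((c%:R^-1 *: \sum_(i < c) \sum_(j < c) (delta_mx i j *t delta_mx i j : op (c * c))) *t rho)))) = 0.
  by [].
pose f Y : op (c * c * b') := swap (on1 (kraus W) (swap ((Y : op (c * c)) *t rho))).
have lf : linear f.
  apply: linear_comp; first exact: linear_swap.
  apply: linear_comp; first exact/linear_on1/linear_kraus.
  by apply: linear_comp; [exact: linear_swap | exact: linear_tensl].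
rewrite -/(f _) (lin_Z lf) (lin_sum lf) tensZl -scalemxAl -scalemxAr !mxtraceZ tens_suml.
suff -> : \tr ((\sum_(i < c) (\sum_(j < c) (delta_mx i j *t delta_mx i j : op (c * c))) *t (1%:M : op b')) *m
   \sum_(i < c) f (\sum_(j < c) (delta_mx i j *t delta_mx i j))) = 0 by rewrite !mulr0.
rewrite mulmx_suml raddf_sum /=.
transitivity (\sum_(t < c) \sum_(t' < c) \sum_(s < c) \sum_(s' < c)
   \tr ((delta_mx t t' *t (1%:M : op b')) *m kraus W (delta_mx s s' *t rho)) * ((s == t') && (s' == t))%:R).
  apply: eq_bigr => t _; rewrite tens_suml mulmx_suml raddf_sum; apply: eq_bigr => t' _ /=.
  rewrite mulmx_sumr raddf_sum; apply: eq_bigr => s _ /=.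
  rewrite (lin_sum lf) mulmx_sumr raddf_sum; apply: eq_bigr => s' _ /=.
  rewrite /f swap_tens on1_tens; last exact: linear_kraus.
  by rewrite trace_swap_tens trace_delta_mul mxE (eq_sym t') (eq_sym t).
transitivity (\sum_(t < c) \sum_(t' < c) \sum_j \tr (blk (W j) t' t' *m rho *m (blk (W j) t t)^t*)).
  apply: eq_bigr => t _; apply: eq_bigr => t' _.
  rewrite (bigD1 t') //= [X in _ + X]big1 ?addr0 => [|s st]; last first.
    by rewrite big1 // => s' _; rewrite (negbTE st) mulr0.
  rewrite (bigD1 t) //= [X in _ + X]big1 ?addr0 => [|s st]; last first.
    by rewrite eqxx (negbTE st) mulr0.
  rewrite !eqxx mulr1 trace_delta_tens mul1mx.
  rewrite /kraus (lin_sum (@linear_slice2 R c b' t' t)) raddf_sum; apply: eq_bigr => j _ /=.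
  by rewrite slice2_sandwich.
under eq_bigr => t _ do rewrite exchange_big.
rewrite exchange_big big1 // => j _ /=.
transitivity (\tr (ptr (W j) *m rho *m (ptr (W j))^t*)); last by rewrite W0 mul0mx mul0mx mxtrace0.
rewrite /ptr adj_sum mulmx_sumr raddf_sum; apply: eq_bigr => t _ /=.
by rewrite !mulmx_suml raddf_sum.
Qed.

Lemma cp_comp m n p (f : op n -> op p) (g : op m -> op n) :
  completely_positive f -> completely_positive g -> completely_positive (fun X => f (g X)).
Proof.
move=> [lf cf] [lg cg]; split=> [|q X hX]; first exact: linear_comp lf lg.
have -> : on1 (fun X => f (g X)) X = on1 f (on1 g X).
  move: {hX} X; apply: tens_ext.
  - exact/linear_on1/linear_comp.
  - by apply: linear_comp; apply: linear_on1.
  - by move=> X Y; rewrite !on1_tens //; exact: linear_comp.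
by apply: cf; exact: cg.
Qed.

Lemma cp_scale m n (z : R) (f : op m -> op n) : 0 <= z ->
  completely_positive f -> completely_positive (fun X => z%:C *: f X).
Proof.
move=> z0 [lf cf]; split=> [|p X hX]; first exact: linear_scale.
have -> : on1 (fun X => z%:C *: f X) X = z%:C *: on1 f X.
  rewrite /on1 scaler_sumr; apply: eq_bigr => i _; rewrite scaler_sumr.
  by apply: eq_bigr => j _; rewrite tensZl.
by apply: psdZ => //; exact: cf.
Qed.

Lemma cp_bigsum (I : finType) m n (f : I -> op m -> op n) :
  (forall i, completely_positive (f i)) -> completely_positive (fun X => \sum_i f i X).
Proof.
move=> cf; split=> [|p X hX]; first by apply: linear_bigsum => i; case: (cf i).
have -> : on1 (fun X => \sum_i f i X) X = \sum_i on1 (f i) X.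
  rewrite /on1 [RHS]exchange_big; apply: eq_bigr => l _.
  by rewrite exchange_big; apply: eq_bigr => l' _; rewrite tens_suml.
by apply: psd_sum => i; case: (cf i) => _; apply.
Qed.

Lemma tp_on1 m n p (f : op m -> op n) (X : op (m * p)) : linear f -> trace_preserving f ->
  \tr (on1 f X) = \tr X.
Proof.
move=> lf tf; move: X; apply: tens_ext_scalar.
- by move=> a X Y; rewrite (linear_on1 lf) mxtraceD mxtraceZ.
- by move=> a X Y; rewrite mxtraceD mxtraceZ.
- by move=> X Y; rewrite on1_tens // !trace_tens tf.
Qed.

Section Scheme.
Variables (k a c : nat) (I J : finType).
Variables (e : 'I_k -> I -> 'M[C]_(c, a)) (d : 'I_k -> J -> 'M[C]_(a + 1, c)).
Hypothesis k0 : (0 < k)%N.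
Hypothesis e1 : forall i, \sum_j (e i j)^t* *m e i j = 1%:M.
Hypothesis d1 : forall i, \sum_j (d i j)^t* *m d i j = 1%:M.

Lemma kC_neq0 : k%:R != 0 :> C. Proof. by rewrite pnatr_eq0 -lt0n. Qed.

Lemma cp_eff b b' (L : op (c * b) -> op (c * b')) :
  completely_positive L -> completely_positive (eff e d L).
Proof.
move=> cL; rewrite /eff.
apply: (@eq_cp _ _ _ (fun X => ((k%:R^-1 : R)%:C) *: \sum_i on1 (kraus (d i)) (L (on1 (kraus (e i)) X)))).
  by move=> X; rewrite fmorphV rmorph_nat.
apply: cp_scale; first by rewrite invr_ge0 ler0n.
apply: cp_bigsum => i; apply: cp_comp.
  by apply: (eq_cp (fun X => esym (on1_kraus _ X))); exact: cp_kraus.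
apply: cp_comp cL _.
by apply: (eq_cp (fun X => esym (on1_kraus _ X))); exact: cp_kraus.
Qed.

Lemma tp_eff b b' (L : op (c * b) -> op (c * b')) : linear L ->
  trace_preserving L -> trace_preserving (eff e d L).
Proof.
move=> lL tL X; rewrite /eff mxtraceZ raddf_sum /=.
under eq_bigr => i _.
  rewrite tp_on1; [|exact: linear_kraus|exact/kraus_tp].
  rewrite tL tp_on1; [|exact: linear_kraus|exact/kraus_tp]; over.
by rewrite sumr_const card_ord -[\tr X *+ k]mulr_natl mulrA mulVf ?mul1r // kC_neq0.
Qed.

Lemma binary_entropy0 : binary_entropy 0 = 0 :> R.
Proof. by rewrite /binary_entropy /log2 !(mul0r, oppr0, addr0, ln1, mulr0). Qed.

(** An attack that is orthogonal to the identity leaves its output register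
    uncorrelated with the decrypted half of a maximally entangled plaintext;
    the blocks [delta_mx s s'] of phi^+ are tested one at a time. *)
Lemma nm_product (E : op (a * k) -> op (c * k)) (D : op (c * k) -> op ((a + 1) * k)) (eps : R)
    b b' (L : op (c * b) -> op (c * b')) (rho : op b) (V : op ((a + 1) * b')) s s' :
  (0 < a)%N -> (forall b b' (L : op (c * b) -> op (c * b')) X, linear L -> effective E D L X = eff e d L X) ->
  non_malleable eps E D -> cptp L -> p_eq L rho = 0 -> state rho -> contr V ->
  abs (\tr (V *m (eff e d L (delta_mx s s' *t rho)
     - trr (eff e d L (delta_mx s s' *t rho)) *t trl (eff e d L (mixed R a *t rho))))) ^+ 2
  <= a%:R ^+ 2 * (4 * (ln 2 * eps)).
Proof.
move=> a0 ED nm cL pL srho cV; have [[lL cpL] tpL] := cL.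
have an0 : a%:R != 0 :> C by rewrite pnatr_eq0 -lt0n.
have lP := linear_eff e d lL; set P := eff e d L in lP *.
have sphi := state_phi_plus a0.
have Pcp : completely_positive P by apply: cp_eff; case: cL.
have Ptp : trace_preserving P by apply: tp_eff.
pose rho0 := swap (phi_plus R a *t rho).
have s0 : state rho0.
  split; first by apply/psd_swap/psd_tens; [case: sphi | case: srho].
  by rewrite tr_swap trace_tens; case: sphi => _ ->; case: srho => _ ->; rewrite mulr1.
have o1E : on1 P rho0 = a%:R^-1 *: \sum_t \sum_t' P (delta_mx t t' *t rho) *t delta_mx t t'.
  pose g Y := on1 P (swap ((Y : op (a * a)) *t rho)).
  have lg : linear g.
    apply: linear_comp; first exact: linear_on1.
    by apply: linear_comp; [exact: linear_swap | exact: linear_tensl].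
  rewrite /rho0 -/(g _) phi_plusE (lin_Z lg) (lin_sum lg); congr (_ *: _); apply: eq_bigr => t _.
  rewrite (lin_sum lg); apply: eq_bigr => t' _.
  by rewrite /g swap_tens on1_tens.
pose S := swap (on1 P rho0).
have sS : state S.
  split; first by apply: psd_swap; case: Pcp => _; apply; case: s0.
  by rewrite tr_swap tp_on1 //; case: s0.
have trrS : trr S = a%:R^-1 *: \sum_t \sum_t' trr (P (delta_mx t t' *t rho)) *t delta_mx t t'.
  have lg : linear (fun Y : op ((a + 1) * b' * a) => trr (swap Y)).
    by apply: linear_comp; [exact: linear_trr | exact: linear_swap].
  rewrite /S o1E (lin_Z lg) (lin_sum lg); congr (_ *: _); apply: eq_bigr => t _.
  by rewrite (lin_sum lg); apply: eq_bigr => t' _; rewrite trr_swap_tens.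
have trlS : trl S = trl (P (mixed R a *t rho)).
  have lg : linear (fun Y : op ((a + 1) * b' * a) => trl (swap Y)).
    by apply: linear_comp; [exact: linear_trl | exact: linear_swap].
  have lh : linear (fun Y => trl (P (Y *t rho))).
    apply: linear_comp; first exact: linear_trl.
    by apply: linear_comp lP _; exact: linear_tensl.
  rewrite /S o1E (lin_Z lg) (lin_sum lg) mixed_sum (lin_Z lh) (lin_sum lh).
  congr (_ *: _); apply: eq_bigr => t _.
  rewrite (lin_sum lg) (bigD1 t) //= big1 ?addr0 => [|t' tt].
    by rewrite trl_swap_tens trace_delta eqxx scale1r.
  by rewrite trl_swap_tens trace_delta eq_sym (negbTE tt) scale0r.
(* The side register starts in a product with plaintext and reference, so the initial mutual
   information is at most 0; the entropy term is h(0) = 0. *)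
have mi : mutual_info S <= eps.
  have := nm _ _ _ rho0 L s0 cL.
  have -> : swap (on1 (effective E D L) rho0) = S.
    by rewrite /S; congr swap; apply: eq_on1 => Y; rewrite ED.
  have -> : trl (trr rho0) = rho.
    rewrite /rho0 trr_swap_tens trl_tens tr_trr; case: sphi => _ ->; exact: scale1r.
  rewrite pL binary_entropy0 addr0 /rho0 swapK => /le_trans; apply.
  by rewrite gerDr; exact: mutual_info_product.
pose T := swap (V *t (delta_mx s' s : op a)).
have cT : contr T by apply/contr_swap/contr_tens => //; exact: contr_delta.
have sel (Y : 'I_a -> 'I_a -> op ((a + 1) * b')) :
   \sum_t \sum_t' \tr ((V *t (delta_mx s' s : op a)) *m (Y t t' *t delta_mx t t')) = \tr (V *m Y s s').
  rewrite (bigD1 s) //= [X in _ + X]big1 ?addr0 => [|t ts]; last first.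
    by rewrite big1 // => t' _; rewrite tensmx_mul trace_tens trace_delta_mul mxE (eq_sym s) (negbTE ts) mulr0.
  rewrite (bigD1 s') //= [X in _ + X]big1 ?addr0 => [|t ts]; last first.
    by rewrite tensmx_mul trace_tens trace_delta_mul mxE (eq_sym s') (negbTE ts) andbF mulr0.
  by rewrite tensmx_mul trace_tens trace_delta_mul mxE !eqxx mulr1.
have h := pinsker sS cT.
(* phi^+ carries each block |s><s'| with weight 1 / a; this is where the factor a^2 of the squared
   bound comes from. *)
have e2 : \tr (T *m (S - trr S *t trl S)) = a%:R^-1 * \tr (V *m (P (delta_mx s s' *t rho)
     - trr (P (delta_mx s s' *t rho)) *t trl (P (mixed R a *t rho)))).
  rewrite mulmxBr [V *m _]mulmxBr !raddfB /= mulrBr; congr (_ - _).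
    rewrite /T /S -swapM tr_swap o1E -scalemxAr mxtraceZ mulmx_sumr raddf_sum; congr (_ * _).
    rewrite -(sel (fun t t' => P (delta_mx t t' *t rho))); apply: eq_bigr => t _.
    by rewrite mulmx_sumr raddf_sum.
  rewrite trrS trlS tensZl -scalemxAr mxtraceZ; congr (_ * _).
  rewrite -(sel (fun t t' => trr (P (delta_mx t t' *t rho)) *t trl (P (mixed R a *t rho)))).
  rewrite tens_suml mulmx_sumr raddf_sum; apply: eq_bigr => t _ /=.
  rewrite tens_suml mulmx_sumr raddf_sum; apply: eq_bigr => t' _ /=.
  by rewrite -[RHS]tr_swap [in RHS]swapM swap_tens.
move: h; rewrite e2 absM exprMn => h.
have aR : abs (a%:R^-1 : C) = a%:R^-1.
  have -> : (a%:R^-1 : C) = (a%:R^-1)%:C by rewrite fmorphV rmorph_nat.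
  by rewrite abs_real ger0_norm // invr_ge0 ler0n.
rewrite aR exprVn in h.
have aR0 : 0 < (a%:R : R) ^+ 2 by rewrite exprn_gt0 // ltr0n.
rewrite ler_pdivrMl // in h.
apply: le_trans h _; rewrite ler_pM2l // ler_pM2l // ler_pM2l //.
by rewrite ln_gt0 // ltr1n.
Qed.

End Scheme.
End Product.

(** * Attacks of vanishing partial trace *)

Section Attack.
Variable R : realType.
Local Notation C := R[i].
Local Notation op n := 'M[C]_n%N.

Lemma blkM m n p q r s (A : 'M[C]_(m * n, p * q)) (B : 'M[C]_(p * q, r * s)) x y :
  blk (A *m B) x y = \sum_z blk A x z *m blk B z y.
Proof.
apply/matrixP => i j; rewrite !mxE sum_mxtens summxE; apply: eq_bigr => z _.
by rewrite mxE; apply: eq_bigr => l _; rewrite !mxE.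
Qed.

Lemma blk_adj m n p q (A : 'M[C]_(m * n, p * q)) x y : blk (A^t*) x y = (blk A y x)^t*.
Proof. by apply/matrixP => i j; rewrite !mxE. Qed.

Lemma blk_sum m n p q (A : 'M[C]_(m * n, p * q)) :
  A = \sum_x \sum_y delta_mx x y *t blk A x y.
Proof.
apply/matrixP => i j; case: (mxtens_indexP i) => a b; case: (mxtens_indexP j) => c d.
rewrite summxE (bigD1 a) //= [X in _ + X]big1 ?addr0 => [|l lb]; last first.
  by rewrite summxE big1 // => r _; rewrite tensmxE !mxE eq_sym (negbTE lb) mul0r.
rewrite summxE (bigD1 c) //= [X in _ + X]big1 ?addr0 => [|l lb]; last first.
  by rewrite tensmxE !mxE eqxx (eq_sym c) (negbTE lb) mul0r.
by rewrite tensmxE !mxE !eqxx mul1r.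
Qed.

Lemma ptr_mull c n n' q (B : 'M[C]_(n', n)) (W : 'M[C]_(c * n, c * q)) :
  ptr (((1%:M : op c) *t B) *m W) = B *m ptr W.
Proof.
rewrite /ptr mulmx_sumr; apply: eq_bigr => z _.
rewrite blkM (bigD1 z) //= big1 ?addr0 => [|y yz]; rewrite blk_tens mxE ?eqxx ?scale1r //.
by rewrite eq_sym (negbTE yz) scale0r mul0mx.
Qed.

Lemma ptr_mulr c n q q' (B : 'M[C]_(q, q')) (W : 'M[C]_(c * n, c * q)) :
  ptr (W *m ((1%:M : op c) *t B)) = ptr W *m B.
Proof.
rewrite /ptr mulmx_suml; apply: eq_bigr => z _.
rewrite blkM (bigD1 z) //= big1 ?addr0 => [|y yz]; rewrite blk_tens mxE ?eqxx ?scale1r //.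
by rewrite (negbTE yz) scale0r mulmx0.
Qed.

Lemma ptr_delta_mul c n n' q (B : 'M[C]_(n', n)) (W : 'M[C]_(c * n, c * q)) x y :
  ptr ((delta_mx x y *t B) *m W) = B *m blk W y x.
Proof.
rewrite /ptr (bigD1 x) //= [X in _ + X]big1 ?addr0 => [|z zx]; rewrite blkM.
  rewrite (bigD1 y) //= big1 ?addr0 => [|z zy]; rewrite blk_tens mxE ?eqxx ?scale1r //.
  by rewrite (negbTE zy) andbF scale0r mul0mx.
by rewrite big1 // => u _; rewrite blk_tens mxE (negbTE zx) scale0r mul0mx.
Qed.

Lemma ptr_gram c n q (S : 'M[C]_(c * n, c * q)) :
  ptr (S^t* *m S) = \sum_x \sum_y (blk S y x)^t* *m blk S y x.
Proof.
rewrite /ptr; apply: eq_bigr => x _; rewrite blkM.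
by apply: eq_bigr => y _; rewrite blk_adj.
Qed.

Lemma psd_1tens m n (X : op n) : psd X -> psd ((1%:M : op m) *t X).
Proof. by move=> hX; apply: psd_tens => //; rewrite -[1%:M]mulmx1 -{1}(adjC1 R m); exact: psd_adj_mul. Qed.

Lemma psd_ptr_gram c n q (S : 'M[C]_(c * n, c * q)) : psd (ptr (S^t* *m S)).
Proof.
rewrite ptr_gram; apply: psd_sum => x; apply: psd_sum => y; exact: psd_adj_mul.
Qed.

(** The part of [W] orthogonal to [1 (x) M] for all [M]. *)
Definition tl c n q (W : 'M[C]_(c * n, c * q)) : 'M[C]_(c * n, c * q) :=
  W - c%:R^-1 *: ((1%:M : op c) *t ptr W).

Lemma ptr_tl c n q (W : 'M[C]_(c * n, c * q)) : (0 < c)%N -> ptr (tl W) = 0.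
Proof.
move=> c0; rewrite /tl (lin_B (@linear_ptr R c n q)) (lin_Z (@linear_ptr R c n q)).
rewrite ptr_tens mxtrace1 scalerA mulVf ?scale1r ?subrr //.
by rewrite pnatr_eq0 -lt0n.
Qed.

(** A depolarizing attack after [S]: the traceless matrix units act on the
    ciphertext, and the side register is discarded. *)
Definition hfam c b (S : op (c * b)) (t : 'I_c * 'I_c * 'I_b) : 'M[C]_(c * 1, c * b) :=
  tl ((delta_mx t.1.1 t.1.2 *t delta_mx 0 t.2) *m S).

Lemma sum_delta1 n : \sum_i (delta_mx i i : op n) = 1%:M.
Proof.
apply/matrixP => i j; rewrite summxE mxE.
rewrite (bigD1 i) //= big1 ?addr0 => [|l li]; first by rewrite mxE eqxx eq_sym.
by rewrite mxE eq_sym (negbTE li).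
Qed.

Lemma sum_triple c b (V : nmodType) (F : 'I_c * 'I_c * 'I_b -> V) :
  \sum_t F t = \sum_x \sum_y \sum_z F (x, y, z).
Proof.
rewrite (pair_big xpredT xpredT (fun x y => \sum_z F (x, y, z))) /=.
rewrite (pair_big xpredT xpredT (fun x z => F (x.1, x.2, z))) /=.
by apply: eq_bigr => -[[x y] z].
Qed.

(** Expand [tl] on A = (|x><y| (x) <z|) S. The A themselves contribute c times the Gram matrix of S,
    each of the two mixed terms -1 / c times it, and the squares of 1 (x) ptr A its partial trace
    with factor 1 / c^2. *)
Lemma hfam_gram c b (S : op (c * b)) :
  \sum_t (hfam S t)^t* *m hfam S t =
  (c%:R - 2 * c%:R^-1) *: (S^t* *m S)
  + c%:R^-2 *: ((1%:M : op c) *t ptr (S^t* *m S)).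
Proof.
have cc : (c%:R^-1 : C)^*%R = c%:R^-1 by rewrite fmorphV rmorph_nat.
pose A (t : 'I_c * 'I_c * 'I_b) : 'M[C]_(c * 1, c * b) :=
  (delta_mx t.1.1 t.1.2 *t delta_mx 0 t.2) *m S.
have e1 : \sum_t (A t)^t* *m A t = c%:R *: (S^t* *m S).
  transitivity (\sum_(x < c) S^t* *m S).
    rewrite sum_triple; apply: eq_bigr => x _.
    transitivity (\sum_y \sum_z S^t* *m ((delta_mx y y : op c) *t (delta_mx z z : op b)) *m S).
      apply: eq_bigr => y _; apply: eq_bigr => z _; rewrite /A /= adjM adj_tens !adj_delta.
      by rewrite mulmxA -(mulmxA (S^t*)) tensmx_mul !mul_delta_mx.
    transitivity (S^t* *m ((\sum_y (delta_mx y y : op c)) *t (\sum_z (delta_mx z z : op b))) *m S).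
      rewrite tens_suml mulmx_sumr mulmx_suml; apply: eq_bigr => y _.
      by rewrite tens_sumr mulmx_sumr mulmx_suml.
    by rewrite !sum_delta1 tens11 mulmx1.
  by rewrite sumr_const card_ord -scaler_nat.
have pA x y z : ptr (A (x, y, z)) = delta_mx 0 z *m blk S y x by rewrite /A ptr_delta_mul.
have e2 : \sum_t (A t)^t* *m ((1%:M : op c) *t ptr (A t)) = S^t* *m S.
  transitivity (\sum_x \sum_y S^t* *m (delta_mx y x *t blk S y x)).
    rewrite sum_triple; apply: eq_bigr => x _; apply: eq_bigr => y _.
    transitivity (\sum_z S^t* *m (delta_mx y x *t (delta_mx z z *m blk S y x))).
      apply: eq_bigr => z _; rewrite pA /A /= adjM adj_tens !adj_delta.
      by rewrite -mulmxA tensmx_mul mulmx1 mulmxA mul_delta_mx.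
    rewrite -mulmx_sumr; congr (_ *m _); rewrite -tens_sumr; congr (_ *t _).
    by rewrite -mulmx_suml sum_delta1 mul1mx.
  rewrite exchange_big [X in _ = _ *m X](blk_sum S) mulmx_sumr; apply: eq_bigr => y _.
  by rewrite mulmx_sumr.
have e3 : \sum_t ((1%:M : op c) *t ptr (A t))^t* *m A t = S^t* *m S.
  transitivity ((\sum_t (A t)^t* *m ((1%:M : op c) *t ptr (A t)))^t*).
    by rewrite adj_sum; apply: eq_bigr => t _; rewrite adjM trmxCK.
  by rewrite e2 adjM trmxCK.
have e4 : \sum_t (ptr (A t))^t* *m ptr (A t) = ptr (S^t* *m S).
  rewrite ptr_gram sum_triple; apply: eq_bigr => x _; apply: eq_bigr => y _.
  transitivity (\sum_z (blk S y x)^t* *m (delta_mx z z *m blk S y x)).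
    apply: eq_bigr => z _; rewrite pA adjM adj_delta -!mulmxA; congr (_ *m _).
    by rewrite mulmxA mul_delta_mx.
  by rewrite -mulmx_sumr -mulmx_suml sum_delta1 mul1mx.
transitivity (\sum_t ((A t)^t* *m A t - c%:R^-1 *: ((A t)^t* *m ((1%:M : op c) *t ptr (A t)))
   - c%:R^-1 *: (((1%:M : op c) *t ptr (A t))^t* *m A t)
   + c%:R^-2 *: ((1%:M : op c) *t ((ptr (A t))^t* *m ptr (A t))))).
  apply: eq_bigr => t _; rewrite /hfam -/(A t) /tl adjB adjCZ cc mulmxBl !mulmxBr.
  rewrite -!scalemxAl -!scalemxAr scalerA [(_ *t _)^t*]adj_tens adjC1 tensmx_mul mulmx1.
  have gen (p q r s : op (c * b)) : p - q - (r - s) = p - q - r + s.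
    by rewrite opprB addrA addrAC.
  by rewrite -expr2 exprVn; exact: gen.
rewrite big_split sumrB sumrB /= e1 -!scaler_sumr e2 e3 -tens_sumr e4 -!scalerBl.
by congr (_ *: _ + _); ring.
Qed.

End Attack.

(** * Completing a scaled traceless family to a traceless channel *)

Section Key.
Variable R : realType.
Local Notation C := R[i].
Local Notation op n := 'M[C]_n%N.

Lemma natC (n : nat) : (n%:R : C) = (n%:R : R)%:C.
Proof. by rewrite rmorph_nat. Qed.

Lemma conj_real (z : R) : (z%:C : C)^*%R = z%:C.
Proof. by rewrite conjC_complex conjc_real. Qed.

Lemma psd1 n : psd (1%:M : op n).
Proof. by rewrite -[1%:M]mulmx1 -{1}(adjC1 R n); exact: psd_adj_mul. Qed.

(** Matching of the coefficients of G, of the identity o and of T = 1 (x) ptr G; the T terms have to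
    cancel. *)
Lemma completion_comb m n (o G T : 'M[C]_(m, n)) (u v q p w h y z : C) :
  u * q * p = 16^-1 -> u * q * (4 * p + w) + v * q * y = 3 / 4 ->
  u * q * h + v * q * z = 0 ->
  u *: (q *: (p *: (4 *: o - G) + w *: o + h *: T)) + v *: (q *: (y *: o + z *: T)) =
  (3 / 4) *: o - 16^-1 *: G.
Proof.
move=> e1 e2 e3; apply/matrixP => i j; rewrite !mxE -e1 -e2.
transitivity ((u * q * (4 * p + w) + v * q * y) * o i j - u * q * p * G i j + (u * q * h + v * q * z) * T i j).
  ring.
by rewrite e3 mul0r addr0.
Qed.

(** By [hfam_gram] this asks for a positive solution K of a linear equation in K and 1 (x) ptr K.
    The ansatz combines 4 - G, 1 and 1 (x) ptr G, and all its coefficients turn out nonnegative. The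
    3 / 4 is what the depolarizing branch of weight 1 / 4 leaves of the identity; 1 / 16 is the
    square of the scale 1 / 4 applied to W. *)
Lemma completion c bt b (N : finType) (W : N -> 'M[C]_(c * bt, c * b)) : (1 < c)%N ->
  (forall p (X : 'M[C]_(c * b, p)), \sum_j hs (W j *m X) <= 4 * hs X) ->
  exists S : op (c * b), \sum_t (hfam S t)^t* *m hfam S t =
    (3 / 4) *: 1%:M - 16^-1 *: \sum_j (W j)^t* *m W j.
Proof.
move=> c1 hW; set G := \sum_j _.
have psd4 : psd (4 *: 1%:M - G).
  move=> v; have -> : (v^t* *m (4 *: 1%:M - G) *m v) 0 0 = (4 * hs v - \sum_j hs (W j *m v))%:C.
    transitivity (\tr (v^t* *m (4 *: 1%:M - G) *m v)); first by rewrite /mxtrace big_ord1.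
    rewrite mulmxBr mulmxBl raddfB /= rmorphB rmorphM /= rmorph_nat; congr (_ - _).
      by rewrite -scalemxAr mulmx1 -scalemxAl mxtraceZ trace_adj_mul.
    rewrite /G mulmx_sumr mulmx_suml raddf_sum rmorph_sum; apply: eq_bigr => j _ /=.
    by rewrite -trace_adj_mul adjM !mulmxA.
  by rewrite ler0c subr_ge0.
have psdG : psd (ptr G).
  rewrite /G (lin_sum (@linear_ptr R c b b)); apply: psd_sum => j; exact: psd_ptr_gram.
clearbody G.
pose x : R := c%:R; have x2 : 2 <= x by rewrite ler_nat.
(* g is forced by the cancellation of 1 (x) ptr G, and w by the coefficient 3 / 4 of the identity;
   positivity of w uses c >= 2. *)
pose g := (x ^+ 3 - x)^-1.
have xx : 4 <= x ^+ 2 by nra.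
have x30 : 0 < x ^+ 3 - x.
  have -> : x ^+ 3 - x = x * (x ^+ 2 - 1) by ring.
  by rewrite mulr_gt0 //; lra.
have g0 : 0 <= g by rewrite invr_ge0 ltW.
pose w := 2^-1 - 3 / 4 * (x * g).
have w0 : 0 <= w.
  have : x * g <= 3^-1.
    have -> : x * g = (x ^+ 2 - 1)^-1.
      by rewrite /g; field; rewrite !gt_eqF //=; nra.
    by rewrite lef_pV2 ?posrE; lra.
  by rewrite /w; lra.
pose T := (1%:M : op c) *t ptr G.
pose K0 := (16^-1)%:C *: (4 *: 1%:M - G) + w%:C *: (1%:M : op (c * b)) + (16^-1 * g)%:C *: T.
have psdK : psd K0.
  apply: psdD; first apply: psdD.
  - by apply: psdZ; [rewrite invr_ge0 ler0n | exact: psd4].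
  - by apply: psdZ; [exact: w0 | exact: psd1].
  - by apply: psdZ; [apply: mulr_ge0 g0; rewrite invr_ge0 ler0n | exact: psd_1tens].
have [S KS] := psd_factor psdK.
(* The inverse of the factor c - 2 / c of [hfam_gram]. *)
have u0 : 0 < x / (x ^+ 2 - 2) by rewrite divr_gt0 //; lra.
pose z := Num.sqrt (x / (x ^+ 2 - 2)).
exists (z%:C *: S).
have SS : (z%:C *: S)^t* *m (z%:C *: S) = (x / (x ^+ 2 - 2))%:C *: K0.
  rewrite adjCZ conj_real -scalemxAl -scalemxAr scalerA -rmorphM -expr2 sqr_sqrtr ?ltW //.
  by rewrite KS.
rewrite hfam_gram SS.
have ptrT : ptr T = x%:C *: ptr G by rewrite ptr_tens mxtrace1 natC.
have ptrK : (1%:M : op c) *t ptr K0 = ((16^-1 * 4 + w) * x)%:C *: 1%:M + (16^-1 * (x * g - 1))%:C *: T.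
  rewrite /K0 !(lin_D (@linear_ptr R c b b)) !(lin_Z (@linear_ptr R c b b)).
  rewrite (lin_B (@linear_ptr R c b b)) !(lin_Z (@linear_ptr R c b b)) ptrT.
  have -> : ptr (1%:M : op (c * b)) = x%:C *: 1%:M by rewrite -tens11 ptr_tens mxtrace1 natC.
  rewrite -tens11 /T -!tensZr -!tensDr; congr (_ *t _).
  apply/matrixP => i j; rewrite !mxE.
  rewrite ?(rmorphM, rmorphD, rmorphN, rmorph1, fmorphV, rmorph_nat) /=; ring.
rewrite (lin_Z (@linear_ptr R c b b)) tensZr ptrK /K0.
have xC : (c%:R : C) = x%:C by rewrite natC.
rewrite !xC.
have xn : x%:C != 0 by rewrite -(rmorph0 (real_complex R)) (inj_eq (@complexI R)); apply: lt0r_neq0; lra.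
have xn1 : x%:C ^+ 2 - 1 != 0.
  rewrite -rmorphXn -(rmorph1 (real_complex R)) -rmorphB -(rmorph0 (real_complex R)) (inj_eq (@complexI R)).
  by apply: lt0r_neq0; lra.
have xn2 : x%:C ^+ 2 - 2 != 0.
  rewrite -rmorphXn -(rmorph_nat (real_complex R) 2) -rmorphB -(rmorph0 (real_complex R)) (inj_eq (@complexI R)).
  by apply: lt0r_neq0; lra.
have xn3 : x%:C * (x%:C * x%:C) - x%:C != 0.
  have -> : x%:C * (x%:C * x%:C) - x%:C = x%:C * (x%:C ^+ 2 - 1) by ring.
  by rewrite mulf_neq0.
apply: completion_comb; rewrite /w /g; clearbody x;
  rewrite ?(rmorphM, rmorphD, rmorphN, rmorph1, fmorphV, rmorph_nat, rmorphXn) /=;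
  field; rewrite ?xn ?xn1 ?xn2 ?andbT //=.
Qed.

End Key.

(** * Action of the traceless depolarizing attack *)

Section Depolarizing.
Variable R : realType.
Local Notation C := R[i].
Local Notation op n := 'M[C]_n%N.

Lemma sandwich_trace p q m (A : op m) (B : op p) (J : 'M[C]_(p, q)) (Y : op (m * q)) :
  \tr ((A *t B) *m (((1%:M : op m) *t J) *m Y *m ((1%:M : op m) *t J)^t*)) =
  \tr ((A *t (J^t* *m B *m J)) *m Y).
Proof.
rewrite !mulmxA mxtrace_mulC !mulmxA adj_tens adjC1 !tensmx_mul.
by rewrite mul1mx mulmx1.
Qed.

Lemma kraus_sumT (I J : finType) m n (K : I -> 'M[C]_(n, m)) (G : J -> 'M[C]_(n, m)) X :
  kraus (fun t : I + J => match t with inl i => K i | inr j => G j end) X = kraus K X + kraus G X.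
Proof. by rewrite /kraus big_sumType. Qed.

Lemma kraus_mull (I : finType) m n p (K : I -> 'M[C]_(n, m)) (P : 'M[C]_(p, n)) X :
  kraus (fun i => P *m K i) X = P *m kraus K X *m P^t*.
Proof.
rewrite /kraus mulmx_sumr mulmx_suml; apply: eq_bigr => i _.
by rewrite adjM !mulmxA.
Qed.

Lemma krausZ (I : finType) m n (K : I -> 'M[C]_(n, m)) (z : R) X :
  kraus (fun i => z%:C *: K i) X = (z ^+ 2)%:C *: kraus K X.
Proof.
rewrite /kraus scaler_sumr; apply: eq_bigr => i _.
by rewrite adjCZ conj_real -!scalemxAl -scalemxAr scalerA -rmorphM -expr2.
Qed.

(** Randomizing over the traceless matrix units: a depolarizing map without its
    identity component. *)
Lemma dep_action c b (z : R) (Y : op c) (rho : op b) :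
  kraus (hfam (z%:C *: (1%:M : op (c * b)))) (Y *t rho) =
  (z ^+ 2)%:C *: (\tr rho *: ((\tr Y *: 1%:M - c%:R^-1 *: Y) *t (1%:M : op 1))).
Proof.
case: (posnP c) => [c0|c0].
  by apply/matrixP => -[i hi]; exfalso; move: hi; rewrite c0.
have cn : c%:R != 0 :> C by rewrite pnatr_eq0 -lt0n.
have cc : (c%:R^-1 : C)^*%R = c%:R^-1 by rewrite fmorphV rmorph_nat.
pose A x y : op c := delta_mx x y - c%:R^-1 *: ((x == y)%:R *: 1%:M).
have hE t : hfam (z%:C *: (1%:M : op (c * b))) t =
    z%:C *: (A t.1.1 t.1.2 *t delta_mx 0 t.2).
  rewrite /hfam -scalemxAr mulmx1 /tl (lin_Z (@linear_ptr R c 1 b)) ptr_tens trace_delta.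
  by rewrite /A (lin_B (linear_tensl _)) !tensZr !tensZl scalerBr !scalerA; congr (_ - _ *: _); ring.
have hE' X : kraus (hfam (z%:C *: (1%:M : op (c * b)))) X =
   (z ^+ 2)%:C *: kraus (fun t : 'I_c * 'I_c * 'I_b => A t.1.1 t.1.2 *t delta_mx 0 t.2) X.
  by rewrite -krausZ; apply: eq_bigr => t _; rewrite hE.
rewrite hE'; congr (_ *: _).
have s1 (x y : 'I_c) : \sum_(w < b) (A x y *t (delta_mx 0 w : 'rV_b)) *m (Y *t rho) *m (A x y *t (delta_mx 0 w : 'rV_b))^t*
   = \tr rho *: ((A x y *m Y *m (A x y)^t*) *t 1%:M).
  rewrite /mxtrace scaler_suml; apply: eq_bigr => w _.
  rewrite adj_tens !tensmx_mul -tensZr; congr (_ *t _).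
  apply/matrixP => i j; rewrite !ord1 adj_delta mulmx_deltar mulmx_deltal !mxE.
  by rewrite !eqxx mul1r !mulr1.
rewrite /kraus sum_triple /=.
under eq_bigr => x _ do under eq_bigr => y _ do rewrite s1.
under eq_bigr => x _ do rewrite -scaler_sumr -tens_suml.
rewrite -scaler_sumr -tens_suml; congr (_ *: (_ *t _)).
have AE x y : A x y *m Y *m (A x y)^t* = Y y y *: delta_mx x x
    - c%:R^-1 *: ((x == y)%:R *: (delta_mx x x *m Y)) - c%:R^-1 *: ((x == y)%:R *: (Y *m delta_mx x x))
    + c%:R^-1 *: (c%:R^-1 *: ((x == y)%:R *: Y)).
  rewrite /A adjB adj_delta !adjCZ cc rmorph_nat adjC1 mulmxBl !mulmxBr !mulmxBl.
  have e1 : (delta_mx x y : op c) *m Y *m delta_mx y x = Y y y *: delta_mx x x.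
    apply/matrixP => i j; rewrite mulmx_deltar mulmx_deltal !mxE.
    by case: (i == x); case: (j == x); rewrite ?mul0r ?mul1r ?mulr0 ?mulr1.
  have gen (p q r s : op c) : p - q - (r - s) = p - r - q + s.
    by rewrite opprB addrA addrAC; congr (_ + _); exact: addrAC.
  rewrite e1; case: (eqVneq x y) => [<-|xy].
    rewrite !scale1r -!scalemxAl -!scalemxAr -?scalemxAl !mul1mx !mulmx1.
    by rewrite gen.
  by rewrite !scale0r !scaler0 !mul0mx !mulmx0 !subr0 addr0.
under eq_bigr => x _ do under eq_bigr => y _ do rewrite AE.
under eq_bigr => x _ do rewrite big_split sumrB sumrB /=.
have sel (F : 'I_c -> op c) (x : 'I_c) : \sum_y (x == y)%:R *: F x = F x.
  rewrite (bigD1 x) //= big1 ?addr0 ?eqxx ?scale1r // => y yx.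
  by rewrite eq_sym (negbTE yx) scale0r.
under eq_bigr => x _.
  rewrite -scaler_suml -[\sum_i Y i i]/(\tr Y) -!scaler_sumr.
  rewrite (sel (fun x => delta_mx x x *m Y)) (sel (fun x => Y *m delta_mx x x)) (sel (fun _ => Y)); over.
rewrite big_split sumrB sumrB /= -!scaler_sumr -mulmx_suml -mulmx_sumr !sum_delta1 mul1mx mulmx1.
have -> : \sum_(x < c) Y = c%:R *: Y by rewrite sumr_const card_ord scaler_nat.
by rewrite [c%:R^-1 *: (c%:R *: Y)]scalerA (mulVf cn) scale1r subrK.
Qed.

End Depolarizing.

(** * Effective channels of composite attacks, and decrypted noise *)

Section Key.
Variable R : realType.
Local Notation C := R[i].
Local Notation op n := 'M[C]_n%N.

Lemma abs_tr_psd n (V Y : op n) : contr V -> psd Y -> abs (\tr (V *m Y)) <= complex.Re (\tr Y).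
Proof.
move=> cV hY; have [S SY] := psd_factor hY.
have := contr_tr (S^t*) (S^t*) cV.
have -> : \tr (S^t*^t* *m (V *m S^t*)) = \tr (V *m Y).
  by rewrite trmxCK mxtrace_mulC SY mulmxA.
have -> : \tr Y = (hs S)%:C by rewrite SY trace_adj_mul.
rewrite hs_adj /=; lra.
Qed.

Lemma eff_tens k a c a1 (I J : finType) (e : 'I_k -> I -> 'M[C]_(c, a))
    (d : 'I_k -> J -> 'M[C]_(a1, c)) b b' (L : op (c * b) -> op (c * b')) X (rho : op b) :
  eff e d L (X *t rho) = k%:R^-1 *: \sum_i on1 (kraus (d i)) (L (kraus (e i) X *t rho)).
Proof.
apply: (congr1 (fun S => k%:R^-1 *: S)); apply: eq_bigr => i _; rewrite on1_tens //.
exact: linear_kraus.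
Qed.

Lemma eq_eff k a c a1 (I J : finType) (e : 'I_k -> I -> 'M[C]_(c, a))
    (d : 'I_k -> J -> 'M[C]_(a1, c)) b b' (L L' : op (c * b) -> op (c * b')) X :
  (forall Y, L Y = L' Y) -> eff e d L X = eff e d L' X.
Proof. by move=> LL; apply: (congr1 (fun S => k%:R^-1 *: S)); apply: eq_bigr => i _; rewrite LL. Qed.

Lemma eff_add k a c a1 (I J : finType) (e : 'I_k -> I -> 'M[C]_(c, a))
    (d : 'I_k -> J -> 'M[C]_(a1, c)) b b' (L L' : op (c * b) -> op (c * b')) X :
  eff e d (fun Y => L Y + L' Y) X = eff e d L X + eff e d L' X.
Proof.
rewrite /eff -scalerDr -big_split; congr (_ *: _); apply: eq_bigr => i _ /=.
by rewrite (lin_D (linear_on1 (linear_kraus (d i)))).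
Qed.

Lemma effZ k a c a1 (I J : finType) (e : 'I_k -> I -> 'M[C]_(c, a))
    (d : 'I_k -> J -> 'M[C]_(a1, c)) b b' (L : op (c * b) -> op (c * b')) z X :
  eff e d (fun Y => z *: L Y) X = z *: eff e d L X.
Proof.
have h : \sum_i on1 (kraus (d i)) (z *: L (on1 (kraus (e i)) X)) =
    z *: \sum_i on1 (kraus (d i)) (L (on1 (kraus (e i)) X)).
  by rewrite scaler_sumr; apply: eq_bigr => i _; exact: lin_Z (linear_on1 (linear_kraus (d i))) _ _.
by apply: etrans (congr1 (fun S => k%:R^-1 *: S) h) _; rewrite scalerA mulrC -scalerA.
Qed.

Lemma eff_post k a c a1 (I J : finType) (e : 'I_k -> I -> 'M[C]_(c, a))
    (d : 'I_k -> J -> 'M[C]_(a1, c)) b b' b'' (L : op (c * b) -> op (c * b')) (T : 'M[C]_(b'', b')) X :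
  eff e d (fun Y => ((1%:M : op c) *t T) *m L Y *m ((1%:M : op c) *t T)^t*) X =
  ((1%:M : op a1) *t T) *m eff e d L X *m ((1%:M : op a1) *t T)^t*.
Proof.
rewrite /eff -scalemxAr -scalemxAl; congr (_ *: _); rewrite mulmx_sumr mulmx_suml.
apply: eq_bigr => i _; move: (L _) => Y.
rewrite !on1_kraus /kraus mulmx_sumr mulmx_suml; apply: eq_bigr => j _.
have h : (d i j *t 1%:M) *m ((1%:M : op c) *t T) = ((1%:M : op a1) *t T) *m (d i j *t 1%:M).
  by rewrite !tensmx_mul !mulmx1 !mul1mx.
rewrite !mulmxA h -!mulmxA -!adjM h !adjM; done.
Qed.

Section Scheme.
Variables (k a c : nat) (I J : finType).
Variables (e : 'I_k -> I -> 'M[C]_(c, a)) (d : 'I_k -> J -> 'M[C]_(a + 1, c)).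
Hypothesis k0 : (0 < k)%N.
Hypothesis c1 : (1 < c)%N.
Hypothesis e1 : forall i, \sum_j (e i j)^t* *m e i j = 1%:M.
Hypothesis d1 : forall i, \sum_j (d i j)^t* *m d i j = 1%:M.
Hypothesis de : forall i X, kraus (d i) (kraus (e i) X) = inj_bot R a *m X *m (inj_bot R a)^t*.
Variable eps : R.
Hypothesis eps0 : 0 <= eps.

(** [omega] is the decryption of the maximally mixed ciphertext, averaged over
    the key, and [gam] the effective channel of the attack which depolarizes
    the ciphertext by random non-identity Pauli operators. *)
Definition omega : op (a + 1) := (c%:R * k%:R)^-1 *: \sum_i kraus (d i) 1%:M.

Definition gam (X : op a) : op (a + 1) :=
  (c%:R ^+ 2 - 1)^-1 *: ((c%:R ^+ 2 * \tr X) *: omega - inj_bot R a *m X *m (inj_bot R a)^t*).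

(** The one consequence of non-malleability used from here on; entropies do not occur any more. *)
Definition nm_prod := forall b b' (L : op (c * b) -> op (c * b')) (rho : op b) (V : op ((a + 1) * b')) s s',
  cptp L -> p_eq L rho = 0 -> state rho -> contr V ->
  abs (\tr (V *m (eff e d L (delta_mx s s' *t rho)
     - trr (eff e d L (delta_mx s s' *t rho)) *t trl (eff e d L (mixed R a *t rho))))) ^+ 2
  <= a%:R ^+ 2 * (4 * (ln 2 * eps)).

Lemma trace_mul_gam (A : op (a + 1)) X : \tr (A *m gam X) =
  (c%:R ^+ 2 - 1)^-1 * (c%:R ^+ 2 * \tr X * \tr (A *m omega)
    - \tr ((inj_bot R a)^t* *m A *m inj_bot R a *m X)).
Proof.
rewrite /gam -scalemxAr mxtraceZ mulmxBr linearB /= -scalemxAr mxtraceZ; congr (_ * (_ - _)).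
by rewrite !mulmxA mxtrace_mulC !mulmxA.
Qed.
(** The condition on z makes the Gram sum of this branch equal to 1 / 4, by (c - 2 / c) + 1 / c = c
    - 1 / c. Removing the identity component subtracts the ciphertext itself, which decrypts to the
    plaintext: hence the negative term of [gam]. *)
Lemma dep_eff (z : R) b (A : op (a + 1)) X (rho : op b) :
  z ^+ 2 = 4^-1 * (c%:R - c%:R^-1)^-1 ->
  \tr ((A *t (1%:M : op 1)) *m eff e d (kraus (hfam (z%:C *: (1%:M : op (c * b))))) (X *t rho)) =
  4^-1 * \tr (A *m gam X) * \tr rho.
Proof.
move=> z2; rewrite eff_tens.
have kn : k%:R != 0 :> C by rewrite pnatr_eq0 -lt0n.
have cn : c%:R != 0 :> C by rewrite pnatr_eq0 -lt0n ltnW.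
have cn2 : c%:R ^+ 2 - 1 != 0 :> C.
  by rewrite subr_eq0 -natrX -[1]/(1%:R) eqr_nat; case: (c) c1 => [|[|n]] //; rewrite -addn2 sqrnD.
have -> : k%:R^-1 *: \sum_i on1 (kraus (d i)) (kraus (hfam (z%:C *: (1%:M : op (c * b)))) (kraus (e i) X *t rho))
  = (z ^+ 2)%:C *: (\tr rho *: (((\tr X * c%:R) *: omega - c%:R^-1 *: (inj_bot R a *m X *m (inj_bot R a)^t*)) *t 1%:M)).
  transitivity (k%:R^-1 *: \sum_i (z ^+ 2)%:C *: (\tr rho *: ((\tr X *: kraus (d i) 1%:M
      - c%:R^-1 *: (inj_bot R a *m X *m (inj_bot R a)^t*)) *t (1%:M : op 1)))).
    congr (_ *: _); apply: eq_bigr => i _; rewrite dep_action.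
    rewrite !(lin_Z (linear_on1 (linear_kraus (d i)))) on1_tens; last exact: linear_kraus.
    rewrite (lin_B (linear_kraus (d i))) !(lin_Z (linear_kraus (d i))) de.
    by have /kraus_tp -> := e1 i.
  have comm m (p q r : C) (Z : op m) : p *: (q *: (r *: Z)) = q *: (r *: (p *: Z)).
    by rewrite !scalerA; congr (_ *: _); ring.
  rewrite -!scaler_sumr -tens_suml comm; congr (_ *: (_ *: _)); rewrite -tensZl; congr (_ *t _).
  rewrite sumrB -scaler_sumr sumr_const card_ord -[(_ *: _) *+ k]scaler_nat scalerBr /omega !scalerA.
  by congr (_ *: _ - _ *: _); field; rewrite ?cn ?kn.
rewrite trace_mul_gam -!scalemxAr !mxtraceZ tensmx_mul trace_tens mulmx1 mxtrace1 mulr1.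
have cyc : \tr (A *m (inj_bot R a *m X *m (inj_bot R a)^t*)) = \tr ((inj_bot R a)^t* *m A *m inj_bot R a *m X).
  by rewrite !mulmxA mxtrace_mulC !mulmxA.
rewrite mulmxBr trB -!scalemxAr !mxtraceZ cyc z2.
have -> : (4^-1 * (c%:R - c%:R^-1)^-1)%:C = 4^-1 * (c%:R - c%:R^-1)^-1 :> C.
  by rewrite rmorphM !fmorphV rmorphB fmorphV !rmorph_nat.
by field; rewrite cn2 cn kn.
Qed.

End Scheme.
End Key.

Section Omega.
Variable R : realType.
Local Notation C := R[i].
Local Notation op n := 'M[C]_n%N.
Variables (k a c : nat) (J : finType) (d : 'I_k -> J -> 'M[C]_(a + 1, c)).
Hypothesis k0 : (0 < k)%N.
Hypothesis c1 : (1 < c)%N.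
Hypothesis d1 : forall i, \sum_j (d i j)^t* *m d i j = 1%:M.

Lemma psd_omega : psd (omega d).
Proof.
rewrite /omega !natC -rmorphM -fmorphV; apply: psdZ; first by rewrite invr_ge0 mulr_ge0.
by apply: psd_sum => i; apply: psd_kraus; exact: psd1.
Qed.

Lemma tr_omega : \tr (omega d) = 1.
Proof.
have cn : c%:R != 0 :> C by rewrite pnatr_eq0 -lt0n ltnW.
have kn : k%:R != 0 :> C by rewrite pnatr_eq0 -lt0n.
rewrite /omega mxtraceZ.
have -> : \tr (\sum_i kraus (d i) 1%:M) = k%:R * c%:R.
  rewrite raddf_sum -[k in k%:R]card_ord mulr_natl -sumr_const; apply: eq_bigr => i _ /=.
  by have /kraus_tp -> := d1 i; rewrite mxtrace1.
by rewrite mulrC invfM; field; rewrite cn kn.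
Qed.

End Omega.

(** * The product form of traceless attacks *)

Section Key.
Variable R : realType.
Local Notation C := R[i].
Local Notation op n := 'M[C]_n%N.

Lemma ReD (x y : C) : complex.Re (x + y) = complex.Re x + complex.Re y.
Proof. by case: x => ? ?; case: y. Qed.

Lemma Re_sum (I : Type) (r : seq I) (P : pred I) (F : I -> C) :
  complex.Re (\sum_(i <- r | P i) F i) = \sum_(i <- r | P i) complex.Re (F i).
Proof. by elim/big_rec2: _ => // i x y _ <-; rewrite ReD. Qed.

Section Scheme.
Variables (k a c : nat) (I J : finType).
Variables (e : 'I_k -> I -> 'M[C]_(c, a)) (d : 'I_k -> J -> 'M[C]_(a + 1, c)).
Hypothesis k0 : (0 < k)%N.
Hypothesis a0 : (0 < a)%N.
Hypothesis c1 : (1 < c)%N.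
Hypothesis e1 : forall i, \sum_j (e i j)^t* *m e i j = 1%:M.
Hypothesis d1 : forall i, \sum_j (d i j)^t* *m d i j = 1%:M.
Hypothesis de : forall i X, kraus (d i) (kraus (e i) X) = inj_bot R a *m X *m (inj_bot R a)^t*.
Variable eps : R.
Hypothesis eps0 : 0 <= eps.
Hypothesis nm : nm_prod e d eps.

Lemma state_mixed : state (mixed R a).
Proof.
split; last by rewrite /mixed mxtraceZ mxtrace1 mulVf // pnatr_eq0 -lt0n.
rewrite /mixed natC -fmorphV; apply: psdZ; [by rewrite invr_ge0 ler0n | exact: psd1].
Qed.

Lemma trace_kraus_le m n (N : finType) (W : N -> 'M[C]_(n, m)) (Y : op m) (z : R) :
  (forall p (X : 'M[C]_(m, p)), \sum_j hs (W j *m X) <= z * hs X) -> psd Y ->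
  complex.Re (\tr (kraus W Y)) <= z * complex.Re (\tr Y).
Proof.
move=> hW /psd_factor [S ->].
have -> : \tr (S^t* *m S) = (hs (S^t*))%:C by rewrite hs_adj trace_adj_mul.
apply: le_trans (hW _ (S^t*)); rewrite le_eqVlt; apply/orP; left; apply/eqP.
rewrite -{2}[S]trmxCK kraus_adj_mul.
have -> : \tr (\sum_i W i *m S^t* *m (W i *m S^t*)^t*) = (\sum_j hs (W j *m S^t*))%:C.
  rewrite rmorph_sum [LHS]raddf_sum; apply: eq_bigr => j _; exact: trace_mul_adj.
by [].
Qed.

Lemma tr_eff b b' (L : op (c * b) -> op (c * b')) X : linear L ->
  \tr (eff e d L X) = k%:R^-1 * \sum_i \tr (L (on1 (kraus (e i)) X)).
Proof.
move=> lL; rewrite /eff mxtraceZ raddf_sum; congr (_ * _); apply: eq_bigr => i _ /=.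
by rewrite tp_on1; [|exact: linear_kraus|exact/kraus_tp].
Qed.

Lemma trace_eff_le b bt (N : finType) (W : N -> 'M[C]_(c * bt, c * b)) (X : op (a * b)) (z : R) :
  0 <= z ->
  (forall p (X : 'M[C]_(c * b, p)), \sum_j hs (W j *m X) <= z * hs X) -> psd X ->
  complex.Re (\tr (eff e d (kraus W) X)) <= z * complex.Re (\tr X).
Proof.
move=> z0 hW hX; rewrite tr_eff; last exact: linear_kraus.
have kR : (k%:R : R) != 0 by rewrite pnatr_eq0 -lt0n.
have -> : complex.Re (k%:R^-1 * \sum_i \tr (kraus W (on1 (kraus (e i)) X))) =
   k%:R^-1 * \sum_i complex.Re (\tr (kraus W (on1 (kraus (e i)) X))).
  rewrite natC -fmorphV; have reM (x : R) y : complex.Re (x%:C * y) = x * complex.Re y.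
    by case: y => u v; simpc.
  by rewrite reM Re_sum.
rewrite ler_pdivrMl ?ltr0n //.
have : \sum_(i < k) complex.Re (\tr (kraus W (on1 (kraus (e i)) X))) <= \sum_(i < k) z * complex.Re (\tr X).
  apply: ler_sum => i _; apply: le_trans (trace_kraus_le hW _) _.
    by case: (cp_kraus (e i)) => _; apply.
  by rewrite tp_on1; [|exact: linear_kraus|exact/kraus_tp].
by rewrite sumr_const card_ord -[_ *+ k]mulr_natl.
Qed.

Lemma psd_eff b bt (N : finType) (W : N -> 'M[C]_(c * bt, c * b)) (X : op (a * b)) :
  psd X -> psd (eff e d (kraus W) X).
Proof.
have [lE cE] := @cp_eff R k a c I J e d _ _ _ (cp_kraus W).
move=> hX; rewrite /eff natC -fmorphV; apply: psdZ; first by rewrite invr_ge0 ler0n.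
apply: psd_sum => i; case: (cp_kraus (d i)) => _; apply.
by apply: psd_kraus; case: (cp_kraus (e i)) => _; apply.
Qed.

Lemma tens_mul_trace m n (A : op m) (B : op n) (X : op m) (Y : op n) :
  \tr ((A *t B) *m (X *t Y)) = \tr (A *m X) * \tr (B *m Y).
Proof. by rewrite tensmx_mul trace_tens. Qed.

Lemma tr_tens0 m n (A : op m) (X : op (m * n)) : \tr ((A *t (0 : op n)) *m X) = 0.
Proof. by rewrite tensmx0 mul0mx mxtrace0. Qed.

Lemma trace_trl m n (B : op n) (Y : op (m * n)) : \tr (B *m trl Y) = \tr (((1%:M : op m) *t B) *m Y).
Proof.
move: Y; apply: tens_ext_scalar.
- by move=> z X Y; rewrite linear_trl mulmxDr -scalemxAr mxtraceD mxtraceZ.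
- by move=> z X Y; rewrite mulmxDr -scalemxAr mxtraceD mxtraceZ.
- by move=> X Y; rewrite trl_tens tens_mul_trace mul1mx -scalemxAr mxtraceZ.
Qed.

Lemma trace_gam X : \tr (gam d X) = \tr X.
Proof.
have cn : c%:R != 0 :> C by rewrite pnatr_eq0 -lt0n ltnW.
have kn : k%:R != 0 :> C by rewrite pnatr_eq0 -lt0n.
have cn2 : c%:R ^+ 2 - 1 != 0 :> C.
  by rewrite subr_eq0 -natrX -[1]/(1%:R) eqr_nat; case: (c) c1 => [|[|n]] //; rewrite -addn2 sqrnD.
have tro : \tr (omega d) = 1.
  rewrite /omega mxtraceZ.
  have -> : \tr (\sum_i kraus (d i) 1%:M) = k%:R * c%:R.
    rewrite raddf_sum -[k in k%:R]card_ord mulr_natl -sumr_const; apply: eq_bigr => i _ /=.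
    by have /kraus_tp -> := d1 i; rewrite mxtrace1.
  by rewrite mulrC invfM; field; rewrite cn kn.
rewrite /gam mxtraceZ linearB /= mxtraceZ tro mulr1 mxtrace_mulC mulmxA inj_botK mul1mx.
by field.
Qed.

(** Elimination of the unknown marginal g: 64 = 32 + 8 * 4. *)
Lemma abs_chain (f y g n : C) (p q : R) : abs (y - g) <= 8 * p * q ->
  abs (f - g * n) <= 32 * p * q -> abs n <= 4 -> 0 <= p * q -> abs (f - y * n) <= 64 * p * q.
Proof.
move=> hg hf hn pq; have -> : f - y * n = (f - g * n) - (y - g) * n by ring.
apply: le_trans (ler_absD _ _) _; rewrite absN absM.
have h3 := ler_pM (abs_ge0 _) (abs_ge0 _) hg hn.
nra.
Qed.

(** A test supported on one flag sees only that branch, while the plaintext marginal g is that of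
    the whole channel. So g can be computed in the depolarizing branch and inserted into the branch
    of W. The branch weights 1 / 4 and 1 / 16 turn the error 2 a eta into 8 a eta and 32 a eta. *)
Lemma attack_product b bt (N : finType) (W : N -> 'M[C]_(c * bt, c * b)) (rho : op b)
    (A : op (a + 1)) (B : op bt) s s' :
  (forall j, ptr (W j) = 0) ->
  (forall p (X : 'M[C]_(c * b, p)), \sum_j hs (W j *m X) <= 4 * hs X) ->
  state rho -> contr A -> contr B ->
  abs (\tr ((A *t B) *m eff e d (kraus W) (delta_mx s s' *t rho))
       - \tr (A *m gam d (delta_mx s s')) *
         \tr (((1%:M : op (a + 1)) *t B) *m eff e d (kraus W) (mixed R a *t rho)))
  <= 64 * a%:R * Num.sqrt eps.
Proof.
move=> W0 W4 srho cA cB.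
have [S SE] := completion c1 W4.
pose x : R := c%:R; have x2 : 2 <= x by rewrite ler_nat.
have xx : 0 < x - x^-1.
  have h : x^-1 <= 2^-1 by rewrite lef_pV2 ?posrE; lra.
  lra.
pose z := Num.sqrt (4^-1 * (x - x^-1)^-1).
have z2 : z ^+ 2 = 4^-1 * (x - x^-1)^-1.
  by rewrite sqr_sqrtr // mulr_ge0 ?invr_ge0 // ltW.
(* Isometries into orthogonal sectors of one side register, serving as flags. The sector J2 of the
   completing branch is annihilated by both tests below. *)
pose J0 : 'M[C]_(bt + (1 + 1), bt) := col_mx 1%:M 0.
pose J1 : 'M[C]_(bt + (1 + 1), 1) := col_mx 0 (col_mx 1%:M 0).
pose J2 : 'M[C]_(bt + (1 + 1), 1) := col_mx 0 (col_mx 0 1%:M).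
have [J00 J11 J22] : [/\ J0^t* *m J0 = 1%:M, J1^t* *m J1 = 1%:M & J2^t* *m J2 = 1%:M].
  by split; rewrite /J0 /J1 /J2 ?tr_col_mx ?map_row_mx ?tr_col_mx ?map_row_mx ?trmx0 ?map_mx0 ?adjC1 !mul_row_col ?mul1mx ?mulmx0 ?mul0mx ?addr0 ?add0r ?mul_row_col ?mul1mx ?mulmx0 ?addr0 ?add0r.
have [J01 J02 J12] : [/\ J0^t* *m J1 = 0, J0^t* *m J2 = 0 & J1^t* *m J2 = 0].
  by split; rewrite /J0 /J1 /J2 ?tr_col_mx ?map_row_mx ?tr_col_mx ?map_row_mx ?trmx0 ?map_mx0 ?adjC1 !mul_row_col ?mul1mx ?mulmx0 ?mul0mx ?addr0 ?add0r ?mul_row_col ?mul1mx ?mulmx0 ?mul0mx ?addr0 ?add0r.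
have [J10 J20 J21] : [/\ J1^t* *m J0 = 0, J2^t* *m J0 = 0 & J2^t* *m J1 = 0].
  by split; rewrite -[LHS]trmxCK adjM trmxCK ?J01 ?J02 ?J12 trmx0 map_mx0.
clearbody J0 J1 J2.
pose c0 : (0 < c)%N := ltnW c1.
pose K (t : N + ('I_c * 'I_c * 'I_b + 'I_c * 'I_c * 'I_b)) : 'M[C]_(c * (bt + (1 + 1)), c * b) :=
  match t with
  | inl j => ((1%:M : op c) *t J0) *m ((4^-1)%:C *: W j)
  | inr (inl t) => ((1%:M : op c) *t J1) *m hfam (z%:C *: 1%:M) t
  | inr (inr t) => ((1%:M : op c) *t J2) *m hfam S t
  end.
have K0 t : ptr (K t) = 0.
  case: t => [j|[t|t]]; rewrite /K ptr_mull ?ptr_tl ?mulmx0 //.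
  by rewrite (lin_Z (@linear_ptr R c bt b)) W0 scaler0 mulmx0.
have gramJ q (T : 'M[C]_(bt + (1 + 1), q)) (X : 'M[C]_(c * q, c * b)) : T^t* *m T = 1%:M ->
    (((1%:M : op c) *t T) *m X)^t* *m (((1%:M : op c) *t T) *m X) = X^t* *m X.
  move=> TT; rewrite adjM -mulmxA; congr (_ *m _); rewrite mulmxA adj_tens tensmx_mul TT.
  by rewrite adjC1 mul1mx tens11 mul1mx.
have gramZ : \sum_t (hfam (z%:C *: (1%:M : op (c * b))) t)^t* *m hfam (z%:C *: 1%:M) t = 4^-1 *: 1%:M.
  rewrite hfam_gram; have -> : (z%:C *: (1%:M : op (c * b)))^t* *m (z%:C *: 1%:M) = (z ^+ 2)%:C *: 1%:M.
    by rewrite adjCZ conj_real adjC1 -scalemxAl mul1mx scalerA -rmorphM.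
  rewrite z2 (lin_Z (@linear_ptr R c b b)) -tens11 ptr_tens mxtrace1 !tensZr tens11 !scalerA -scalerDl.
  congr (_ *: _); rewrite (natC R c) -/x -(rmorph_nat (real_complex R) 2) -(rmorph_nat (real_complex R) 4).
  rewrite -!(rmorphM, rmorphB, fmorphV, rmorphXn) -rmorphD /=; congr (_%:C).
  field; rewrite !gt_eqF //=; nra.
have q16 : ((4^-1 : R)%:C * (4^-1 : R)%:C) = 16^-1 :> C.
  by rewrite fmorphV rmorph_nat -invfM -natrM.
(* The Gram sums of the branches are G / 16, 1 / 4 and 3 / 4 - G / 16. *)
have Ktp : \sum_t (K t)^t* *m K t = 1%:M.
  transitivity (16^-1 *: (\sum_j (W j)^t* *m W j) + (4^-1 *: 1%:M + ((3 / 4) *: 1%:M - 16^-1 *: \sum_j (W j)^t* *m W j))); last first.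
    rewrite addrCA [_ + (_ - _)]addrC subrK -scalerDl.
    have -> : 4^-1 + 3 / 4 = 1 :> C by field.
    exact: scale1r.
  rewrite big_sumType big_sumType; congr (_ + (_ + _)).
  - rewrite scaler_sumr; apply: eq_bigr => j _; apply: etrans (gramJ _ _ _ J00) _.
    by rewrite adjCZ conj_real -scalemxAl -scalemxAr scalerA q16.
  - apply: etrans _ gramZ; apply: eq_bigr => t _; exact: gramJ J11.
  - apply: etrans _ SE; apply: eq_bigr => t _; exact: gramJ J22.
have cK : cptp (kraus K) by split; [exact: cp_kraus | exact/kraus_tp].
have test V s1 s2 : contr V -> abs (\tr (V *m (eff e d (kraus K) (delta_mx s1 s2 *t rho)
     - trr (eff e d (kraus K) (delta_mx s1 s2 *t rho)) *t trl (eff e d (kraus K) (mixed R a *t rho)))))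
  <= 2 * a%:R * Num.sqrt eps.
  move=> cV; have h := nm s1 s2 cK (p_eq_traceless rho K0) srho cV.
  rewrite -(@ler_pXn2r _ 2) // ?nnegrE ?abs_ge0 //; last by rewrite !mulr_ge0 ?sqrtr_ge0.
  apply: le_trans h _; rewrite !exprMn sqr_sqrtr // .
  have ln21 : ln 2 <= 1 :> R.
    by have := @le_ln1Dx R 1; apply; lra.
  have a2 : 0 <= (a%:R : R) ^+ 2 by exact: sqr_ge0.
  have h2 : ln 2 * eps <= eps by rewrite ler_piMl.
  have := ler_wpM2l a2 h2; nra.
have expand (A' : op (a + 1)) (B' : op (bt + (1 + 1))) X :
  \tr ((A' *t B') *m eff e d (kraus K) X) =
  16^-1 * \tr ((A' *t (J0^t* *m B' *m J0)) *m eff e d (kraus W) X)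
  + (\tr ((A' *t (J1^t* *m B' *m J1)) *m eff e d (kraus (hfam (z%:C *: 1%:M))) X)
  + \tr ((A' *t (J2^t* *m B' *m J2)) *m eff e d (kraus (hfam S)) X)).
  pose L1 Y := (16^-1 : C) *: (((1%:M : op c) *t J0) *m kraus W Y *m ((1%:M : op c) *t J0)^t*).
  pose L2 Y := ((1%:M : op c) *t J1) *m kraus (hfam (z%:C *: (1%:M : op (c * b)))) Y *m ((1%:M : op c) *t J1)^t*.
  pose L3 Y := ((1%:M : op c) *t J2) *m kraus (hfam S) Y *m ((1%:M : op c) *t J2)^t*.
  have KE Y : kraus K Y = L1 Y + (L2 Y + L3 Y).
    apply: etrans (kraus_sumT _ _ _) _; congr (_ + _); last first.
      by apply: etrans (kraus_sumT _ _ _) _; congr (_ + _); exact: kraus_mull.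
    apply: etrans (kraus_mull _ _ _) _; rewrite krausZ -scalemxAr -scalemxAl.
    by rewrite rmorphM q16.
  have -> : eff e d (kraus K) X = eff e d L1 X + (eff e d L2 X + eff e d L3 X).
    apply: etrans (eq_eff _ _ _ KE) _; apply: etrans (eff_add _ _ _ _ _) _.
    by congr (_ + _); exact: eff_add.
  clear KE.
  rewrite !mulmxDr !mxtraceD /L1 /L2 /L3 effZ !eff_post -scalemxAr mxtraceZ !sandwich_trace.
  by [].
clear K0 Ktp cK; clearbody K.
have eta0 : 0 <= Num.sqrt eps by exact: sqrtr_ge0.
set eta := Num.sqrt eps in test eta0 *.
pose g := \tr (A *m trr (eff e d (kraus K) (delta_mx s s' *t rho))).
have trrho : \tr rho = 1 by case: srho.
have trm : \tr (mixed R a) = 1 by case: state_mixed.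
have four (y : C) (r : R) : abs (4^-1 * y) <= r -> abs y <= 4 * r.
  have -> : (4^-1 : C) = (4^-1)%:C by rewrite fmorphV rmorph_nat.
  by rewrite absM abs_real ger0_norm ?invr_ge0 // ler_pdivrMl.
have sixteen (y : C) (r : R) : abs (16^-1 * y) <= r -> abs y <= 16 * r.
  have -> : (16^-1 : C) = (16^-1)%:C by rewrite fmorphV rmorph_nat.
  by rewrite absM abs_real ger0_norm ?invr_ge0 // ler_pdivrMl.
have hg : abs (\tr (A *m gam d (delta_mx s s')) - g) <= 8 * a%:R * eta.
  have cV : contr (A *t (J1 *m J1^t*)).
    apply: contr_tens => //; apply: contrM; first exact: contr_isometry.
    exact/contr_adj/contr_isometry.
  have ex (A' : op (a + 1)) X : \tr ((A' *t (J1 *m J1^t*)) *m eff e d (kraus K) X) =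
     \tr ((A' *t (1%:M : op 1)) *m eff e d (kraus (hfam (z%:C *: 1%:M))) X).
    rewrite expand.
    have -> : J1^t* *m (J1 *m J1^t*) *m J1 = 1%:M by rewrite mulmxA J11 mul1mx J11.
    have -> : J0^t* *m (J1 *m J1^t*) *m J0 = 0 by rewrite mulmxA J01 !mul0mx.
    have -> : J2^t* *m (J1 *m J1^t*) *m J2 = 0 by rewrite mulmxA J21 !mul0mx.
    by rewrite tr_tens0 [X in _ + (_ + X)]tr_tens0 mulr0 add0r addr0.
  have := test _ s s' cV.
  have -> : \tr ((A *t (J1 *m J1^t*)) *m (eff e d (kraus K) (delta_mx s s' *t rho)
     - trr (eff e d (kraus K) (delta_mx s s' *t rho)) *t trl (eff e d (kraus K) (mixed R a *t rho))))
     = 4^-1 * (\tr (A *m gam d (delta_mx s s')) - g).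
    rewrite mulmxBr linearB mulrBr /=; congr (_ - _).
      apply: etrans (ex _ _) _; apply: etrans (dep_eff k0 c1 e1 de _ _ _ z2) _.
      by rewrite trrho mulr1.
    apply: etrans (tens_mul_trace _ _ _ _) _; rewrite mulrC; congr (_ * _).
    apply: etrans (trace_trl _ _) _; apply: etrans (ex _ _) _.
    apply: etrans (dep_eff k0 c1 e1 de _ _ _ z2) _; rewrite trrho mulr1 mul1mx.
    by rewrite trace_gam trm mulr1.
  move=> /four h; apply: le_trans h _.
  by have -> : 4 * (2 * a%:R * eta) = 8 * a%:R * eta by ring.
have hf : abs (\tr ((A *t B) *m eff e d (kraus W) (delta_mx s s' *t rho)) - g * \tr (((1%:M : op (a + 1)) *t B) *m eff e d (kraus W) (mixed R a *t rho))) <= 32 * a%:R * eta.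
  have cV : contr (A *t (J0 *m B *m J0^t*)).
    apply: contr_tens => //; apply: contrM; first by apply: contrM => //; exact: contr_isometry.
    exact/contr_adj/contr_isometry.
  have ex (A' : op (a + 1)) X : \tr ((A' *t (J0 *m B *m J0^t*)) *m eff e d (kraus K) X) =
     16^-1 * \tr ((A' *t B) *m eff e d (kraus W) X).
    rewrite expand.
    have -> : J0^t* *m (J0 *m B *m J0^t*) *m J0 = B.
      by rewrite !mulmxA J00 mul1mx -mulmxA J00 mulmx1.
    have -> : J1^t* *m (J0 *m B *m J0^t*) *m J1 = 0 by rewrite !mulmxA J10 !mul0mx.
    have -> : J2^t* *m (J0 *m B *m J0^t*) *m J2 = 0 by rewrite !mulmxA J20 !mul0mx.
    by rewrite -[RHS]addr0; congr (_ + _); rewrite -[RHS]addr0; congr (_ + _); exact: tr_tens0.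
  have := test _ s s' cV.
  have -> : \tr ((A *t (J0 *m B *m J0^t*)) *m (eff e d (kraus K) (delta_mx s s' *t rho)
     - trr (eff e d (kraus K) (delta_mx s s' *t rho)) *t trl (eff e d (kraus K) (mixed R a *t rho))))
     = 16^-1 * (\tr ((A *t B) *m eff e d (kraus W) (delta_mx s s' *t rho))
        - g * \tr (((1%:M : op (a + 1)) *t B) *m eff e d (kraus W) (mixed R a *t rho))).
    rewrite mulmxBr linearB mulrBr /=; congr (_ - _); first exact: ex.
    apply: etrans (tens_mul_trace _ _ _ _) _; rewrite mulrCA; congr (_ * _).
    apply: etrans (trace_trl _ _) _; exact: ex.
  move=> /sixteen h; apply: le_trans h _.
  by have -> : 16 * (2 * a%:R * eta) = 32 * a%:R * eta by ring.
have hn : abs (\tr (((1%:M : op (a + 1)) *t B) *m eff e d (kraus W) (mixed R a *t rho))) <= 4.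
  have psdmr : psd (mixed R a *t rho) by apply: psd_tens; [case: state_mixed | case: srho].
  apply: le_trans (abs_tr_psd _ _) _.
  - exact: contr_1tens.
  - exact: psd_eff.
  - apply: le_trans (trace_eff_le _ W4 psdmr) _ => //.
    by rewrite trace_tens trrho; case: state_mixed => _ ->; rewrite mulr1 /= mulr1.
by apply: abs_chain hg hf hn _; rewrite mulr_ge0.
Qed.

End Scheme.
End Key.

Opaque eff gam omega.

(** * Secrecy *)

Section Traceless.
Variable R : realType.
Local Notation C := R[i].
Local Notation op n := 'M[C]_n%N.

Lemma tr_mulBZ n (V A B : op n) (z : C) :
  \tr (V *m (A - z *: B)) = \tr (V *m A) - z * \tr (V *m B).
Proof. by rewrite mulmxBr raddfB /= -scalemxAr mxtraceZ. Qed.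

Lemma tr_ptr c n (X : op (c * n)) : \tr X = \tr (ptr X).
Proof.
rewrite /mxtrace sum_mxtens exchange_big; apply: eq_bigr => i _.
by rewrite summxE; apply: eq_bigr => z _; rewrite mxE.
Qed.

Definition avg c n q (W : 'M[C]_(c * n, c * q)) : 'M[C]_(n, q) := c%:R^-1 *: ptr W.

Lemma tl_avg c n q (W : 'M[C]_(c * n, c * q)) : W = tl W + (1%:M : op c) *t avg W.
Proof. by rewrite /tl /avg tensZr subrK. Qed.

Lemma ptr_gram_tl c n q (W : 'M[C]_(c * n, c * q)) : (0 < c)%N ->
  ptr (W^t* *m W) = ptr ((tl W)^t* *m tl W) + c%:R *: ((avg W)^t* *m avg W).
Proof.
move=> c0; have t0 := ptr_tl W c0.
rewrite {1 2}(tl_avg W); move: (tl W) (avg W) t0 => T M t0.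
rewrite adjD mulmxDl !mulmxDr !(lin_D (@linear_ptr R c q q)).
rewrite adj_tens adjC1 ptr_mulr ptr_mull t0 mulmx0.
have -> : ptr (T^t*) = 0.
  rewrite /ptr; under eq_bigr => z _ do rewrite blk_adj.
  by rewrite -adj_sum -/(ptr T) t0 trmx0 map_mx0.
by rewrite mul0mx addr0 add0r tensmx_mul mul1mx ptr_tens mxtrace1.
Qed.

Lemma hs_1tens c n q p (W : 'M[C]_(c * n, c * q)) (Y : 'M[C]_(q, p)) :
  (hs (W *m ((1%:M : op c) *t Y)))%:C = \tr (Y^t* *m ptr (W^t* *m W) *m Y).
Proof.
rewrite -trace_adj_mul tr_ptr adjM adj_tens adjC1.
by rewrite -mulmxA (mulmxA (W^t*)) mulmxA ptr_mulr ptr_mull.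
Qed.

(** The cross terms contain ptr (tl W) = 0. Orthogonality is available because the input is the
    identity on the ciphertext, that is, maximally mixed. *)
Lemma tl_pyth c n q p (W : 'M[C]_(c * n, c * q)) (Y : 'M[C]_(q, p)) : (0 < c)%N ->
  hs (W *m ((1%:M : op c) *t Y)) = hs (tl W *m ((1%:M : op c) *t Y)) + c%:R * hs (avg W *m Y).
Proof.
move=> c0; apply: complexI; rewrite rmorphD rmorphM /= !hs_1tens ptr_gram_tl // mulmxDr mulmxDl mxtraceD.
congr (_ + _); rewrite -scalemxAr -scalemxAl mxtraceZ -trace_adj_mul adjM rmorph_nat !mulmxA.
by [].
Qed.

Lemma hs_tens m n p q (A : 'M[C]_(m, n)) (B : 'M[C]_(p, q)) : hs (A *t B) = hs A * hs B.
Proof.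
by apply: complexI; rewrite rmorphM /= -!trace_adj_mul adj_tens tensmx_mul trace_tens.
Qed.

Lemma hs1 n : hs (1%:M : op n) = n%:R.
Proof. by apply: complexI; rewrite -trace_adj_mul mulmx1 adjC1 mxtrace1 rmorph_nat. Qed.

(** Test the hypothesis on 1 (x) Y, of squared norm c hs Y, and drop the traceless part in
    [tl_pyth]. *)
Lemma avg_bound c n q (N : finType) (W : N -> 'M[C]_(c * n, c * q)) : (0 < c)%N ->
  (forall p (X : 'M[C]_(c * q, p)), \sum_j hs (W j *m X) <= hs X) ->
  forall p (Y : 'M[C]_(q, p)), \sum_j hs (avg (W j) *m Y) <= hs Y.
Proof.
move=> c0 hW p Y; have cR : 0 < (c%:R : R) by rewrite ltr0n.
have := hW _ ((1%:M : op c) *t Y); rewrite hs_tens hs1 => h.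
rewrite -(ler_pM2l cR); apply: le_trans h; rewrite mulr_sumr; apply: ler_sum => j _.
by rewrite tl_pyth // lerDr hs_ge0.
Qed.

Lemma avg1_bound c n q (N : finType) (W : N -> 'M[C]_(c * n, c * q)) a : (0 < c)%N ->
  (forall p (X : 'M[C]_(c * q, p)), \sum_j hs (W j *m X) <= hs X) ->
  forall p (X : 'M[C]_(a * q, p)), \sum_j hs (((1%:M : op a) *t avg (W j)) *m X) <= hs X.
Proof.
move=> c0 hW p X; under eq_bigr => j _ do rewrite hs_sum_blocks2.
rewrite exchange_big hs_sum_blocks2; apply: ler_sum => l _.
apply: le_trans (avg_bound c0 hW _); apply: ler_sum => j _.
rewrite le_eqVlt; apply/orP; left; apply/eqP; congr hs.
apply/matrixP => i k; rewrite !mxE sum_mxtens (bigD1 l) //=.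
rewrite [X in _ + X]big1 ?addr0 => [|r rl].
  by apply: eq_bigr => t _; rewrite tensmxE [1%:M _ _]mxE eqxx mul1r [in RHS]mxE.
rewrite big1 // => t _.
by rewrite tensmxE mxE eq_sym (negbTE rl) mul0r mul0r.
Qed.

Lemma hs_opp m n (X : 'M[C]_(m, n)) : hs (- X) = hs X.
Proof. by rewrite -scaleN1r hsZ absN (abs_real 1) normr1 expr1n mul1r. Qed.

(** W and 1 (x) avg W are both bounded families, and 4 comes from hs (X + Y) <= 2 hs X + 2 hs Y. It
    is the 4 assumed in [completion]; it enters the error terms only, leading terms being estimated
    by [tl_pyth]. *)
Lemma tl_bound c n q (N : finType) (W : N -> 'M[C]_(c * n, c * q)) : (0 < c)%N ->
  (forall p (X : 'M[C]_(c * q, p)), \sum_j hs (W j *m X) <= hs X) ->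
  forall p (X : 'M[C]_(c * q, p)), \sum_j hs (tl (W j) *m X) <= 4 * hs X.
Proof.
move=> c0 hW p X.
have h j : hs (tl (W j) *m X) <= 2 * hs (W j *m X) + 2 * hs (((1%:M : op c) *t avg (W j)) *m X).
  have -> : tl (W j) *m X = W j *m X + - (((1%:M : op c) *t avg (W j)) *m X).
    by rewrite /tl -tensZr mulmxBl.
  by apply: le_trans (hsD_le _ _) _; rewrite hs_opp.
apply: le_trans (ler_sum _ (fun j _ => h j)) _; rewrite big_split -!mulr_sumr /=.
have := hW _ X; have := avg1_bound c0 hW X; lra.
Qed.

Section Scheme.
Variables (k a c : nat) (I J : finType).
Variables (e : 'I_k -> I -> 'M[C]_(c, a)) (d : 'I_k -> J -> 'M[C]_(a + 1, c)).
Hypothesis k0 : (0 < k)%N.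
Hypothesis a0 : (0 < a)%N.
Hypothesis c1 : (1 < c)%N.
Hypothesis e1 : forall i, \sum_j (e i j)^t* *m e i j = 1%:M.
Hypothesis d1 : forall i, \sum_j (d i j)^t* *m d i j = 1%:M.
Hypothesis de : forall i X, kraus (d i) (kraus (e i) X) = inj_bot R a *m X *m (inj_bot R a)^t*.
Variable eps : R.
Hypothesis eps0 : 0 <= eps.
Hypothesis nm : nm_prod e d eps.

Definition enc (X : op a) : op c := k%:R^-1 *: \sum_i kraus (e i) X.

Lemma tr_enc X : \tr (enc X) = \tr X.
Proof.
rewrite /enc mxtraceZ raddf_sum /=.
under eq_bigr => i _ do have /kraus_tp -> := e1 i.
rewrite sumr_const card_ord -[\tr X *+ k]mulr_natl mulrA mulVf ?mul1r //.
by rewrite pnatr_eq0 -lt0n.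
Qed.

Lemma trace_1tens_on1 m n p (f : op m -> op n) (B : op p) (Y : op (m * p)) :
  linear f -> trace_preserving f ->
  \tr (((1%:M : op n) *t B) *m on1 f Y) = \tr (((1%:M : op m) *t B) *m Y).
Proof.
move=> lf tf; move: Y; apply: tens_ext_scalar.
- by move=> z X Y; rewrite (linear_on1 lf) mulmxDr -scalemxAr mxtraceD mxtraceZ.
- by move=> z X Y; rewrite mulmxDr -scalemxAr mxtraceD mxtraceZ.
- by move=> X Y; rewrite on1_tens // !tens_mul_trace !mul1mx tf.
Qed.

(** Decryption preserves the trace and does not touch the side register, which therefore sees the
    key-averaged encryption only. *)
Lemma trace_eff_1tens b b' (L : op (c * b) -> op (c * b')) (B : op b') X (Y : op b) : linear L ->
  \tr (((1%:M : op (a + 1)) *t B) *m eff e d L (X *t Y)) =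
  \tr (((1%:M : op c) *t B) *m L (enc X *t Y)).
Proof.
move=> lL; rewrite eff_tens /enc tensZl (lin_Z lL) -!scalemxAr !mxtraceZ; congr (_ * _).
rewrite tens_suml (lin_sum lL) !mulmx_sumr !raddf_sum; apply: eq_bigr => i _ /=.
apply: trace_1tens_on1; first exact: linear_kraus.
exact/kraus_tp.
Qed.

Lemma encE X : enc X = k%:R^-1 *: \sum_i kraus (e i) X.
Proof. by []. Qed.

Opaque enc.

(** Moving the ciphertext to the output register and replacing it by a random
    one, with the component along the identity removed. *)
Definition swapout (i : 'I_c) : 'M[C]_(c * c, c * 1) :=
  (Num.sqrt (c%:R^-1))%:C *: tl (\sum_v delta_mx i v *t delta_mx v 0).

Lemma swapout_sqr : (Num.sqrt (c%:R^-1 : R))%:C * (Num.sqrt (c%:R^-1 : R))%:C = c%:R^-1 :> C.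
Proof. by rewrite -rmorphM -expr2 sqr_sqrtr ?invr_ge0 ?ler0n // fmorphV rmorph_nat. Qed.

Lemma blk_swapout i z p : blk (swapout i) z p =
  (Num.sqrt (c%:R^-1))%:C *: ((z == i)%:R *: delta_mx p 0 - (c%:R^-1 * (z == p)%:R) *: delta_mx i 0).
Proof.
pose U i : 'M[C]_(c * c, c * 1) := \sum_v delta_mx i v *t delta_mx v 0.
have ptrU : ptr (U i) = delta_mx i 0.
  rewrite /U (lin_sum (@linear_ptr R c c 1)) (bigD1 i) //= big1 ?addr0 => [|v vi].
    by rewrite ptr_tens trace_delta eqxx scale1r.
  by rewrite ptr_tens trace_delta eq_sym (negbTE vi) scale0r.
have blkU : blk (U i) z p = (z == i)%:R *: delta_mx p 0.
  rewrite /U (lin_sum (@linear_blk R c c c 1 z p)) (bigD1 p) //= big1 ?addr0 => [|v vi].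
    by rewrite blk_tens mxE eqxx andbT.
  by rewrite blk_tens mxE [p == v]eq_sym (negbTE vi) andbF scale0r.
rewrite /swapout (lin_Z (@linear_blk R c c c 1 z p)) /tl (lin_B (@linear_blk R c c c 1 z p)); congr (_ *: (_ - _)).
  exact: blkU.
rewrite (lin_Z (@linear_blk R c c c 1 z p)) blk_tens scalerA mxE; congr (_ *: _).
exact: ptrU.
Qed.

(** The unmodified swap would hand over |p><q| itself. The two mixed terms with the removed identity
    part take away c^-2 of it each, and the square of that part adds noise of size c^-3. *)
Lemma swapout_delta p q : trl (kraus swapout (delta_mx p q *t (1%:M : op 1))) =
  (1 - 2 * c%:R^-2) *: delta_mx p q + (c%:R^-3 * (p == q)%:R) *: 1%:M.
Proof.
have cn : c%:R != 0 :> C by rewrite pnatr_eq0 -lt0n ltnW.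
have cc : (c%:R^-1 : C)^*%R = c%:R^-1 by rewrite fmorphV rmorph_nat.
pose r z i : op c := (z == i)%:R *: delta_mx p q - (c%:R^-1 * ((z == i)%:R * (z == q)%:R)) *: delta_mx p i
   - (c%:R^-1 * ((z == i)%:R * (z == p)%:R)) *: delta_mx i q
   + (c%:R^-2 * ((z == p)%:R * (z == q)%:R)) *: delta_mx i i.
have step z i : slice2 (swapout i *m (delta_mx p q *t (1%:M : op 1)) *m (swapout i)^t*) z z = c%:R^-1 *: r z i.
  rewrite slice2_sandwich mulmx1 !blk_swapout adjCZ conj_real -scalemxAl -scalemxAr scalerA swapout_sqr.
  congr (_ *: _); rewrite adjB !adjCZ !adj_delta rmorphM /= cc !rmorph_nat.
  rewrite mulmxBl !mulmxBr -!scalemxAl -!scalemxAr !mul_delta_mx !scalerA /r.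
  apply/matrixP => x y; rewrite !mxE; case: (z == i); rewrite /=; field; exact: cn.
have -> : trl (kraus swapout (delta_mx p q *t (1%:M : op 1))) = c%:R^-1 *: \sum_z \sum_i r z i.
  rewrite scaler_sumr; apply: eq_bigr => z _; rewrite scaler_sumr.
  rewrite /kraus (lin_sum (@linear_slice2 R c c z z)); apply: eq_bigr => i _; exact: step.
have sel (F : 'I_c -> op c) (w : 'I_c) : \sum_z (z == w)%:R *: F z = F w.
  rewrite (bigD1 w) //= big1 ?addr0 ?eqxx ?scale1r // => y yw.
  by rewrite (negbTE yw) scale0r.
have s1 : \sum_(z < c) \sum_(i < c) (z == i)%:R *: delta_mx p q = c%:R *: (delta_mx p q : op c).
  rewrite exchange_big /=; under eq_bigr => i _ do rewrite (sel (fun _ => delta_mx p q)).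
  by rewrite sumr_const card_ord scaler_nat.
have s2 : \sum_z \sum_i (c%:R^-1 * ((z == i)%:R * (z == q)%:R)) *: (delta_mx p i : op c) = c%:R^-1 *: delta_mx p q.
  rewrite exchange_big -(sel (fun i => c%:R^-1 *: delta_mx p i) q); apply: eq_bigr => i _ /=.
  rewrite -(sel (fun z => (z == q)%:R *: (c%:R^-1 *: delta_mx p i)) i); apply: eq_bigr => z _.
  by rewrite !scalerA; congr (_ *: _); ring.
have s3 : \sum_z \sum_i (c%:R^-1 * ((z == i)%:R * (z == p)%:R)) *: (delta_mx i q : op c) = c%:R^-1 *: delta_mx p q.
  rewrite exchange_big -(sel (fun i => c%:R^-1 *: delta_mx i q) p); apply: eq_bigr => i _ /=.
  rewrite -(sel (fun z => (z == p)%:R *: (c%:R^-1 *: delta_mx i q)) i); apply: eq_bigr => z _.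
  by rewrite !scalerA; congr (_ *: _); ring.
have s4 : \sum_z \sum_i (c%:R^-2 * ((z == p)%:R * (z == q)%:R)) *: (delta_mx i i : op c) = (c%:R^-2 * (p == q)%:R) *: 1%:M.
  rewrite -(sel (fun z => (c%:R^-2 * (z == q)%:R) *: 1%:M) p); apply: eq_bigr => z _.
  by rewrite -scaler_sumr sum_delta1 scalerA; congr (_ *: _); ring.
have -> : \sum_z \sum_i r z i = c%:R *: delta_mx p q - c%:R^-1 *: delta_mx p q - c%:R^-1 *: delta_mx p q
   + (c%:R^-2 * (p == q)%:R) *: 1%:M.
  rewrite -s4 -{1}s2 -s1 -s3 -!sumrB -big_split; apply: eq_bigr => z _ /=.
  by rewrite -!sumrB -big_split.
apply/matrixP => x y; rewrite !mxE; case: (x == p); case: (y == q); rewrite /=; field; exact: cn.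
Qed.

Lemma swapout_trl (Y : op c) : trl (kraus swapout (Y *t (1%:M : op 1))) =
  (1 - 2 * c%:R^-2) *: Y + (c%:R^-3 * \tr Y) *: 1%:M.
Proof.
pose f (Y : op c) := trl (kraus swapout (Y *t (1%:M : op 1))).
have lf : linear f.
  apply: linear_comp; first exact: linear_trl.
  by apply: linear_comp; [exact: linear_kraus | exact: linear_tensl].
rewrite -/(f Y) {1}(sum_deltas Y) (lin_sum lf).
transitivity (\sum_p \sum_q Y p q *: ((1 - 2 * c%:R^-2) *: delta_mx p q + (c%:R^-3 * (p == q)%:R) *: (1%:M : op c))).
  apply: eq_bigr => p _; rewrite (lin_sum lf); apply: eq_bigr => q _.
  by rewrite (lin_Z lf) /f swapout_delta.
under eq_bigr => p _ do (under eq_bigr => q _ do rewrite scalerDr); under eq_bigr => p _ do rewrite big_split.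
rewrite big_split /=; congr (_ + _).
  rewrite [in RHS](sum_deltas Y) scaler_sumr; apply: eq_bigr => p _; rewrite scaler_sumr.
  by apply: eq_bigr => q _; rewrite !scalerA mulrC.
rewrite /mxtrace mulr_sumr scaler_suml; apply: eq_bigr => p _.
rewrite (bigD1 p) //= big1 ?addr0 => [|q qp].
  by rewrite eqxx scalerA; congr (_ *: _); rewrite mulr1 mulrC.
by rewrite eq_sym (negbTE qp) mulr0 scale0r scaler0.
Qed.

Lemma swapout_bound p (X : 'M[C]_(c * 1, p)) : \sum_i hs (swapout i *m X) <= 4 * hs X.
Proof.
have cn : c%:R != 0 :> C by rewrite pnatr_eq0 -lt0n ltnW.
pose W (i : 'I_c) : 'M[C]_(c * c, c * 1) := (Num.sqrt (c%:R^-1))%:C *: \sum_v delta_mx i v *t delta_mx v 0.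
have WE i : swapout i = tl (W i).
  rewrite /swapout /tl /W (lin_Z (@linear_ptr R c c 1)) tensZr scalerBr; congr (_ - _).
  by rewrite !scalerA mulrC.
under eq_bigr => i _ do rewrite WE.
apply: tl_bound; first exact: ltnW.
move=> q Y; rewrite (kraus_tp_hs (K := W)) //.
have gi i : (W i)^t* *m W i = c%:R^-1 *: 1%:M.
  rewrite /W adjCZ conj_real -scalemxAl -scalemxAr scalerA swapout_sqr; congr (_ *: _).
  rewrite adj_sum mulmx_suml -tens11 -(sum_delta1 R c) tens_suml; apply: eq_bigr => v _.
  rewrite mulmx_sumr (bigD1 v) //= big1 ?addr0 => [|w wv]; rewrite adj_tens !adj_delta tensmx_mul.
    rewrite !mul_delta_mx; congr (_ *t _).
    by apply/matrixP => x y; rewrite !ord1 !mxE !eqxx.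
  by rewrite [X in _ *t X]mul_delta_mx_0 ?tensmx0 // eq_sym.
under eq_bigr => i _ do rewrite gi.
by rewrite sumr_const card_ord -scaler_nat scalerA mulfV // scale1r.
Qed.

Definition eta := Num.sqrt eps.
Definition sigma := enc (mixed R a).

Lemma state1 : state (1%:M : op 1).
Proof. by split; [exact: psd1 | rewrite mxtrace1]. Qed.

Lemma swapout_comb (u v w x y z : C) :
  (1 - 2 * u) * x + v * w * z - w * ((1 - 2 * u) * y + v * 1 * z) = (1 - 2 * u) * (x - w * y).
Proof. ring. Qed.

(** [attack_product] for [swapout] with A = 1: as [gam] preserves the trace, the side register
    receives from |s><s'| what it receives from the mixed plaintext, times the trace. The noise
    terms cancel, and 1 - 2 c^-2 >= 1 / 2 turns 64 into 128. *)
Lemma secrecy (V : op c) s s' : contr V ->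
  abs (\tr (V *m (enc (delta_mx s s') - (s == s')%:R *: sigma))) <= 128 * a%:R * eta.
Proof.
move=> cV.
have ptrW i : ptr (swapout i) = 0.
  by rewrite /swapout (lin_Z (@linear_ptr R c c 1)) ptr_tl ?scaler0 // ltnW.
have h := @attack_product R k a c I J e d k0 a0 c1 e1 d1 de eps eps0 nm 1 c 'I_c swapout 1%:M 1%:M V s s' ptrW swapout_bound state1 (@contr1 _ _) cV.
have F X : \tr (((1%:M : op (a + 1)) *t V) *m eff e d (kraus swapout) (X *t (1%:M : op 1))) =
   (1 - 2 * c%:R^-2) * \tr (V *m enc X) + c%:R^-3 * \tr X * \tr V.
  apply: etrans (trace_eff_1tens _ _ _ (linear_kraus _)) _.
  rewrite -trace_trl swapout_trl tr_enc mulmxDr mxtraceD -!scalemxAr !mxtraceZ mulmx1.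
  by [].
have g1 : \tr ((1%:M : op (a + 1)) *m gam d (delta_mx s s')) = (s == s')%:R.
  by rewrite mul1mx; apply: etrans (trace_gam k0 c1 d1 _) _; exact: trace_delta.
have m1 : \tr (mixed R a) = 1 by case: (state_mixed R a0).
have h' : abs (((1 - 2 * c%:R^-2) * \tr (V *m enc (delta_mx s s')) + c%:R^-3 * (s == s')%:R * \tr V) -
  (s == s')%:R * ((1 - 2 * c%:R^-2) * \tr (V *m sigma) + c%:R^-3 * 1 * \tr V)) <= 64 * a%:R * eta.
  apply: le_trans h; rewrite le_eqVlt; apply/orP; left; apply/eqP; congr abs.
  congr (_ - _ * _); apply: esym; [|exact: g1|].
    by rewrite -(trace_delta R s s'); exact: F.
  by have Fm := F (mixed R a); rewrite m1 in Fm; exact: Fm.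
move: h' => {h}.
have -> : (1 - 2 * c%:R^-2) * \tr (V *m enc (delta_mx s s')) + c%:R^-3 * (s == s')%:R * \tr V -
  (s == s')%:R * ((1 - 2 * c%:R^-2) * \tr (V *m sigma) + c%:R^-3 * 1 * \tr V) =
  (1 - 2 * c%:R^-2) * \tr (V *m (enc (delta_mx s s') - (s == s')%:R *: sigma)).
  apply: etrans (congr1 (fun x => (1 - 2 * c%:R^-2) * x) (esym (tr_mulBZ _ _ _ _))).
  exact: swapout_comb.
have -> : (1 - 2 * c%:R^-2 : C) = (1 - 2 * c%:R^-2)%:C.
  by rewrite rmorphB rmorphM fmorphV rmorphXn !rmorph_nat.
have x2 : 2 <= (c%:R : R) by rewrite ler_nat.
have hx : (c%:R : R)^-2 <= 4^-1.
  by rewrite lef_pV2 ?posrE ?exprn_gt0 //; nra.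
rewrite absM abs_real ger0_norm; last lra.
set w := abs _ => h; have w0 : 0 <= w by exact: abs_ge0.
have := ler_wpM2r w0 hx; nra.
Qed.

End Scheme.
End Traceless.

(** * The mean ciphertext is nearly maximally mixed *)

Section Mixing.
Variable R : realType.
Local Notation C := R[i].
Local Notation op n := 'M[C]_n%N.

Lemma cauchy_schwarz (T : finType) (z w : T -> C) (k : R) : 0 < k ->
  \sum_t abs (z t) ^+ 2 = k ->
  abs (\sum_t z t * w t) ^+ 2 <= k * \sum_t abs (w t) ^+ 2.
Proof.
move=> k0 zk; set G := \sum_t abs (w t) ^+ 2.
have := @sqr_le_of_AMGM R (abs (\sum_t z t * w t)) (k * G / 4) (abs_ge0 _).
have -> : 4 * (k * G / 4) = k * G by field.
apply=> t t0; apply: le_trans (ler_abs_sum _ _ _) _.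
have tk : t^-1 = \sum_s t^-1 * k^-1 * abs (z s) ^+ 2.
  by rewrite -mulr_sumr zk -mulrA mulVf ?mulr1 // gt_eqF.
rewrite tk /G mulr_sumr mulr_suml mulr_sumr -big_split; apply: ler_sum => s _ /=.
rewrite absM; move: (abs (z s)) (abs (w s)) => x y.
rewrite -subr_ge0.
have -> : t * (k * y ^+ 2 / 4) + t^-1 * k^-1 * x ^+ 2 - x * y = t * k * (y / 2 - x / (t * k)) ^+ 2.
  by field; rewrite !gt_eqF.
by rewrite mulr_ge0 ?sqr_ge0 // mulr_ge0 // ltW.
Qed.

Section Scheme.
Variables (k a c : nat) (I J : finType).
Variables (e : 'I_k -> I -> 'M[C]_(c, a)) (d : 'I_k -> J -> 'M[C]_(a + 1, c)).
Hypothesis k0 : (0 < k)%N.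
Hypothesis a0 : (0 < a)%N.
Hypothesis c1 : (1 < c)%N.
Hypothesis e1 : forall i, \sum_j (e i j)^t* *m e i j = 1%:M.
Hypothesis d1 : forall i, \sum_j (d i j)^t* *m d i j = 1%:M.
Hypothesis de : forall i X, kraus (d i) (kraus (e i) X) = inj_bot R a *m X *m (inj_bot R a)^t*.
Variable eps : R.
Hypothesis eps0 : 0 <= eps.
Hypothesis nm : nm_prod e d eps.
Hypothesis small : a%:R ^+ 6 * eta eps <= 1.
Local Notation sigma := (sigma e).
Local Notation eta := (eta eps).
Local Notation enc := (enc e).

(** For each key the products d e are Kraus operators of the embedding of A into A (+) bot, so
    [kraus_id_scalar] applies. *)
Lemma coef_exists : exists z : 'I_k -> I -> J -> C,
  (forall i j l, d i l *m e i j = z i j l *: inj_bot R a) /\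
  (forall i, \sum_j \sum_l abs (z i j l) ^+ 2 = 1).
Proof.
have h i : exists z : I * J -> C, (forall t, d i t.2 *m e i t.1 = z t *: inj_bot R a) /\ \sum_t abs (z t) ^+ 2 = 1.
  apply: (kraus_id_scalar a0 (inj_botK R a)) => X; rewrite -(de i).
  rewrite /kraus -(pair_bigA _ (fun j l => d i l *m e i j *m X *m (d i l *m e i j)^t*)) /= exchange_big.
  apply: eq_bigr => l _; rewrite mulmx_sumr mulmx_suml; apply: eq_bigr => j _.
  by rewrite adjM !mulmxA.
pose P i (z : I * J -> C) := (forall t, d i t.2 *m e i t.1 = z t *: inj_bot R a) /\ \sum_t abs (z t) ^+ 2 = 1.
have [z hz] : exists z : 'I_k -> I * J -> C, forall i, P i (z i).
  exact: (fin_all_exists h).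
exists (fun i j l => z i (j, l)); split=> [i j l|i].
  by have [h1 _] := hz i; rewrite (h1 (j, l)).
by have [_ h2] := hz i; rewrite -h2 (pair_bigA _ (fun j l => abs (z i (j, l)) ^+ 2)); apply: eq_bigr => -[].
Qed.

(** Two distinct families cover the cross terms of an attack, which in general are not completely
    positive. *)
Lemma eff_pair b bt (N : finType) (W W' : N -> 'M[C]_(c * bt, c * b)) (X : op (a * b)) :
  eff e d (fun Y => \sum_n W n *m Y *m (W' n)^t*) X = k%:R^-1 *: \sum_i \sum_l \sum_n \sum_j
    ((d i l *t 1%:M) *m W n *m (e i j *t 1%:M)) *m X *m ((d i l *t 1%:M) *m W' n *m (e i j *t 1%:M))^t*.
Proof.
rewrite effE; congr (_ *: _); apply: eq_bigr => i _.
rewrite !on1_kraus /kraus; apply: eq_bigr => l _.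
rewrite mulmx_sumr mulmx_suml; apply: eq_bigr => n _.
rewrite mulmx_sumr mulmx_suml mulmx_sumr mulmx_suml; apply: eq_bigr => j _.
by rewrite !adjM !mulmxA.
Qed.

Lemma eff_pair_adj b bt (N : finType) (W W' : N -> 'M[C]_(c * bt, c * b)) (X : op (a * b)) :
  (eff e d (fun Y => \sum_n W n *m Y *m (W' n)^t*) X)^t* =
  eff e d (fun Y => \sum_n W' n *m Y *m (W n)^t*) (X^t*).
Proof.
rewrite !eff_pair adjCZ fmorphV rmorph_nat; congr (_ *: _).
rewrite adj_sum; apply: eq_bigr => i _; rewrite adj_sum; apply: eq_bigr => l _.
rewrite adj_sum; apply: eq_bigr => n _; rewrite adj_sum; apply: eq_bigr => j _.
by rewrite adjM trmxCK adjM mulmxA.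
Qed.

Lemma eff_kraus b bt (N : finType) (W : N -> 'M[C]_(c * bt, c * b)) (X : op (a * b)) :
  eff e d (kraus W) X = k%:R^-1 *: \sum_i \sum_l \sum_n \sum_j
    ((d i l *t 1%:M) *m W n *m (e i j *t 1%:M)) *m X *m ((d i l *t 1%:M) *m W n *m (e i j *t 1%:M))^t*.
Proof. exact: eff_pair. Qed.

(** The right-hand side is [a ^+ 2] times the entanglement fidelity of the
    effective channel of [V0]. *)
Lemma fidelity_ge (V0 : op c) :
  a%:R ^+ 2 * abs (\tr (V0 *m sigma)) ^+ 2 <=
  complex.Re (\sum_s \sum_s' \tr (((inj_bot R a *m delta_mx s' s *m (inj_bot R a)^t*) *t (1%:M : op 1)) *m
    eff e d (kraus (fun _ : 'I_1 => V0 *t (1%:M : op 1))) (delta_mx s s' *t 1%:M))).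
Proof.
have [z [ze z1]] := coef_exists.
pose g i j l := \tr ((inj_bot R a)^t* *m (d i l *m V0 *m e i j)).
have kC : k%:R != 0 :> C by rewrite pnatr_eq0 -lt0n.
have kR : 0 < (k%:R : R) by rewrite ltr0n.
have -> : \sum_s \sum_s' \tr (((inj_bot R a *m delta_mx s' s *m (inj_bot R a)^t*) *t (1%:M : op 1)) *m
    eff e d (kraus (fun _ : 'I_1 => V0 *t (1%:M : op 1))) (delta_mx s s' *t 1%:M))
   = (k%:R^-1 * \sum_i \sum_j \sum_l abs (g i j l) ^+ 2)%:C.
  have one s s' : \tr (((inj_bot R a *m delta_mx s' s *m (inj_bot R a)^t*) *t (1%:M : op 1)) *m
    eff e d (kraus (fun _ : 'I_1 => V0 *t (1%:M : op 1))) (delta_mx s s' *t 1%:M))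
    = k%:R^-1 * \sum_i \sum_j \sum_l ((inj_bot R a)^t* *m (d i l *m V0 *m e i j)) s s *
        (((inj_bot R a)^t* *m (d i l *m V0 *m e i j)) s' s')^*%R.
    rewrite eff_kraus -scalemxAr mxtraceZ; congr (_ * _); rewrite mulmx_sumr raddf_sum.
    apply: eq_bigr => i _ /=; rewrite mulmx_sumr raddf_sum [RHS]exchange_big; apply: eq_bigr => l _ /=.
    rewrite big_ord1 mulmx_sumr raddf_sum; apply: eq_bigr => j _ /=.
    rewrite !tensmx_mul !mulmx1 adj_tens adjC1 !tensmx_mul !mulmx1 trace_tens mxtrace1 mulr1.
    rewrite -adjE; set G := d i l *m V0 *m e i j.
    transitivity (\tr (delta_mx s' s *m (((inj_bot R a)^t* *m G) *m delta_mx s s' *m ((inj_bot R a)^t* *m G)^t*))).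
      by rewrite [((inj_bot R a)^t* *m G)^t*]adjM trmxCK -!mulmxA [LHS]mxtrace_mulC -!mulmxA.
    rewrite trace_delta_mul mxE (bigD1 s') //= big1 ?addr0 => [|r rs]; rewrite mulmx_deltar ?eqxx ?mulr1 //.
    by rewrite (negbTE rs) mulr0 mul0r.
  under eq_bigr => s _ do under eq_bigr => s' _ do rewrite one.
  under eq_bigr => s _ do rewrite -mulr_sumr.
  rewrite -mulr_sumr rmorphM fmorphV rmorph_nat; congr (_ * _).
  under eq_bigr => s _ do rewrite exchange_big /=.
  rewrite exchange_big rmorph_sum; apply: eq_bigr => i _ /=.
  under eq_bigr => s _ do rewrite exchange_big /=.
  rewrite exchange_big rmorph_sum; apply: eq_bigr => j _ /=.
  under eq_bigr => s _ do rewrite exchange_big /=.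
  rewrite exchange_big rmorph_sum; apply: eq_bigr => l _ /=.
  rewrite sqr_abs mulrC /g /mxtrace rmorph_sum mulr_suml; apply: eq_bigr => s _ /=.
  by rewrite mulr_sumr.
rewrite /=.
have tz : \sum_t abs ((z t.1.1 t.1.2 t.2)^*%R) ^+ 2 = (k%:R : R).
  transitivity (\sum_i \sum_j \sum_l abs (z i j l) ^+ 2).
    rewrite (pair_bigA _ (fun i j => \sum_l abs (z i j l) ^+ 2)) /=.
    rewrite (pair_bigA _ (fun x l => abs (z x.1 x.2 l) ^+ 2)) /=.
    by apply: eq_bigr => -[[i j] l] _; rewrite abs_conj.
  under eq_bigr => i _ do rewrite z1.
  by rewrite sumr_const card_ord.
have := @cauchy_schwarz ('I_k * I * J)%type (fun t => (z t.1.1 t.1.2 t.2)^*%R) (fun t => g t.1.1 t.1.2 t.2) _ kR tz.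
have -> : \sum_(t : 'I_k * I * J) abs (g t.1.1 t.1.2 t.2) ^+ 2 = \sum_i \sum_j \sum_l abs (g i j l) ^+ 2.
  rewrite (pair_bigA _ (fun i j => \sum_l abs (g i j l) ^+ 2)) /=.
  rewrite (pair_bigA _ (fun x l => abs (g x.1 x.2 l) ^+ 2)) /=.
  by apply: eq_bigr => -[[i j] l].
have -> : \sum_(t : 'I_k * I * J) (z t.1.1 t.1.2 t.2)^*%R * g t.1.1 t.1.2 t.2 = (k%:R * a%:R) * \tr (V0 *m sigma).
  transitivity (\sum_i \sum_j \sum_l (z i j l)^*%R * g i j l).
    rewrite (pair_bigA _ (fun i j => \sum_l (z i j l)^*%R * g i j l)) /=.
    rewrite (pair_bigA _ (fun x l => (z x.1 x.2 l)^*%R * g x.1 x.2 l)) /=.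
    by apply: eq_bigr => -[[i j] l].
  (* The completeness relation of d is inserted to the left of V0. Then d meets e, leaving the
     conjugate of z times the adjoint embedding: the coefficients to which Cauchy-Schwarz is
     applied, with the squares of z summing to k. *)
  transitivity (\sum_i \sum_j \tr ((e i j)^t* *m V0 *m e i j)).
    apply: eq_bigr => i _; apply: eq_bigr => j _.
    transitivity (\sum_l \tr ((e i j)^t* *m ((d i l)^t* *m d i l) *m (V0 *m e i j))).
      apply: eq_bigr => l _; rewrite /g -mxtraceZ scalemxAl -adjCZ -ze adjM.
      by rewrite !mulmxA.
    rewrite -raddf_sum -mulmx_suml -mulmx_sumr d1 mulmx1 mulmxA.
    by [].
  have -> : \tr (V0 *m sigma) = (k%:R * a%:R)^-1 * \sum_i \sum_j \tr ((e i j)^t* *m V0 *m e i j).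
    have -> : sigma = k%:R^-1 *: \sum_i kraus (e i) (mixed R a) by exact: encE.
    rewrite /mixed.
    under eq_bigr => i _ do rewrite (lin_Z (linear_kraus (e i))).
    rewrite -scaler_sumr scalerA -scalemxAr mxtraceZ -invfM; congr (_ * _).
    rewrite mulmx_sumr raddf_sum; apply: eq_bigr => i _ /=.
    rewrite /kraus mulmx_sumr raddf_sum; apply: eq_bigr => j _ /=.
    by rewrite mulmx1 mulmxA mxtrace_mulC mulmxA.
  rewrite mulrA mulfV ?mul1r // mulf_neq0 // pnatr_eq0 -lt0n //.
rewrite absM (natC R k) (natC R a) -rmorphM abs_real ger0_norm ?mulr_ge0 ?ler0n // => h.
rewrite -(ler_pM2l kR) mulrA.
have -> : k%:R * (k%:R^-1 * \sum_i \sum_j \sum_l abs (g i j l) ^+ 2) = \sum_i \sum_j \sum_l abs (g i j l) ^+ 2.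
  by rewrite mulrA mulfV ?mul1r // gt_eqF.
rewrite -(ler_pM2l kR); apply: le_trans h.
rewrite le_eqVlt; apply/orP; left; apply/eqP.
by move: (abs _) => y; ring.
Qed.

End Scheme.
End Mixing.

Section Mixing.
Variable R : realType.
Local Notation C := R[i].
Local Notation op n := 'M[C]_n%N.

Lemma ReM_real (x y : R) : complex.Re (x%:C * y%:C) = x * y.
Proof. by rewrite -rmorphM. Qed.

Lemma psd_tr_real n (X : op n) : psd X -> \tr X = (complex.Re (\tr X))%:C /\ 0 <= complex.Re (\tr X).
Proof.
by move=> /psd_factor [S ->]; rewrite trace_adj_mul; split=> //; exact: hs_ge0.
Qed.

Section Scheme.
Variables (k a c : nat) (I J : finType).
Variables (e : 'I_k -> I -> 'M[C]_(c, a)) (d : 'I_k -> J -> 'M[C]_(a + 1, c)).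
Hypothesis k0 : (0 < k)%N.
Hypothesis a0 : (0 < a)%N.
Hypothesis c1 : (1 < c)%N.
Hypothesis e1 : forall i, \sum_j (e i j)^t* *m e i j = 1%:M.
Hypothesis d1 : forall i, \sum_j (d i j)^t* *m d i j = 1%:M.
Hypothesis de : forall i X, kraus (d i) (kraus (e i) X) = inj_bot R a *m X *m (inj_bot R a)^t*.
Variable eps : R.
Hypothesis eps0 : 0 <= eps.
Hypothesis nm : nm_prod e d eps.
Hypothesis small : a%:R ^+ 6 * eta eps <= 1.

Lemma c2_bound : (c%:R ^+ 2 / (c%:R ^+ 2 - 1) : R) <= 4 / 3.
Proof.
have x2 : 2 <= (c%:R : R) by rewrite ler_nat.
have h : 0 < (c%:R : R) ^+ 2 - 1 by nra.
by rewrite ler_pdivrMr //; nra.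
Qed.

Lemma eta_ge0 : 0 <= eta eps.
Proof. exact: sqrtr_ge0. Qed.

Lemma small_pow m : (m <= 6)%N -> a%:R ^+ m * eta eps <= 1.
Proof.
move=> m6; apply: le_trans small; apply: ler_wpM2r; first exact: eta_ge0.
by apply: ler_weXn2l => //; rewrite ler1n.
Qed.

(** With V0 the traceless part of V, tr (V0 sigma) is the quantity in question. [fidelity_ge] bounds
    the fidelity of the attack V0 below by its square, whereas by the product form that fidelity is
    at most of order 1 / a^2, since the output of [gam] hardly depends on the plaintext. This is the
    origin of all errors 1 / a. *)
Lemma sigma_mixed (V : op c) : contr V ->
  abs (\tr (V *m (sigma e - mixed R c))) <= 9 / a%:R.
Proof.
move=> cV; have x2 : 2 <= (c%:R : R) by rewrite ler_nat.
have cn2 : 0 < (c%:R : R) ^+ 2 - 1 by nra.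
have a1 : 0 < (a%:R : R) by rewrite ltr0n.
pose V0 : op c := V - (\tr V / c%:R) *: 1%:M.
pose W (_ : 'I_1) : 'M[C]_(c * 1, c * 1) := V0 *t (1%:M : op 1).
have WE j : W j = tl (V *t (1%:M : op 1)).
  by rewrite /W /V0 /tl ptr_tens (lin_B (linear_tensl _)) tensZl tensZr scalerA [_^-1 * _]mulrC.
have W0 j : ptr (W j) = 0 by rewrite WE ptr_tl // ltnW.
have W4 p (X : 'M[C]_(c * 1, p)) : \sum_j hs (W j *m X) <= 4 * hs X.
  under eq_bigr => j _ do rewrite WE.
  apply: (@tl_bound R c 1 1 'I_1 (fun _ => V *t (1%:M : op 1))); first exact: ltnW.
  by move=> q Y; rewrite big_ord1; exact: contr_tens1.
pose A s s' : op (a + 1) := inj_bot R a *m delta_mx s' s *m (inj_bot R a)^t*.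
have ci := contr_isometry (inj_botK R a).
have cA s s' : contr (A s s').
  apply: contrM; last exact: contr_adj.
  by apply: contrM => //; exact: contr_delta.
pose F s s' := \tr ((A s s' *t (1%:M : op 1)) *m eff e d (kraus W) (delta_mx s s' *t 1%:M)).
pose n := \tr (((1%:M : op (a + 1)) *t (1%:M : op 1)) *m eff e d (kraus W) (mixed R a *t 1%:M)).
have hF s s' : abs (F s s' - \tr (A s s' *m gam d (delta_mx s s')) * n) <= 64 * a%:R * eta eps.
  exact: (attack_product k0 a0 c1 e1 d1 de eps0 nm s s' W0 W4 (state1 R) (cA s s') (@contr1 _ _)).
have psdn : psd (eff e d (kraus W) (mixed R a *t 1%:M)).
  apply: psd_eff; apply: psd_tens; last exact: psd1.
  by case: (state_mixed R a0).
have [nR n0] := psd_tr_real psdn.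
have n4 : complex.Re (\tr (eff e d (kraus W) (mixed R a *t 1%:M))) <= 4.
  apply: le_trans (trace_eff_le k0 e1 d1 _ W4 _) _ => //.
    by apply: psd_tens; [case: (state_mixed R a0) | exact: psd1].
  by rewrite trace_tens mxtrace1; case: (state_mixed R a0) => _ ->; rewrite mulr1 /= mulr1.
have nE : n = (complex.Re (\tr (eff e d (kraus W) (mixed R a *t 1%:M))))%:C.
  by rewrite -nR /n tens11 mul1mx.
set nu := complex.Re _ in n0 n4 nE.
pose w := complex.Re (\tr ((inj_bot R a)^t* *m omega d *m inj_bot R a)).
have psdw : psd ((inj_bot R a)^t* *m omega d *m inj_bot R a).
  by have := psd_conj ((inj_bot R a)^t*) (psd_omega d); rewrite trmxCK.
have [wR w0] := psd_tr_real psdw.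
have w1 : w <= 1.
  apply: le_trans (Re_le_abs _) _.
  have -> : \tr ((inj_bot R a)^t* *m omega d *m inj_bot R a) = \tr ((inj_bot R a *m (inj_bot R a)^t*) *m omega d).
    by rewrite mxtrace_mulC mulmxA.
  apply: le_trans (abs_tr_psd _ (psd_omega d)) _; last by rewrite (tr_omega k0 c1 d1).
  by apply: contrM => //; exact: contr_adj.
have sumY : \sum_s \sum_s' \tr (A s s' *m gam d (delta_mx s s')) =
   ((c%:R ^+ 2 - 1)^-1 * (c%:R ^+ 2 * w - a%:R ^+ 2))%:C.
  have one s s' : \tr (A s s' *m gam d (delta_mx s s')) = (c%:R ^+ 2 - 1)^-1 *
     ((s' == s)%:R * (c%:R ^+ 2 * ((inj_bot R a)^t* *m omega d *m inj_bot R a) s s') - 1).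
    rewrite trace_mul_gam trace_delta; congr (_ * (_ - _)).
      rewrite [s' == s]eq_sym [RHS]mulrCA mulrA; congr (_ * _).
      by rewrite -[RHS]trace_delta_mul /A -!mulmxA [LHS]mxtrace_mulC -!mulmxA.
    rewrite /A !mulmxA inj_botK mul1mx -(mulmxA _ (_^t*) (inj_bot R a)) inj_botK mulmx1.
    by rewrite trace_delta_mul mxE !eqxx.
  under eq_bigr => s _ do under eq_bigr => s' _ do rewrite one.
  transitivity ((c%:R ^+ 2 - 1)^-1 * \sum_s (c%:R ^+ 2 * ((inj_bot R a)^t* *m omega d *m inj_bot R a) s s - a%:R)).
    rewrite mulr_sumr; apply: eq_bigr => s _; rewrite -mulr_sumr; congr (_ * _).
    rewrite sumrB sumr_const card_ord; congr (_ - _).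
    rewrite (bigD1 s) //= big1 ?addr0 ?eqxx ?mul1r // => s' ss.
    by rewrite (negbTE ss) mul0r.
  rewrite sumrB -mulr_sumr sumr_const card_ord -[\sum_s _]/(\tr _) wR -/w.
  rewrite rmorphM fmorphV rmorphB rmorphB rmorphM !rmorphXn !rmorph_nat rmorph1.
  by rewrite -[a%:R *+ a]mulr_natr -!expr2 rmorphM rmorphXn rmorph_nat.
have := fidelity_ge k0 a0 d1 de V0; move=> fid.
(* 16 / 3 is 4 / 3, bounding the sum of the [gam] terms, times the bound 4 on n; each of the a^2
   pairs s, s' adds 64 a eta. *)
have up : complex.Re (\sum_s \sum_s' F s s') <= 16 / 3 + 64 * (a%:R ^+ 3 * eta eps).
  have -> : \sum_s \sum_s' F s s' = \sum_s \sum_s' (F s s' - \tr (A s s' *m gam d (delta_mx s s')) * n)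
     + (\sum_s \sum_s' \tr (A s s' *m gam d (delta_mx s s'))) * n.
    rewrite mulr_suml -big_split; apply: eq_bigr => s _ /=.
    by rewrite mulr_suml -big_split; apply: eq_bigr => s' _ /=; rewrite subrK.
  rewrite ReD addrC; apply: lerD.
    rewrite sumY nE ReM_real.
    have h := c2_bound; have h2 : c%:R ^+ 2 * w - a%:R ^+ 2 <= c%:R ^+ 2.
      have := sqr_ge0 (a%:R : R); have := sqr_ge0 (c%:R : R); nra.
    have i0 : 0 <= (c%:R ^+ 2 - 1 : R)^-1 by rewrite invr_ge0 ltW.
    have h3 := ler_wpM2l i0 h2; rewrite mulrC in h.
    have h4 := ler_wpM2r n0 (le_trans h3 h); apply: le_trans h4 _; lra.
  apply: le_trans (Re_le_abs _) _; apply: le_trans (ler_abs_sum _ _ _) _.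
  apply: (@le_trans _ _ (\sum_(s < a) \sum_(s' < a) 64 * a%:R * eta eps)).
    apply: ler_sum => s _; apply: le_trans (ler_abs_sum _ _ _) _.
    by apply: ler_sum => s' _; exact: hF.
  rewrite !sumr_const card_ord -[(_ *+ a) *+ a]mulr_natr -[(64 * _ * _) *+ a]mulr_natr.
  by rewrite le_eqVlt; apply/orP; left; apply/eqP; ring.
have tV0 : \tr (V0 *m sigma e) = \tr (V *m (sigma e - mixed R c)).
  have ts : \tr (sigma e) = 1 by rewrite (tr_enc k0 e1); case: (state_mixed R a0).
  apply: etrans _ (esym (tr_mulBZ V (sigma e) 1%:M _)).
  rewrite /V0 mulmxBl raddfB /= -scalemxAl mul1mx mxtraceZ ts mulr1 mulmx1.
  by rewrite [\tr V / _]mulrC.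
rewrite tV0 in fid; move: fid; set x := abs _ => fid.
have x0 : 0 <= x by exact: abs_ge0.
have := small_pow (isT : (3 <= 6)%N) => s3.
(* a^3 eta <= 1, and 16 / 3 + 64 < 81. *)
have fin : (a%:R * x) ^+ 2 <= 9 ^+ 2.
  have := le_trans fid up; rewrite exprMn => h; apply: le_trans h _; lra.
rewrite ler_pdivlMr // mulrC.
by rewrite -(@ler_pXn2r _ 2) // nnegrE ?mulr_ge0 // ltW.
Qed.

End Scheme.
End Mixing.

(** * Functionals of encrypted operators *)

Section Accept.
Variable R : realType.
Local Notation C := R[i].
Local Notation op n := 'M[C]_n%N.

(** Linear functionals on [op c] of norm at most [K] for the trace norm. *)
Definition bil c (K : R) (f : op c -> C) : Prop :=
  (forall z X Y, f (z *: X + Y) = z * f X + f Y) /\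
  (forall p (G H : 'M[C]_(c, p)), 2 * abs (f (G *m H^t*)) <= K * (hs G + hs H)).

(** By duality [secrecy] and [sigma_mixed], stated for contractions, apply to any functional into
    which an attack and a test have been absorbed. *)
Lemma bil_trace c (K : R) (f : op c -> C) : 0 < K -> bil K f ->
  exists V : op c, contr V /\ forall Y, f Y = K%:C * \tr (V *m Y).
Proof.
move=> K0 [lf bf]; pose V : op c := \matrix_(i, j) ((K^-1)%:C * f (delta_mx j i)).
have VE Y : \tr (V *m Y) = (K^-1)%:C * f Y.
  have lf' : linear (f : op c -> C^o) by [].
  rewrite {2}(sum_deltas Y) (lin_sum lf') mulr_sumr /=.
  transitivity (\sum_j \sum_i (K^-1)%:C * f (delta_mx i j) * Y i j).
    by rewrite /mxtrace; apply: eq_bigr => j _; rewrite mxE; apply: eq_bigr => i _; rewrite mxE.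
  rewrite exchange_big; apply: eq_bigr => i _; rewrite (lin_sum lf') mulr_sumr; apply: eq_bigr => j _.
  by rewrite (lin_Z lf') /GRing.scale /=; ring.
exists V; split=> [|Y]; last first.
  by rewrite VE mulrA -rmorphM mulfV ?gt_eqF // rmorph1 mul1r.
apply: contr_bil => p G H; have := bf p G H.
have -> : \tr (H^t* *m (V *m G)) = (K^-1)%:C * f (G *m H^t*).
  by rewrite mxtrace_mulC -mulmxA VE.
have Ki : 0 <= K^-1 by rewrite invr_ge0 ltW.
rewrite absM abs_real (ger0_norm Ki) => h.
by rewrite mulrCA ler_pdivrMl.
Qed.

(** Polarization over w = 1, i, -1, -i: each of the four terms is at most 2 K (hs u + hs v), and
    their sum is divided by 4. *)
Lemma polar b (f : op b -> C) (K : R) p (u v : 'M[C]_(b, p)) :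
  (forall z X Y, f (z *: X + Y) = z * f X + f Y) ->
  (forall u : 'M[C]_(b, p), abs (f (u *m u^t*)) <= K * hs u) ->
  0 <= K -> abs (f (u *m v^t*)) <= 2 * K * (hs u + hs v).
Proof.
move=> lf bf K0; have lf' : linear (f : op b -> C^o) by [].
pose g (w : C) := (u + w *: v) *m (u + w *: v)^t*.
have gE w : g w = u *m u^t* + w^*%R *: (u *m v^t*) + w *: (v *m u^t*) + (w * w^*%R) *: (v *m v^t*).
  rewrite /g adjD adjCZ mulmxDl !mulmxDr -!scalemxAl -!scalemxAr scalerA addrA.
  by [].
have i2 : ('i%C : C) * 'i%C = -1 by rewrite -expr2 sqr_i.
have iJ : ('i%C : C)^*%R = - 'i%C by rewrite conjC_complex /=; apply/eqP; rewrite eq_complex /= oppr0 !eqxx.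
have e : u *m v^t* = 4^-1 *: (g 1 + 'i%C *: g 'i%C - g (-1) - 'i%C *: g (- 'i%C)).
  rewrite !gE !rmorphN /= iJ !conjC1; move: (u *m u^t*) (u *m v^t*) (v *m u^t*) (v *m v^t*) => P Q S T.
  apply/matrixP => x y; rewrite !mxE; move: (P x y) (Q x y) (S x y) (T x y) => {}P {}Q {}S {}T.
  transitivity (4^-1 * (2 * Q + 2 * S - 2 * ('i%C * 'i%C) * Q + 2 * ('i%C * 'i%C) * S)).
    by rewrite i2; field.
  ring.
have ai : abs ('i%C : C) = 1.
  by apply: complexI; rewrite absE normc_def /= expr0n expr1n add0r sqrtr1.
have bg w : abs w = 1 -> abs (f (g w)) <= K * (2 * hs u + 2 * hs v).
  move=> w1; apply: le_trans (bf _) _; apply: ler_wpM2l => //.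
  by apply: le_trans (hsD_le _ _) _; rewrite hsZ w1 expr1n mul1r.
clear gE; clearbody g.
rewrite e (lin_Z lf') !(lin_B lf') (lin_D lf') !(lin_Z lf') /GRing.scale /=.
have -> : (4^-1 : C) = (4^-1)%:C by rewrite fmorphV rmorph_nat.
rewrite absM abs_real ger0_norm ?invr_ge0 //.
have a1 : abs (1 : C) = 1 by rewrite (abs_real 1) normr1.
have h1 := bg 1 a1; have h2 := bg (-1); rewrite absN in h2; have {}h2 := h2 a1.
have h3 := bg 'i%C ai; have h4 := bg (- 'i%C); rewrite absN in h4; have {}h4 := h4 ai.
have m3 : abs ('i%C * f (g 'i%C)) <= K * (2 * hs u + 2 * hs v) by rewrite absM ai mul1r.
have m4 : abs ('i%C * f (g (- 'i%C))) <= K * (2 * hs u + 2 * hs v) by rewrite absM ai mul1r.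
have t1 := ler_absD (f (g 1) + 'i%C * f (g 'i%C) - f (g (-1))) (- ('i%C * f (g (- 'i%C)))).
have t2 := ler_absD (f (g 1) + 'i%C * f (g 'i%C)) (- f (g (-1))).
have t3 := ler_absD (f (g 1)) ('i%C * f (g 'i%C)).
rewrite !absN in t1 t2.
rewrite ler_pdivrMl //; apply: le_trans t1 _; apply: le_trans (lerD t2 (lexx _)) _.
apply: le_trans (lerD (lerD t3 (lexx _)) (lexx _)) _.
apply: le_trans (lerD (lerD (lerD h1 m3) h2) m4) _; move: (hs u) (hs v) => x y.
by rewrite le_eqVlt; apply/orP; left; apply/eqP; ring.
Qed.

Lemma kraus_pair (N : finType) c n b p q (W : N -> 'M[C]_(n, c * b)) (G H : 'M[C]_(c, p)) (u v : 'M[C]_(b, q)) :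
  kraus W ((G *m H^t*) *t (u *m v^t*)) = \sum_j (W j *m (G *t u)) *m (W j *m (H *t v))^t*.
Proof.
apply: eq_bigr => j _; rewrite -tensmx_mul adjM adj_tens.
by rewrite !mulmxA.
Qed.

Lemma trace_pair_le n p (P : op n) (X Y : 'M[C]_(n, p)) : contr P ->
  2 * abs (\tr (P *m (X *m Y^t*))) <= hs X + hs Y.
Proof.
move=> cP; have := contr_tr X Y cP.
by rewrite mxtrace_mulC -mulmxA.
Qed.

(** K depends on the total norm of the vectors and not on their number; hence sums over plaintext
    blocks do not cost a factor a. *)
Lemma bil_kraus (T N : finType) c n b q (W : N -> 'M[C]_(n, c * b)) (P : op n)
    (u v : T -> 'M[C]_(b, q)) (z K : R) :
  contr P -> (forall p (X : 'M[C]_(c * b, p)), \sum_j hs (W j *m X) <= z * hs X) -> 0 <= z ->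
  z * \sum_t hs (u t) <= K -> z * \sum_t hs (v t) <= K ->
  bil K (fun G : op c => \sum_t \tr (P *m kraus W (G *t (u t *m (v t)^t*)))).
Proof.
move=> cP hW z0 hu hv; split=> [w X Y|p G H].
  rewrite mulr_sumr -big_split; apply: eq_bigr => t _ /=.
  by rewrite tensDl tensZl linear_kraus mulmxDr -scalemxAr mxtraceD mxtraceZ.
have h t : 2 * abs (\tr (P *m kraus W ((G *m H^t*) *t (u t *m (v t)^t*)))) <= z * hs (u t) * hs G + z * hs (v t) * hs H.
  rewrite kraus_pair mulmx_sumr raddf_sum /=.
  apply: le_trans (ler_wpM2l _ (ler_abs_sum _ _ _)) _ => //.
  rewrite mulr_sumr; apply: (@le_trans _ _ (\sum_j (hs (W j *m (G *t u t)) + hs (W j *m (H *t v t))))).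
    by apply: ler_sum => j _; exact: trace_pair_le.
  rewrite big_split; apply: lerD; apply: le_trans (hW _ _) _; rewrite hs_tens; move: (hs _) (hs _) => x y; nra.
apply: le_trans (ler_wpM2l _ (ler_abs_sum _ _ _)) _ => //.
rewrite mulr_sumr; apply: le_trans (ler_sum _ (fun t _ => h t)) _.
rewrite big_split mulrDr /= -!mulr_suml -!mulr_sumr.
by apply: lerD; apply: ler_wpM2r => //; exact: hs_ge0.
Qed.

(** For an input state x *m x^t*, the blocks of x over the plaintext basis separate the matrix units
    |s><s'|, which get encrypted, from operators on the side register. *)
Definition rowblk a b p (x : 'M[C]_(a * b, p)) (s : 'I_a) : 'M[C]_(b, p) :=
  \matrix_(i, q) x (mxtens_index (s, i)) q.

Lemma slice2_rowblk a b p (x y : 'M[C]_(a * b, p)) s s' :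
  slice2 (x *m y^t*) s s' = rowblk x s *m (rowblk y s')^t*.
Proof. by apply/matrixP => i j; rewrite !mxE; apply: eq_bigr => l _; rewrite !mxE. Qed.

Lemma hs_rowblk a b p (x : 'M[C]_(a * b, p)) : hs x = \sum_s hs (rowblk x s).
Proof. exact: hs_sum_blocks2. Qed.

Lemma outer_rowblk_pair a b b' p (x : 'M[C]_(a * b, p)) (w : 'M[C]_(a * b', p)) :
  x *m w^t* = \sum_s \sum_s' delta_mx s s' *t (rowblk x s *m (rowblk w s')^t*).
Proof.
rewrite [LHS]blk_sum; apply: eq_bigr => s _; apply: eq_bigr => s' _; congr (_ *t _).
by apply/matrixP => i j; rewrite !mxE; apply: eq_bigr => l _; rewrite !mxE.
Qed.

Lemma outer_rowblk a b p (x : 'M[C]_(a * b, p)) :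
  x *m x^t* = \sum_s \sum_s' delta_mx s s' *t (rowblk x s *m (rowblk x s')^t*).
Proof. exact: outer_rowblk_pair. Qed.

End Accept.

(** * Weight of the traceless part that passes a tag test *)

Section Accept.
Variable R : realType.
Local Notation C := R[i].
Local Notation op n := 'M[C]_n%N.

Section Scheme.
Variables (k a c : nat) (I J : finType).
Variables (e : 'I_k -> I -> 'M[C]_(c, a)) (d : 'I_k -> J -> 'M[C]_(a + 1, c)).
Hypothesis k0 : (0 < k)%N.
Hypothesis a0 : (0 < a)%N.
Hypothesis c1 : (1 < c)%N.
Hypothesis e1 : forall i, \sum_j (e i j)^t* *m e i j = 1%:M.
Hypothesis d1 : forall i, \sum_j (d i j)^t* *m d i j = 1%:M.
Hypothesis de : forall i X, kraus (d i) (kraus (e i) X) = inj_bot R a *m X *m (inj_bot R a)^t*.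
Variable eps : R.
Hypothesis eps0 : 0 <= eps.
Hypothesis nm : nm_prod e d eps.
Hypothesis small : a%:R ^+ 6 * eta eps <= 1.

Lemma mul_sub_mulCA (z w x y : C) : z * x - w * (z * y) = z * (x - w * y).
Proof. by rewrite mulrBr mulrCA. Qed.

Lemma addB_split (x y : C) : x = y + (x - y).
Proof. by rewrite addrCA subrr addr0. Qed.

Lemma lin_sub_mul (z p q g u v : C) : z * p + q - g * (z * u + v) = z * (p - g * u) + (q - g * v).
Proof. ring. Qed.

Lemma sum_pair n (K : R) (h : 'I_n -> R) :
  \sum_s \sum_s' K * (h s + h s') = K * (2 * n%:R * \sum_s h s).
Proof.
transitivity (\sum_(s < n) K * (n%:R * h s + \sum_s' h s')).
  apply: eq_bigr => s _; rewrite -mulr_sumr big_split /= sumr_const card_ord.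
  by rewrite -[h s *+ n]mulr_natl.
rewrite -mulr_sumr big_split /= -mulr_sumr sumr_const card_ord -[_ *+ n]mulr_natl; ring.
Qed.

Lemma real_inv_sub (g w u v : R) :
  (g%:C - 1)^-1 * (g%:C * w%:C * u%:C - v%:C) = ((g - 1)^-1 * (g * w * u - v))%:C.
Proof. by rewrite -(rmorph1 (real_complex R)) -!(rmorphM, rmorphB, fmorphV). Qed.

Lemma q_arith (g w u v s : R) : 0 < g - 1 -> g * (g - 1)^-1 <= 4 / 3 ->
  0 <= w -> 0 <= u -> 0 <= v -> u <= s -> (g - 1)^-1 * (g * w * u - v) <= 4 / 3 * w * s.
Proof.
move=> g1 g43 w0 u0 v0 us; have g1' : 0 <= (g - 1)^-1 by rewrite invr_ge0 ltW.
apply: (@le_trans _ _ ((g - 1)^-1 * (g * w * u))); first by rewrite ler_wpM2l // gerBl.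
have -> : (g - 1)^-1 * (g * w * u) = g * (g - 1)^-1 * w * u by ring.
apply: ler_pM => //; last by apply: ler_wpM2r.
by rewrite !mulr_ge0 // ltW // -(subrK 1 g) ltr_wpDr.
Qed.

Lemma bil_secrecy (K : R) (f : op c -> C) s s' : 0 < K -> bil K f ->
  abs (f (enc e (delta_mx s s')) - (s == s')%:R * f (sigma e)) <= K * (128 * a%:R * eta eps).
Proof.
move=> K0 bf; have [V [cV fE]] := bil_trace K0 bf.
rewrite (fE (enc e _)) (fE (sigma e)).
have -> : K%:C * \tr (V *m enc e (delta_mx s s')) - (s == s')%:R * (K%:C * \tr (V *m sigma e)) =
   K%:C * \tr (V *m (enc e (delta_mx s s') - (s == s')%:R *: sigma e)).
  by rewrite tr_mulBZ; exact: mul_sub_mulCA.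
rewrite absM abs_real gtr0_norm // ler_pM2l //.
exact: (secrecy k0 a0 c1 e1 d1 de eps0 nm).
Qed.

Lemma bil_mixed (K : R) (f : op c -> C) : 0 < K -> bil K f ->
  abs (f (sigma e) - f (mixed R c)) <= K * (9 / a%:R).
Proof.
move=> K0 bf; have [V [cV fE]] := bil_trace K0 bf.
rewrite !fE -mulrBr.
have -> : \tr (V *m sigma e) - \tr (V *m mixed R c) = \tr (V *m (sigma e - mixed R c)).
  by rewrite mulmxBr raddfB.
rewrite absM abs_real gtr0_norm // ler_pM2l //.
exact: (sigma_mixed k0 a0 c1 e1 d1 de eps0 nm small).
Qed.

(** Two replacements of different cost. Secrecy is applied to each of the a^2 pairs, where the
    smallness of eta pays for a^3. Replacing sigma by the mixed state costs 9 / a, too much to be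
    repeated a times, so it is applied once to the diagonal sum; hence the separate hypothesis on
    that sum. *)
Lemma bil_total (l : 'I_a -> 'I_a -> op c -> C) (K : R) : 0 < K ->
  (forall s s', bil K (l s s')) -> bil K (fun Y => \sum_s l s s Y) ->
  abs (\sum_s \sum_s' l s s' (enc e (delta_mx s s')) - \sum_s l s s (mixed R c)) <=
  K * (128 * (a%:R ^+ 3 * eta eps) + 9 / a%:R).
Proof.
move=> K0 bl bs.
have -> : \sum_s \sum_s' l s s' (enc e (delta_mx s s')) - \sum_s l s s (mixed R c) =
   \sum_s \sum_s' (l s s' (enc e (delta_mx s s')) - (s == s')%:R * l s s' (sigma e))
   + (\sum_s l s s (sigma e) - \sum_s l s s (mixed R c)).
  rewrite addrA; congr (_ - _); rewrite -big_split; apply: eq_bigr => s _ /=.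
  have -> : l s s (sigma e) = \sum_s' (s == s')%:R * l s s' (sigma e).
    rewrite (bigD1 s) //= big1 ?addr0 ?eqxx ?mul1r // => s' ss.
    by rewrite eq_sym (negbTE ss) mul0r.
  by rewrite -big_split; apply: eq_bigr => s' _ /=; rewrite subrK.
apply: le_trans (ler_absD _ _) _; rewrite mulrDr; apply: lerD; last exact: (bil_mixed K0 bs).
apply: le_trans (ler_abs_sum _ _ _) _.
apply: (@le_trans _ _ (\sum_(s < a) \sum_(s' < a) K * (128 * a%:R * eta eps))).
  apply: ler_sum => s _; apply: le_trans (ler_abs_sum _ _ _) _.
  by apply: ler_sum => s' _; exact: bil_secrecy.
rewrite !sumr_const card_ord -[(_ *+ a) *+ a]mulr_natl -[(K * _) *+ a]mulr_natl.
by rewrite le_eqVlt; apply/orP; left; apply/eqP; ring.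
Qed.

Section Attack.
Variables (a' b b' : nat) (N : finType) (W : N -> 'M[C]_(c * b', c * b)).
Hypothesis W1 : forall p (X : 'M[C]_(c * b, p)), \sum_j hs (W j *m X) <= hs X.
Variable Q : 'M[C]_(a, a').
Hypothesis QQ : Q^t* *m Q = 1%:M.

Local Notation A := (inj_bot R a *m Q *m (inj_bot R a *m Q)^t*).
Local Notation W0 := (fun j => tl (W j)).

Lemma W0_bound p (X : 'M[C]_(c * b, p)) : \sum_j hs (W0 j *m X) <= 4 * hs X.
Proof. by apply: tl_bound => //; exact: ltnW. Qed.

Lemma ptr_W0 j : ptr (W0 j) = 0.
Proof. by rewrite ptr_tl // ltnW. Qed.

Lemma iso_iQ : (inj_bot R a *m Q)^t* *m (inj_bot R a *m Q) = 1%:M.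
Proof. by rewrite adjM -mulmxA (mulmxA (_^t*) (inj_bot R a)) inj_botK mul1mx. Qed.

Lemma contr_A : contr A.
Proof. by apply: contrM; [|apply: contr_adj]; apply: contr_isometry; exact: iso_iQ. Qed.

(** The second factor of the product form in [attack_product] for B = 1, as a linear functional of
    the side input; off-diagonal blocks require it outside states. *)
Definition weight (Y : op b) : C := \tr (eff e d (kraus W0) (mixed R a *t Y)).

Lemma weight_linear z X Y : weight (z *: X + Y) = z * weight X + weight Y.
Proof.
by rewrite /weight tensDr tensZr (linear_eff e d (linear_kraus _)) mxtraceD mxtraceZ.
Qed.

Lemma weight_psd Y : psd Y -> weight Y = (complex.Re (weight Y))%:C /\ 0 <= complex.Re (weight Y).
Proof.
move=> hY; apply: psd_tr_real; apply: psd_eff; apply: psd_tens => //.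
by case: (state_mixed R a0).
Qed.

Lemma weight_enc Y : weight Y = \tr (kraus W0 (sigma e *t Y)).
Proof.
rewrite /weight; have := trace_eff_1tens e d1 1%:M (mixed R a) Y (linear_kraus W0).
by rewrite !tens11 !mul1mx.
Qed.

Lemma key_outer s s' p (u : 'M[C]_(b, p)) :
  abs (\tr ((A *t 1%:M) *m eff e d (kraus W0) (delta_mx s s' *t (u *m u^t*)))
    - \tr (A *m gam d (delta_mx s s')) * weight (u *m u^t*)) <= 64 * a%:R * eta eps * hs u.
Proof.
case: (eqVneq (hs u) 0) => [h|h].
  rewrite (hs_eq0 h) mul0mx tensmx0.
  have lE := linear_eff e d (linear_kraus W0).
  rewrite (lin_0 lE) mulmx0 mxtrace0 sub0r.
  have -> : weight 0 = 0 by rewrite /weight tensmx0 (lin_0 lE) mxtrace0.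
  rewrite mulr0 oppr0 abs0 mulr_ge0 ?hs_ge0 //.
  by rewrite mulr_ge0 ?mulr_ge0 ?ler0n ?eta_ge0.
have hp : 0 < hs u by rewrite lt_def h hs_ge0.
pose rho := ((hs u)^-1)%:C *: (u *m u^t*).
have srho : state rho.
  split; first by apply: psdZ; [rewrite invr_ge0 ltW | exact: psd_mul_adj].
  by rewrite mxtraceZ trace_mul_adj -rmorphM mulVf ?rmorph1.
have uE : u *m u^t* = (hs u)%:C *: rho by rewrite /rho scalerA -rmorphM mulfV ?scale1r.
have hk := attack_product k0 a0 c1 e1 d1 de eps0 nm s s' ptr_W0 W0_bound srho contr_A (@contr1 R _).
rewrite tens11 mul1mx in hk.
have lE := linear_eff e d (linear_kraus W0).
rewrite uE tensZr (lin_Z lE) -scalemxAr mxtraceZ.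
have -> : weight ((hs u)%:C *: rho) = (hs u)%:C * weight rho.
  by rewrite /weight tensZr (lin_Z lE) mxtraceZ.
rewrite mulrCA -mulrBr absM abs_real ger0_norm ?hs_ge0 // mulrC ler_pM2r //.
Qed.

(** On a maximally mixed ciphertext [tl_pyth] gives the sharp bound 1; 36 / a is 4 times the error
    of [bil_mixed]. The bound 4 from [tl_bound] would spoil the final constant 4 / d. *)
Lemma weight_trl p (x : 'M[C]_(a * b, p)) : hs x = 1 ->
  complex.Re (weight (trl (x *m x^t*))) <= 1 + 36 / a%:R.
Proof.
move=> x1.
pose l (G : op c) := \sum_s \tr ((1%:M : op (c * b')) *m kraus W0 (G *t (rowblk x s *m (rowblk x s)^t*))).
have bl : bil 4 l.
  by apply: (bil_kraus (@contr1 R _) W0_bound) => //; rewrite -hs_rowblk x1 mulr1.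
have wE : weight (trl (x *m x^t*)) = l (sigma e).
  rewrite weight_enc /trl tens_sumr (lin_sum (linear_kraus _)) raddf_sum; apply: eq_bigr => s _ /=.
  by rewrite slice2_rowblk mul1mx.
have lm : complex.Re (l (mixed R c)) <= 1.
  have -> : l (mixed R c) = (c%:R^-1 * \sum_s \sum_j hs (W0 j *m ((1%:M : op c) *t rowblk x s)))%:C.
    rewrite rmorphM fmorphV rmorph_nat rmorph_sum mulr_sumr; apply: eq_bigr => s _ /=.
    rewrite mul1mx /mixed tensZl (lin_Z (linear_kraus _)) mxtraceZ; congr (_ * _).
    rewrite -{1}[1%:M]mulmx1 -{2}(adjC1 R c) kraus_pair rmorph_sum raddf_sum; apply: eq_bigr => j _ /=.
    exact: trace_mul_adj.
  have cp : 0 < (c%:R : R) by rewrite ltr0n ltnW.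
  rewrite /= ler_pdivrMl // mulr1.
  have -> : c%:R = \sum_s c%:R * hs (rowblk x s) :> R by rewrite -mulr_sumr -hs_rowblk x1 mulr1.
  apply: ler_sum => s _; rewrite -hs1 -hs_tens; apply: le_trans (W1 _).
  by apply: ler_sum => j _; rewrite [leRHS]tl_pyth 1?ltnW // lerDl mulr_ge0 ?hs_ge0.
have hm := bil_mixed (ltr0n R 4) bl.
have -> : weight (trl (x *m x^t*)) = l (mixed R c) + (l (sigma e) - l (mixed R c)).
  by rewrite wE; exact: addB_split.
rewrite ReD; apply: lerD => //; apply: le_trans (Re_le_abs _) _; apply: le_trans hm _.
by rewrite mulrA -natrM.
Qed.

(** The product form is known for states; [polar] extends it to the off-diagonal blocks of x. The
    [gam] terms sum to c^2 / (c^2 - 1) <= 4 / 3 times tr (A omega) and the weight of the side input,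
    minus a nonnegative weight, which is dropped. *)
Lemma q_bound p (x : 'M[C]_(a * b, p)) : hs x = 1 ->
  complex.Re (\tr ((A *t (1%:M : op b')) *m eff e d (kraus W0) (x *m x^t*))) <=
  4 / 3 * complex.Re (\tr (A *m omega d)) * (1 + 36 / a%:R) + 256 * (a%:R ^+ 2 * eta eps).
Proof.
move=> x1; have lE := linear_eff e d (linear_kraus W0).
pose f s s' Y := \tr ((A *t (1%:M : op b')) *m eff e d (kraus W0) (delta_mx s s' *t Y))
    - \tr (A *m gam d (delta_mx s s')) * weight Y.
have lf s s' z X Y : f s s' (z *: X + Y) = z * f s s' X + f s s' Y.
  rewrite /f weight_linear tensDr tensZr lE mulmxDr -scalemxAr mxtraceD mxtraceZ.
  exact: lin_sub_mul.
have K0 : 0 <= 64 * a%:R * eta eps by rewrite !mulr_ge0 ?ler0n ?eta_ge0.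
have fb s s' : abs (f s s' (rowblk x s *m (rowblk x s')^t*)) <= 2 * (64 * a%:R * eta eps) * (hs (rowblk x s) + hs (rowblk x s')).
  by apply: polar => // u; exact: key_outer.
have fsum : abs (\sum_s \sum_s' f s s' (rowblk x s *m (rowblk x s')^t*)) <= 256 * (a%:R ^+ 2 * eta eps).
  apply: le_trans (ler_abs_sum _ _ _) _.
  apply: (@le_trans _ _ (\sum_s \sum_s' 2 * (64 * a%:R * eta eps) * (hs (rowblk x s) + hs (rowblk x s')))).
    apply: ler_sum => s _; apply: le_trans (ler_abs_sum _ _ _) _.
    by apply: ler_sum => s' _; exact: fb.
  rewrite sum_pair -hs_rowblk x1.
  by rewrite le_eqVlt; apply/orP; left; apply/eqP; ring.
have psdx : psd (trl (x *m x^t*)) by apply: psd_trl; exact: psd_mul_adj.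
(* The component of x in the tag space: its weight is the subtracted plaintext term of [gam]. *)
pose y := (Q^t* *t (1%:M : op b)) *m x.
have psdy : psd (trl (y *m y^t*)) by apply: psd_trl; exact: psd_mul_adj.
have [wxR wx0] := weight_psd psdx; have [wyR wy0] := weight_psd psdy.
have wx1 := weight_trl x1.
have psdO : psd ((inj_bot R a *m Q)^t* *m omega d *m (inj_bot R a *m Q)).
  by have := psd_conj ((inj_bot R a *m Q)^t*) (psd_omega d); rewrite trmxCK.
have tO : \tr (A *m omega d) = \tr ((inj_bot R a *m Q)^t* *m omega d *m (inj_bot R a *m Q)).
  by rewrite [RHS]mxtrace_mulC mulmxA.
have [oR o0] := psd_tr_real psdO; rewrite -tO in oR o0.
set om := complex.Re (\tr (A *m omega d)) in oR o0 *.
have lw : linear (weight : op b -> C^o) by exact: weight_linear.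
have main : \sum_s \sum_s' \tr (A *m gam d (delta_mx s s')) * weight (rowblk x s *m (rowblk x s')^t*) =
   ((c%:R ^+ 2 - 1)^-1 * (c%:R ^+ 2 * om * complex.Re (weight (trl (x *m x^t*))) - complex.Re (weight (trl (y *m y^t*)))))%:C.
  transitivity ((c%:R ^+ 2 - 1)^-1 * (c%:R ^+ 2 * om%:C * weight (trl (x *m x^t*)) - weight (trl (y *m y^t*)))).
    have wx : weight (trl (x *m x^t*)) = \sum_s weight (rowblk x s *m (rowblk x s)^t*).
      by rewrite /trl (lin_sum lw); apply: eq_bigr => s _; rewrite slice2_rowblk.
    have wy : weight (trl (y *m y^t*)) = \sum_s \sum_s' \tr (Q *m Q^t* *m delta_mx s s') * weight (rowblk x s *m (rowblk x s')^t*).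
      have -> : y *m y^t* = (Q^t* *t (1%:M : op b)) *m (x *m x^t*) *m (Q *t (1%:M : op b)).
        by rewrite /y adjM adj_tens trmxCK adjC1 !mulmxA.
      rewrite outer_rowblk mulmx_sumr mulmx_suml (lin_sum (@linear_trl R a' b)) (lin_sum lw); apply: eq_bigr => s _.
      rewrite mulmx_sumr mulmx_suml (lin_sum (@linear_trl R a' b)) (lin_sum lw); apply: eq_bigr => s' _.
      rewrite !tensmx_mul mul1mx mulmx1 trl_tens (lin_Z lw); congr (_ * _).
      by rewrite mxtrace_mulC !mulmxA.
    rewrite wx wy mulr_sumr -sumrB mulr_sumr; apply: eq_bigr => s _.
    transitivity (\sum_s' (c%:R ^+ 2 - 1)^-1 * ((s == s')%:R * (c%:R ^+ 2 * om%:C * weight (rowblk x s *m (rowblk x s')^t*))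
        - \tr (Q *m Q^t* *m delta_mx s s') * weight (rowblk x s *m (rowblk x s')^t*))); last first.
      rewrite -mulr_sumr sumrB; congr (_ * (_ - _)).
      rewrite (bigD1 s) //= big1 ?addr0 ?eqxx ?mul1r // => s' ss.
      by rewrite eq_sym (negbTE ss) mul0r.
    apply: eq_bigr => s' _; rewrite trace_mul_gam trace_delta oR.
    have -> : (inj_bot R a)^t* *m A *m inj_bot R a = Q *m Q^t*.
      by rewrite adjM !mulmxA inj_botK mul1mx -(mulmxA _ (_^t*) (inj_bot R a)) inj_botK mulmx1.
    move: (weight _) (\tr (Q *m _ *m _)) => u v; move: ((c%:R ^+ 2 - 1)^-1 : C) (c%:R ^+ 2 : C) => g h.
    ring.
  rewrite wxR wyR -(rmorph_nat (real_complex R) c) -rmorphXn /=.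
  exact: real_inv_sub.
have -> : \tr ((A *t (1%:M : op b')) *m eff e d (kraus W0) (x *m x^t*)) =
   \sum_s \sum_s' \tr (A *m gam d (delta_mx s s')) * weight (rowblk x s *m (rowblk x s')^t*)
   + \sum_s \sum_s' f s s' (rowblk x s *m (rowblk x s')^t*).
  rewrite outer_rowblk (lin_sum lE) mulmx_sumr raddf_sum -big_split; apply: eq_bigr => s _ /=.
  rewrite (lin_sum lE) mulmx_sumr raddf_sum -big_split; apply: eq_bigr => s' _ /=.
  by rewrite /f; exact: addB_split.
rewrite ReD; apply: lerD; last by apply: le_trans (Re_le_abs _) fsum.
rewrite main /=.
have cn2 : 0 < (c%:R : R) ^+ 2 - 1 by rewrite subr_gt0 -natrX ltr1n (@ltn_exp2r 1 c 2).
exact: (q_arith cn2 (c2_bound R c1) o0 wx0 wy0 wx1).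
Qed.

End Attack.
End Scheme.
End Accept.

(** * The accepting and rejecting branches *)

Section Cross.
Variable R : realType.
Local Notation C := R[i].
Local Notation op n := 'M[C]_n%N.

(** The conjugate of z combines with the adjoint of I1 into the adjoint of D E. So D appears next to
    its own adjoint and can be summed away. *)
Lemma cross_alg m n p q (I1 : 'M[C]_(m, n)) (V : op n) (D : 'M[C]_(m, q)) (E : 'M[C]_(q, n))
    (A : 'M[C]_(q, p)) (B : 'M[C]_(n, p)) (z : C) :
  I1^t* *m I1 = 1%:M -> D *m E = z *: I1 ->
  \tr (I1 *m V *m I1^t* *m (D *m A *m (z *: (I1 *m B))^t*)) =
  \tr (D^t* *m D *m (A *m (V^t* *m B)^t* *m E^t*)).
Proof.
move=> II DE; transitivity (z^*%R * \tr (I1^t* *m D *m A *m B^t* *m V)).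
  rewrite adjCZ adjM -!scalemxAr mxtraceZ; congr (_ * _).
  rewrite -(mulmxA (I1 *m V)) mxtrace_mulC.
  by rewrite !mulmxA -(mulmxA _ (I1^t*) I1) II mulmx1.
rewrite !mulmxA [RHS]mxtrace_mulC !mulmxA -[E^t* *m D^t*]adjM DE adjCZ [(V^t* *m B)^t*]adjM trmxCK !mulmxA -!scalemxAl mxtraceZ.
by [].
Qed.

Section Scheme.
Variables (k a c : nat) (I J : finType).
Variables (e : 'I_k -> I -> 'M[C]_(c, a)) (d : 'I_k -> J -> 'M[C]_(a + 1, c)).
Hypothesis k0 : (0 < k)%N.
Hypothesis a0 : (0 < a)%N.
Hypothesis c1 : (1 < c)%N.
Hypothesis e1 : forall i, \sum_j (e i j)^t* *m e i j = 1%:M.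
Hypothesis d1 : forall i, \sum_j (d i j)^t* *m d i j = 1%:M.
Hypothesis de : forall i X, kraus (d i) (kraus (e i) X) = inj_bot R a *m X *m (inj_bot R a)^t*.

Lemma enc_outer b b' p (x : 'M[C]_(a * b, p)) (w : 'M[C]_(a * b', p)) :
  k%:R^-1 *: \sum_i \sum_j (e i j *t 1%:M) *m (x *m w^t*) *m (e i j *t 1%:M)^t* =
  \sum_s \sum_s' enc e (delta_mx s s') *t (rowblk x s *m (rowblk w s')^t*).
Proof.
transitivity (k%:R^-1 *: \sum_i \sum_j \sum_s \sum_s'
    (e i j *m delta_mx s s' *m (e i j)^t*) *t (rowblk x s *m (rowblk w s')^t*)).
  congr (_ *: _); apply: eq_bigr => i _; apply: eq_bigr => j _.
  rewrite outer_rowblk_pair mulmx_sumr mulmx_suml; apply: eq_bigr => s _.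
  rewrite mulmx_sumr mulmx_suml; apply: eq_bigr => s' _.
  by rewrite adj_tens adjC1 !tensmx_mul mul1mx mulmx1.
under eq_bigr => i _ do rewrite exchange_big.
rewrite exchange_big scaler_sumr; apply: eq_bigr => s _ /=.
under eq_bigr => i _ do rewrite exchange_big.
rewrite exchange_big scaler_sumr; apply: eq_bigr => s' _ /=.
rewrite encE tensZl tens_suml; congr (_ *: _); apply: eq_bigr => i _.
by rewrite tens_suml.
Qed.

(** A test supported on the embedded plaintext brings the adjoint embedding next to d, as
    [cross_alg] requires. Summing over l then leaves no decryption, only W against encrypted
    operators. *)
Lemma cross_trace b b' (N : finType) (W : N -> 'M[C]_(c * b', c * b)) (M : N -> 'M[C]_(b', b))
    (V : op (a * b')) p (x : 'M[C]_(a * b, p)) :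
  \tr ((inj_bot R a *t 1%:M) *m V *m (inj_bot R a *t 1%:M)^t* *m
     eff e d (fun Y => \sum_n W n *m Y *m ((1%:M : op c) *t M n)^t*) (x *m x^t*)) =
  \sum_s \sum_s' \sum_n \tr (W n *m (enc e (delta_mx s s') *t
     (rowblk x s *m (rowblk (V^t* *m (((1%:M : op a) *t M n) *m x)) s')^t*))).
Proof.
have [z [ze z1]] := coef_exists a0 de.
rewrite eff_pair -scalemxAr mxtraceZ.
transitivity (k%:R^-1 * \sum_i \sum_n \sum_j \tr (W n *m ((e i j *t 1%:M) *m
   (x *m (V^t* *m (((1%:M : op a) *t M n) *m x))^t*) *m (e i j *t 1%:M)^t*))); last first.
  transitivity (\sum_n \tr (W n *m \sum_s \sum_s' enc e (delta_mx s s') *t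
     (rowblk x s *m (rowblk (V^t* *m (((1%:M : op a) *t M n) *m x)) s')^t*))); last first.
    transitivity (\sum_n \sum_s \sum_s' \tr (W n *m (enc e (delta_mx s s') *t
     (rowblk x s *m (rowblk (V^t* *m (((1%:M : op a) *t M n) *m x)) s')^t*)))).
      apply: eq_bigr => n _; rewrite mulmx_sumr raddf_sum; apply: eq_bigr => s _ /=.
      by rewrite mulmx_sumr raddf_sum.
    rewrite exchange_big; apply: eq_bigr => s _ /=.
    by rewrite exchange_big.
  rewrite exchange_big mulr_sumr; apply: eq_bigr => n _ /=.
  rewrite -enc_outer -scalemxAr mxtraceZ mulmx_sumr raddf_sum; congr (_ * _).
  apply: eq_bigr => i _ /=; rewrite mulmx_sumr raddf_sum; apply: eq_bigr => j _ /=.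
  by [].
congr (_ * _); rewrite mulmx_sumr raddf_sum; apply: eq_bigr => i _ /=.
transitivity (\sum_l \sum_n \sum_j \tr ((inj_bot R a *t (1%:M : op b')) *m V *m (inj_bot R a *t 1%:M)^t* *m
   ((d i l *t 1%:M) *m W n *m (e i j *t 1%:M) *m (x *m x^t*) *m
    ((d i l *t 1%:M) *m ((1%:M : op c) *t M n) *m (e i j *t 1%:M))^t*))).
  rewrite mulmx_sumr raddf_sum; apply: eq_bigr => l _ /=.
  rewrite mulmx_sumr raddf_sum; apply: eq_bigr => n _ /=.
  by rewrite mulmx_sumr raddf_sum.
rewrite exchange_big; apply: eq_bigr => n _ /=.
rewrite exchange_big; apply: eq_bigr => j _ /=.
have II : (inj_bot R a *t (1%:M : op b'))^t* *m (inj_bot R a *t (1%:M : op b')) = 1%:M.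
  by rewrite adj_tens tensmx_mul inj_botK adjC1 mul1mx tens11.
have DE l : (d i l *t (1%:M : op b')) *m (e i j *t 1%:M) = z i j l *: (inj_bot R a *t (1%:M : op b')).
  by rewrite tensmx_mul ze mul1mx tensZl.
have h l : \tr ((inj_bot R a *t (1%:M : op b')) *m V *m (inj_bot R a *t 1%:M)^t* *m
   ((d i l *t 1%:M) *m W n *m (e i j *t 1%:M) *m (x *m x^t*) *m
    ((d i l *t 1%:M) *m ((1%:M : op c) *t M n) *m (e i j *t 1%:M))^t*)) =
   \tr ((d i l *t (1%:M : op b'))^t* *m (d i l *t 1%:M) *m
     (W n *m (e i j *t 1%:M) *m x *m (V^t* *m (((1%:M : op a) *t M n) *m x))^t* *m (e i j *t 1%:M)^t*)).
  rewrite -(cross_alg V _ _ II (DE l)); congr (\tr (_ *m _)).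
  have -> : z i j l *: ((inj_bot R a *t (1%:M : op b')) *m (((1%:M : op a) *t M n) *m x)) =
     (d i l *t 1%:M) *m ((1%:M : op c) *t M n) *m (e i j *t 1%:M) *m x.
    by rewrite mulmxA !tensmx_mul !mulmx1 !mul1mx ze tensZl -scalemxAl.
  by rewrite [in RHS]adjM !mulmxA.
under eq_bigr => l _ do rewrite h.
rewrite -raddf_sum /= -mulmx_suml.
have -> : \sum_l (d i l *t (1%:M : op b'))^t* *m (d i l *t 1%:M) = 1%:M.
  under eq_bigr => l _ do rewrite adj_tens adjC1 tensmx_mul mulmx1.
  by rewrite -tens_suml d1 tens11.
by rewrite mul1mx !mulmxA.
Qed.

End Scheme.
End Cross.

(** * Comparison with the simulator on acceptance *)

Section AcceptBound.
Variable R : realType.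
Local Notation C := R[i].
Local Notation op n := 'M[C]_n%N.

Lemma bil_le c (K K' : R) (f : op c -> C) : K <= K' -> bil K f -> bil K' f.
Proof.
move=> KK [lf bf]; split=> // p G H; apply: le_trans (bf _ _ _) _.
by apply: ler_wpM2r => //; rewrite addr_ge0 ?hs_ge0.
Qed.

Lemma bil_sum (T : finType) c (K : T -> R) (f : T -> op c -> C) :
  (forall t, bil (K t) (f t)) -> bil (\sum_t K t) (fun G => \sum_t f t G).
Proof.
move=> h; split=> [z X Y|p G H].
  rewrite mulr_sumr -big_split; apply: eq_bigr => t _ /=.
  by case: (h t) => -> _.
apply: le_trans (ler_wpM2l _ (ler_abs_sum _ _ _)) _ => //.
rewrite mulr_sumr mulr_suml; apply: ler_sum => t _.
by case: (h t) => _.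
Qed.

(** W acts on one of the two vectors only, so u and the v n enter the constant additively and sums
    over blocks stay bounded by total norms. *)
Lemma bil_pair (N : finType) c b b' q (W : N -> 'M[C]_(c * b', c * b)) (u : 'M[C]_(b, q))
    (v : N -> 'M[C]_(b', q)) (z : R) :
  (forall p (X : 'M[C]_(c * b, p)), \sum_j hs (W j *m X) <= z * hs X) ->
  bil (z * hs u + \sum_n hs (v n)) (fun G : op c => \sum_n \tr (W n *m (G *t (u *m (v n)^t*)))).
Proof.
move=> hW; split=> [w X Y|p G H].
  rewrite mulr_sumr -big_split; apply: eq_bigr => n _ /=.
  by rewrite tensDl tensZl mulmxDr -scalemxAr mxtraceD mxtraceZ.
apply: le_trans (ler_wpM2l _ (ler_abs_sum _ _ _)) _ => //.
rewrite mulr_sumr; apply: (@le_trans _ _ (\sum_n (hs (W n *m (G *t u)) + hs (H *t v n)))).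
  apply: ler_sum => n _; have -> : W n *m ((G *m H^t*) *t (u *m (v n)^t*)) = 1%:M *m (W n *m (G *t u) *m (H *t v n)^t*).
    by rewrite mul1mx adj_tens -mulmxA tensmx_mul.
  exact/trace_pair_le/contr1.
rewrite big_split /=; have h1 := hW _ (G *t u); rewrite hs_tens in h1.
have -> : \sum_n hs (H *t v n) = hs H * \sum_n hs (v n).
  by rewrite mulr_sumr; apply: eq_bigr => n _; exact: hs_tens.
have s0 : 0 <= \sum_n hs (v n) by apply: sumr_ge0 => n _; exact: hs_ge0.
have z0 : 0 <= z * (hs G * hs u) by apply: le_trans h1; apply: sumr_ge0 => n _; exact: hs_ge0.
have zH : 0 <= z * (hs H * hs u).
  by have := hW _ (H *t u); rewrite hs_tens; apply: le_trans; apply: sumr_ge0 => n _; exact: hs_ge0.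
have sG := mulr_ge0 s0 (hs_ge0 G).
apply: le_trans (lerD h1 (lexx _)) _.
rewrite mulrDl !mulrDr -subr_ge0.
have -> : forall g h t : R, z * hs u * g + z * hs u * h + (t * g + t * h) - (z * (g * hs u) + h * t)
   = z * (h * hs u) + t * g by move=> *; ring.
by rewrite addr_ge0.
Qed.

Lemma abs_sub0 (x y : C) (t : R) : abs (x - y) <= t -> y = 0 -> abs x <= t.
Proof. by move=> h y0; rewrite y0 subr0 in h. Qed.

Lemma test_sum4 n (B Z1 Z2 Z3 Z4 : op n) (t : C) (q s : R) : \tr (B *m Z4) = t ->
  abs (\tr (B *m Z1)) <= q -> abs (\tr (B *m Z2)) <= s -> abs (\tr (B *m Z3)) <= s ->
  abs (\tr (B *m (Z1 + Z2 + Z3 + Z4)) - t) <= q + 2 * s.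
Proof.
move=> h4 h1 h2 h3; rewrite !mulmxDr !mxtraceD h4 addrK.
apply: le_trans (ler_absD _ _) _; apply: le_trans (lerD (ler_absD _ _) (lexx _)) _.
by apply: le_trans (lerD (lerD h1 h2) h3) _; rewrite -addrA mulr_natl mulr2n.
Qed.

Section Scheme.
Variables (k a c : nat) (I J : finType).
Variables (e : 'I_k -> I -> 'M[C]_(c, a)) (d : 'I_k -> J -> 'M[C]_(a + 1, c)).
Hypothesis k0 : (0 < k)%N.
Hypothesis a0 : (0 < a)%N.
Hypothesis c1 : (1 < c)%N.
Hypothesis e1 : forall i, \sum_j (e i j)^t* *m e i j = 1%:M.
Hypothesis d1 : forall i, \sum_j (d i j)^t* *m d i j = 1%:M.
Hypothesis de : forall i X, kraus (d i) (kraus (e i) X) = inj_bot R a *m X *m (inj_bot R a)^t*.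

Lemma eff_plain b b' (N : finType) (M : N -> 'M[C]_(b', b)) (X : op (a * b)) :
  eff e d (kraus (fun n => (1%:M : op c) *t M n)) X =
  (inj_bot R a *t 1%:M) *m on2 (kraus M) X *m (inj_bot R a *t 1%:M)^t*.
Proof.
move: X; apply: tens_ext.
- exact: linear_eff (linear_kraus _).
- by move=> z X Y; rewrite (linear_on2 (linear_kraus M)) mulmxDr mulmxDl -scalemxAr -scalemxAl.
move=> X Y; rewrite eff_tens on2_tens ?adj_tens ?tensmx_mul; last exact: linear_kraus.
rewrite adjC1 mul1mx mulmx1.
have h i : on1 (kraus (d i)) (kraus (fun n => (1%:M : op c) *t M n) (kraus (e i) X *t Y)) =
    (inj_bot R a *m X *m (inj_bot R a)^t*) *t kraus M Y.
  rewrite -on2_kraus on2_tens ?on1_tens ?de //; exact: linear_kraus.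
under eq_bigr => i _ do rewrite h.
rewrite sumr_const card_ord -[(_ *t _) *+ k]scaler_nat scalerA mulVf ?scale1r //.
by rewrite pnatr_eq0 -lt0n.
Qed.

Variable eps : R.
Hypothesis eps0 : 0 <= eps.
Hypothesis nm : nm_prod e d eps.
Hypothesis small : a%:R ^+ 6 * eta eps <= 1.

(** The error of [bil_total] for K = 1. *)
Definition slack : R := 128 * (a%:R ^+ 3 * eta eps) + 9 / a%:R.

Section Attack.
Variables (b b' : nat) (N : finType) (W : N -> 'M[C]_(c * b', c * b)).
Hypothesis W1 : forall p (X : 'M[C]_(c * b, p)), \sum_j hs (W j *m X) <= hs X.

Local Notation W0 := (fun j => tl (W j)).
Local Notation I1 := (inj_bot R a *t (1%:M : op b')).

(** [bil_total] with K = 5, namely 4 for the traceless family and 1 for the averages. Its main term,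
    on a maximally mixed ciphertext, contains ptr (tl (W n)) = 0, so the cross terms are pure
    error. *)
Lemma cross_bound (V : op (a * b')) p (x : 'M[C]_(a * b, p)) : contr V -> hs x = 1 ->
  abs (\tr (I1 *m V *m I1^t* *m
     eff e d (fun Y => \sum_n tl (W n) *m Y *m ((1%:M : op c) *t avg (W n))^t*) (x *m x^t*))) <= 5 * slack.
Proof.
move=> cV x1; rewrite (cross_trace a0 d1 de (fun n => tl (W n)) (fun n => avg (W n))).
have wb : \sum_n hs (V^t* *m (((1%:M : op a) *t avg (W n)) *m x)) <= 1.
  rewrite -x1; apply: le_trans (avg1_bound (ltnW c1) W1 x).
  by apply: ler_sum => n _; exact: contr_adj.
pose w n := V^t* *m (((1%:M : op a) *t avg (W n)) *m x).
pose l s s' (G : op c) := \sum_n \tr (tl (W n) *m (G *t (rowblk x s *m (rowblk (w n) s')^t*))).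
pose K s s' := 4 * hs (rowblk x s) + \sum_n hs (rowblk (w n) s').
have bl s s' : bil (K s s') (l s s').
  exact: (bil_pair (rowblk x s) (fun n => rowblk (w n) s') (tl_bound (ltnW c1) W1)).
have rs (q n : nat) (v : 'M[C]_(a * q, n)) s : hs (rowblk v s) <= hs v.
  rewrite [leRHS]hs_rowblk (bigD1 s) //= lerDl.
  by apply: sumr_ge0 => i _; exact: hs_ge0.
have K5 s s' : K s s' <= 5.
  rewrite /K; have := rs _ _ x s; rewrite x1 => xs.
  have : \sum_n hs (rowblk (w n) s') <= 1.
    by apply: le_trans wb; apply: ler_sum => n _; exact: rs.
  lra.
have bs : bil 5 (fun G => \sum_s l s s G).
  apply: bil_le (bil_sum (fun s => bl s s)).
  rewrite big_split /= -mulr_sumr -hs_rowblk x1 exchange_big /=.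
  by under eq_bigr => n _ do rewrite -hs_rowblk; lra.
apply: (abs_sub0 (bil_total k0 a0 c1 e1 d1 de eps0 nm small (ltr0n R 5) (fun s s' => bil_le (K5 s s') (bl s s')) bs)).
  rewrite big1 // => s _; rewrite /l big1 // => n _.
  rewrite tensZl -scalemxAr mxtraceZ tr_ptr ptr_mulr ptr_tl ?(ltnW c1) //.
  by rewrite mul0mx mxtrace0 mulr0.
Qed.

Lemma cross_bound_adj (V : op (a * b')) p (x : 'M[C]_(a * b, p)) : contr V -> hs x = 1 ->
  abs (\tr (I1 *m V *m I1^t* *m
     eff e d (fun Y => \sum_n ((1%:M : op c) *t avg (W n)) *m Y *m (tl (W n))^t*) (x *m x^t*))) <= 5 * slack.
Proof.
move=> cV x1; have := cross_bound (contr_adj cV) x1.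
set Z := eff _ _ _ _; move: (eff_pair_adj e d (fun n => tl (W n)) (fun n => (1%:M : op c) *t avg (W n)) (x *m x^t*)).
rewrite -/Z adjM trmxCK => <-.
by rewrite -abs_conj -tr_adj adjM !adjM !trmxCK mxtrace_mulC !mulmxA.
Qed.

Section Accept.
Variable a' : nat.
Variable Q : 'M[C]_(a, a').
Hypothesis QQ : Q^t* *m Q = 1%:M.
Local Notation iQ := ((inj_bot R a *m Q) *t (1%:M : op b')).

(** The right-hand side of [q_bound]: how much of the traceless part, which the simulator rejects,
    may still pass the tag test. *)
Definition reject_weight : R :=
  4 / 3 * complex.Re (\tr (inj_bot R a *m Q *m (inj_bot R a *m Q)^t* *m omega d)) * (1 + 36 / a%:R)
  + 256 * (a%:R ^+ 2 * eta eps).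

Lemma kraus_split Y : kraus W Y =
  kraus W0 Y + \sum_n tl (W n) *m Y *m ((1%:M : op c) *t avg (W n))^t*
  + \sum_n ((1%:M : op c) *t avg (W n)) *m Y *m (tl (W n))^t*
  + kraus (fun n => (1%:M : op c) *t avg (W n)) Y.
Proof.
rewrite /kraus -!big_split; apply: eq_bigr => n _ /=.
rewrite {1 2}(tl_avg (W n)); move: (tl _) (_ *t _) => A B.
by rewrite adjD mulmxDl mulmxDr !mulmxDl addrACA -!addrA.
Qed.

(** Of the four parts in [kraus_split] the averages commute with encryption and reproduce the
    simulator exactly; the traceless part costs [reject_weight], and the two cross terms 5 slack
    each. *)
Lemma accept (T : op (a' * b')) p (y : 'M[C]_(a' * b, p)) : contr T -> hs y = 1 ->
  abs (\tr (T *m (iQ^t* *m eff e d (kraus W) (((Q *t 1%:M) *m y) *m ((Q *t 1%:M) *m y)^t*) *m iQ))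
    - \tr (T *m on2 (kraus (fun n => avg (W n))) (y *m y^t*))) <= reject_weight + 10 * slack.
Proof.
move=> cT y1.
have QI n : (Q *t (1%:M : op n))^t* *m (Q *t 1%:M) = 1%:M.
  by rewrite adj_tens adjC1 tensmx_mul QQ mul1mx tens11.
have yE : on2 (kraus (fun n => avg (W n))) (((Q *t 1%:M) *m y) *m ((Q *t 1%:M) *m y)^t*) =
   (Q *t 1%:M) *m on2 (kraus (fun n => avg (W n))) (y *m y^t*) *m (Q *t 1%:M)^t*.
  rewrite !on2_kraus /kraus mulmx_sumr mulmx_suml; apply: eq_bigr => n _.
  have h : (1%:M *t avg (W n)) *m (Q *t (1%:M : op b)) = (Q *t (1%:M : op b')) *m (1%:M *t avg (W n)).
    by rewrite !tensmx_mul !mul1mx !mulmx1.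
  by rewrite adjM !mulmxA h -!mulmxA -!adjM h adjM.
have x1 : hs ((Q *t (1%:M : op b)) *m y) = 1 by rewrite hs_isometry.
move: ((Q *t (1%:M : op b)) *m y) x1 yE => x x1 yE.
pose V := (Q *t (1%:M : op b')) *m T *m (Q *t 1%:M)^t*.
have cV : contr V.
  by apply: contrM; [apply: contrM => //|apply: contr_adj]; exact: contr_isometry.
have iQE : iQ = I1 *m (Q *t 1%:M) by rewrite tensmx_mul mul1mx.
have trV (Z : op ((a + 1) * b')) : \tr (T *m (iQ^t* *m Z *m iQ)) = \tr (I1 *m V *m I1^t* *m Z).
  transitivity (\tr ((I1 *m (Q *t 1%:M)) *m (T *m (Q *t 1%:M)^t* *m I1^t* *m Z))).
    by rewrite [RHS]mxtrace_mulC iQE adjM !mulmxA.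
  by rewrite /V !mulmxA.
have II : I1^t* *m I1 = 1%:M.
  by rewrite adj_tens tensmx_mul inj_botK adjC1 mul1mx tens11.
have last : \tr (I1 *m V *m I1^t* *m eff e d (kraus (fun n => (1%:M : op c) *t avg (W n))) (x *m x^t*)) =
   \tr (T *m on2 (kraus (fun n => avg (W n))) (y *m y^t*)).
  rewrite -trV eff_plain yE; move: (on2 _ _) => Z; congr (\tr (_ *m _)).
  rewrite iQE adjM !mulmxA -(mulmxA _ (I1^t*) I1) II mulmx1 -(mulmxA _ (I1^t*) I1) II mulmx1.
  by rewrite QI mul1mx -mulmxA QI mulmx1.
have first : abs (\tr (I1 *m V *m I1^t* *m eff e d (kraus W0) (x *m x^t*))) <= reject_weight.
  rewrite -trV; apply: le_trans (abs_tr_psd cT _) _.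
    have := psd_conj (iQ^t*) (psd_eff e d W0 (psd_mul_adj x)).
    by rewrite trmxCK.
  have -> : \tr (iQ^t* *m eff e d (kraus W0) (x *m x^t*) *m iQ) =
     \tr ((inj_bot R a *m Q *m (inj_bot R a *m Q)^t* *t (1%:M : op b')) *m eff e d (kraus W0) (x *m x^t*)).
    rewrite mxtrace_mulC mulmxA; congr (\tr (_ *m _)).
    by rewrite adj_tens adjC1 tensmx_mul mul1mx.
  exact: (q_bound k0 a0 c1 e1 d1 de eps0 nm small W1 QQ x1).
rewrite trV.
have -> : eff e d (kraus W) (x *m x^t*) =
  eff e d (kraus W0) (x *m x^t*)
  + eff e d (fun Y => \sum_n tl (W n) *m Y *m ((1%:M : op c) *t avg (W n))^t*) (x *m x^t*)
  + eff e d (fun Y => \sum_n ((1%:M : op c) *t avg (W n)) *m Y *m (tl (W n))^t*) (x *m x^t*)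
  + eff e d (kraus (fun n => (1%:M : op c) *t avg (W n))) (x *m x^t*).
  rewrite -!eff_add; apply: eq_eff => Y; exact: kraus_split.
have := test_sum4 last first (cross_bound cV x1) (cross_bound_adj cV x1).
by rewrite mulrA -natrM.
Qed.

End Accept.
End Attack.
End Scheme.
End AcceptBound.

(** * The rejection branch *)

Section TagBound.
Variable R : realType.
Local Notation C := R[i].
Local Notation op n := 'M[C]_n%N.

Lemma botE a : bot R a = delta_mx (rshift a 0) (rshift a 0).
Proof.
apply/matrixP => i j; rewrite /bot /block_mx !mxE.
case: (splitP i) => i' Ei; rewrite mxE; case: (splitP j) => j' Ej; rewrite !mxE.
- by case: eqP => // /(congr1 val) /=; rewrite Ei => h; have := ltn_ord i'; rewrite h addn0 ltnn.
- by case: eqP => // /(congr1 val) /=; rewrite Ei => h; have := ltn_ord i'; rewrite h addn0 ltnn.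
- by case: (j =P _) => [/(congr1 val) /=|]; rewrite ?andbF // Ej => h; have := ltn_ord j'; rewrite h addn0 ltnn.
have -> : i = rshift a 0 by apply: val_inj => /=; rewrite Ei ord1.
have -> : j = rshift a 0 by apply: val_inj => /=; rewrite Ej ord1.
by rewrite !ord1 !eqxx.
Qed.

Lemma trace_mul_delta_tens m n (V : op (m * n)) (x : 'I_m) (Z : op n) :
  \tr (V *m (delta_mx x x *t Z)) = \tr (slice2 V x x *m Z).
Proof.
rewrite /mxtrace sum_mxtens (bigD1 x) //= [X in _ + X]big1 ?addr0 => [|y yx]; last first.
  rewrite big1 // => i _; rewrite mxE sum_mxtens big1 // => z _; rewrite big1 // => l _.
  by rewrite tensmxE mxE (negbTE yx) andbF mul0r mulr0.
apply: eq_bigr => i _; rewrite !mxE sum_mxtens (bigD1 x) //= [X in _ + X]big1 ?addr0 => [|y yx]; last first.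
  by rewrite big1 // => l _; rewrite tensmxE mxE (negbTE yx) /= mul0r mulr0.
by apply: eq_bigr => l _; rewrite tensmxE !mxE !eqxx mul1r.
Qed.

Lemma contr_slice2 m n (V : op (m * n)) (x : 'I_m) : contr V -> contr (slice2 V x x).
Proof.
move=> cV p X; pose KX : 'M[C]_(m * n, p) :=
  \matrix_(i, j) (((mxtens_unindex i).1 == x)%:R * X (mxtens_unindex i).2 j).
have -> : hs X = hs KX.
  rewrite hs_rowblk (bigD1 x) //= [X in _ + X]big1 ?addr0 => [|y yx].
    by congr hs; apply/matrixP => i j; rewrite !mxE mxtens_indexK eqxx mul1r.
  have -> : rowblk KX y = 0; last by rewrite /hs big1 // => i _; rewrite big1 // => j _; rewrite mxE abs0 expr0n.
  by apply/matrixP => i j; rewrite !mxE mxtens_indexK (negbTE yx) mul0r.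
apply: le_trans (cV _ KX).
rewrite [leRHS]hs_rowblk (bigD1 x) //=; have -> : rowblk (V *m KX) x = slice2 V x x *m X.
  apply/matrixP => i j; rewrite !mxE sum_mxtens (bigD1 x) //= [X in _ + X]big1 ?addr0 => [|y yx]; last first.
    by rewrite big1 // => l _; rewrite !mxE mxtens_indexK (negbTE yx) mul0r mulr0.
  by apply: eq_bigr => l _; rewrite !mxE mxtens_indexK eqxx mul1r.
by rewrite lerDl; apply: sumr_ge0 => i _; exact: hs_ge0.
Qed.

Lemma on1_conj m m' n (K : 'M[C]_(m', m)) (Y : op (m * n)) :
  on1 (fun Z => K *m Z *m K^t*) Y = (K *t 1%:M) *m Y *m (K *t 1%:M)^t*.
Proof.
transitivity (on1 (kraus (fun _ : 'I_1 => K)) Y).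
  apply: eq_on1 => Z; by rewrite /kraus big_ord1.
by rewrite on1_kraus /kraus big_ord1.
Qed.

Lemma on1_trace m m' n (B : op m) (Z0 : op m') (Y : op (m * n)) :
  on1 (fun Z => \tr (B *m Z) *: Z0) Y = Z0 *t trl ((B *t 1%:M) *m Y).
Proof.
have lf : linear (fun Z => \tr (B *m Z) *: Z0).
  by move=> z X X'; rewrite mulmxDr -scalemxAr mxtraceD mxtraceZ scalerDl scalerA.
move: Y; apply: tens_ext; first exact: linear_on1.
  by move=> z X X'; rewrite mulmxDr -scalemxAr linear_trl tensDr tensZr.
by move=> X X'; rewrite on1_tens // tensmx_mul mul1mx trl_tens tensZl tensZr.
Qed.

Lemma on1_comp m m' m'' n (f : op m' -> op m'') (g : op m -> op m') (Y : op (m * n)) :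
  linear f -> linear g -> on1 (f \o g) Y = on1 f (on1 g Y).
Proof.
move=> lf lg; move: Y; apply: tens_ext.
- by apply: linear_on1; exact: linear_comp.
- by apply: linear_comp; exact: linear_on1.
by move=> X X'; rewrite !on1_tens //; exact: linear_comp.
Qed.

(** The Kraus operators of the rejection branch of the simulator: the
    traceless part of the attack on a maximally mixed ciphertext. *)
Definition rej_ops c b b' (N : finType) (W : N -> 'M[C]_(c * b', c * b)) (t : N * ('I_c * 'I_c)) : 'M[C]_(b', b) :=
  (Num.sqrt (c%:R^-1))%:C *: blk (tl (W t.1)) t.2.1 t.2.2.

Lemma kraus_rej_ops c b b' (N : finType) (W : N -> 'M[C]_(c * b', c * b)) X :
  kraus (rej_ops W) X = trl (kraus (fun n => tl (W n)) (mixed R c *t X)).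
Proof.
rewrite /kraus (lin_sum (@linear_trl R c b')).
rewrite -(pair_bigA _ (fun n t => rej_ops W (n, t) *m X *m (rej_ops W (n, t))^t*)) /=.
apply: eq_bigr => n _.
rewrite -(pair_bigA _ (fun x y => rej_ops W (n, (x, y)) *m X *m (rej_ops W (n, (x, y)))^t*)) /= /trl.
apply: eq_bigr => x _.
have sE (Z : op (c * b')) : slice2 Z x x = blk Z x x by apply/matrixP => i j; rewrite !mxE.
rewrite sE blkM; apply: eq_bigr => y _.
rewrite blk_adj blkM (bigD1 y) //= big1 ?addr0 => [|z zy]; last first.
  by rewrite blk_tens !mxE (negbTE zy) mulr0 scale0r mulmx0.
rewrite blk_tens !mxE eqxx mulr1 /rej_ops /= adjCZ.
rewrite -!scalemxAr -!scalemxAl !scalerA; congr (_ *: _).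
by rewrite conj_real swapout_sqr.
Qed.

Lemma add4_0 (x y z t : C) : y = 0 -> z = 0 -> x + y + z + t = x + t.
Proof. by move=> -> ->; rewrite !addr0. Qed.

(** On a maximally mixed ciphertext the cross terms contain ptr (tl (W n)) = 0. For B = 1 the
    identity also shows that the two simulator maps together preserve the trace. *)
Lemma mixed_test c b b' (N : finType) (W : N -> 'M[C]_(c * b', c * b)) (B : op b') (X : op b) : (0 < c)%N ->
  \tr (((1%:M : op c) *t B) *m kraus W (mixed R c *t X)) =
  \tr (B *m kraus (rej_ops W) X) + \tr (B *m kraus (fun n => avg (W n)) X).
Proof.
move=> c0; rewrite kraus_rej_ops trace_trl kraus_split !mulmxDr !mxtraceD.
have h1 : \tr (((1%:M : op c) *t B) *m \sum_n tl (W n) *m (mixed R c *t X) *m ((1%:M : op c) *t avg (W n))^t*) = 0.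
  rewrite mulmx_sumr raddf_sum big1 //= => n _.
  rewrite tensZl adj_tens adjC1 -scalemxAr -scalemxAl -scalemxAr mxtraceZ tr_ptr.
  by rewrite ptr_mull !ptr_mulr ptr_tl // !mul0mx mulmx0 mxtrace0 mulr0.
have h2 : \tr (((1%:M : op c) *t B) *m \sum_n ((1%:M : op c) *t avg (W n)) *m (mixed R c *t X) *m (tl (W n))^t*) = 0.
  rewrite mulmx_sumr raddf_sum big1 //= => n _.
  rewrite tensZl -scalemxAr -scalemxAl -scalemxAr mxtraceZ mulmxA mulmxA tr_ptr.
  rewrite !tensmx_mul !mul1mx ptr_mull.
  have -> : ptr ((tl (W n))^t*) = 0.
    have := ptr_tl (W n) c0; rewrite /ptr => h.
    under eq_bigr => z _ do rewrite blk_adj.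
    by rewrite -adj_sum h trmx0 map_mx0.
  by rewrite mulmx0 mxtrace0 mulr0.
apply: etrans (add4_0 _ _ h1 h2) _; congr (_ + _).
rewrite -on2_kraus on2_tens; last exact: linear_kraus.
rewrite tensmx_mul trace_tens mul1mx; case: (state_mixed R c0) => _ ->.
by rewrite mul1r.
Qed.

Section Scheme.
Variables (k a c : nat) (I J : finType).
Variables (e : 'I_k -> I -> 'M[C]_(c, a)) (d : 'I_k -> J -> 'M[C]_(a + 1, c)).
Hypothesis k0 : (0 < k)%N.
Hypothesis a0 : (0 < a)%N.
Hypothesis c1 : (1 < c)%N.
Hypothesis e1 : forall i, \sum_j (e i j)^t* *m e i j = 1%:M.
Hypothesis d1 : forall i, \sum_j (d i j)^t* *m d i j = 1%:M.
Hypothesis de : forall i X, kraus (d i) (kraus (e i) X) = inj_bot R a *m X *m (inj_bot R a)^t*.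
Variable eps : R.
Hypothesis eps0 : 0 <= eps.
Hypothesis nm : nm_prod e d eps.
Hypothesis small : a%:R ^+ 6 * eta eps <= 1.

Variables (b b' : nat) (N : finType) (W : N -> 'M[C]_(c * b', c * b)).
Hypothesis W1 : forall p (X : 'M[C]_(c * b, p)), \sum_j hs (W j *m X) <= hs X.

Lemma eq_bil (K : R) (f g : op c -> C) : (forall G, f G = g G) -> bil K f -> bil K g.
Proof.
by move=> fg [lf bf]; split=> [z X Y|p G H]; rewrite -!fg //; exact: bf.
Qed.

(** A test on the side register alone is a functional of encrypted operators, so [bil_total]
    applies, with K = 1 because the attack is not split here. *)
Lemma reject_test (B : op b') p (x : 'M[C]_(a * b, p)) : contr B -> hs x = 1 ->
  abs (\tr (((1%:M : op (a + 1)) *t B) *m eff e d (kraus W) (x *m x^t*))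
     - \tr (((1%:M : op c) *t B) *m kraus W (mixed R c *t trl (x *m x^t*)))) <= slack a eps.
Proof.
move=> cB x1.
pose l s s' (G : op c) := \tr (((1%:M : op c) *t B) *m kraus W (G *t (rowblk x s *m (rowblk x s')^t*))).
have cB1 : contr ((1%:M : op c) *t B) by apply: contr_tens => //; exact: contr1.
have W1' p' (X : 'M[C]_(c * b, p')) : \sum_j hs (W j *m X) <= 1 * hs X by rewrite mul1r.
have rs s : hs (rowblk x s) <= 1.
  rewrite -x1 [leRHS]hs_rowblk (bigD1 s) //= lerDl.
  by apply: sumr_ge0 => i _; exact: hs_ge0.
have bl s s' : bil 1 (l s s').
  apply: eq_bil (bil_kraus (T := 'I_1) (u := fun _ => rowblk x s) (v := fun _ => rowblk x s') cB1 W1' ler01 _ _).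
  - by move=> G; rewrite big_ord1.
  - by rewrite big_ord1 mul1r.
  - by rewrite big_ord1 mul1r.
have bs : bil 1 (fun G => \sum_s l s s G).
  by apply: (bil_kraus (T := 'I_a) cB1 W1' ler01); rewrite -hs_rowblk x1 mulr1.
have lE := linear_eff e d (linear_kraus W).
have -> : \tr (((1%:M : op (a + 1)) *t B) *m eff e d (kraus W) (x *m x^t*)) =
    \sum_s \sum_s' l s s' (enc e (delta_mx s s')).
  rewrite outer_rowblk (lin_sum lE) mulmx_sumr raddf_sum; apply: eq_bigr => s _ /=.
  rewrite (lin_sum lE) mulmx_sumr raddf_sum; apply: eq_bigr => s' _ /=.
  exact: (trace_eff_1tens e d1 B _ _ (linear_kraus W)).
have -> : \tr (((1%:M : op c) *t B) *m kraus W (mixed R c *t trl (x *m x^t*))) = \sum_s l s s (mixed R c).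
  rewrite /trl tens_sumr (lin_sum (linear_kraus W)) mulmx_sumr raddf_sum; apply: eq_bigr => s _ /=.
  by rewrite slice2_rowblk.
have := bil_total k0 a0 c1 e1 d1 de eps0 nm small ltr01 bl bs.
by rewrite mul1r.
Qed.

End Scheme.
End TagBound.

(** * Total error of the tagged decryption *)

Section TagTest.
Variable R : realType.
Local Notation C := R[i].
Local Notation op n := 'M[C]_n%N.

Lemma tensBl m n p q (X Y : 'M[C]_(m, n)) (Z : 'M[C]_(p, q)) : (X - Y) *t Z = X *t Z - Y *t Z.
Proof. by rewrite tensDl -(scaleN1r Y) tensZl scaleN1r. Qed.

Lemma trl_on1_tp m m' n (f : op m -> op m') (X : op (m * n)) : linear f -> trace_preserving f ->
  trl (on1 f X) = trl X.
Proof.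
move=> lf tf; move: X; apply: tens_ext.
- by apply: linear_comp; [exact: linear_trl | exact: linear_on1].
- exact: linear_trl.
by move=> X Y; rewrite on1_tens // !trl_tens tf.
Qed.

Lemma trl_on2 m n n' (f : op n -> op n') (X : op (m * n)) : linear f ->
  trl (on2 f X) = f (trl X).
Proof.
move=> lf; move: X; apply: tens_ext.
- by apply: linear_comp; [exact: linear_trl | exact: linear_on2].
- by apply: linear_comp => //; exact: linear_trl.
by move=> X Y; rewrite on2_tens // !trl_tens (lin_Z lf).
Qed.

Lemma abs_two_tests (x y z t u v w : C) (p q : R) : abs (x - y) <= p ->
  abs (t - u) <= q -> abs (z - v) <= p -> u = w + v ->
  abs (x + (t - z) - (y + w)) <= p + q + p.
Proof.
move=> h1 h2 h3 uE; have -> : x + (t - z) - (y + w) = (x - y) + (t - u) - (z - v) by rewrite uE; ring.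
apply: le_trans (ler_absD _ _) _; rewrite absN; apply: lerD => //.
by apply: le_trans (ler_absD _ _) _; apply: lerD.
Qed.

Section Scheme.
Variables (k a c : nat) (I J : finType).
Variables (e : 'I_k -> I -> 'M[C]_(c, a)) (d : 'I_k -> J -> 'M[C]_(a + 1, c)).
Hypothesis k0 : (0 < k)%N.
Hypothesis a0 : (0 < a)%N.
Hypothesis c1 : (1 < c)%N.
Hypothesis e1 : forall i, \sum_j (e i j)^t* *m e i j = 1%:M.
Hypothesis d1 : forall i, \sum_j (d i j)^t* *m d i j = 1%:M.
Hypothesis de : forall i X, kraus (d i) (kraus (e i) X) = inj_bot R a *m X *m (inj_bot R a)^t*.
Variable eps : R.
Hypothesis eps0 : 0 <= eps.
Hypothesis nm : nm_prod e d eps.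
Hypothesis small : a%:R ^+ 6 * eta eps <= 1.

Variables (b b' : nat) (N : finType) (W : N -> 'M[C]_(c * b', c * b)).
Hypothesis W1 : forall p (X : 'M[C]_(c * b, p)), \sum_j hs (W j *m X) <= hs X.
Variables (a' : nat) (Q : 'M[C]_(a, a')).
Hypothesis QQ : Q^t* *m Q = 1%:M.

Local Notation iQ := (inj_bot R a *m Q).
Local Notation j := (inj_bot R a').

(** What the tagged scheme does after D. A |bot> put out by D is orthogonal to the range of iQ and
    so remains a rejection. *)
Definition tag_check (Z : op (a + 1)) : op (a' + 1) :=
  j *m iQ^t* *m Z *m (j *m iQ^t*)^t* + \tr ((1%:M - iQ *m iQ^t*) *m Z) *: bot R a'.

Lemma linear_tag_check : linear tag_check.
Proof.
move=> z X Y; rewrite /tag_check; move: (1%:M - _) (j *m _) => B K.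
rewrite !mulmxDr !mulmxDl -!scalemxAr -!scalemxAl mxtraceD mxtraceZ.
by rewrite scalerDl scalerDr scalerA addrACA.
Qed.

(** Rejection is written as everything minus acceptance, so that it can be handled by [reject_test]
    and a second use of [accept]. *)
Lemma trace_tag_check (V : op ((a' + 1) * b')) (Y : op ((a + 1) * b')) :
  \tr (V *m on1 tag_check Y) =
  \tr ((j *t 1%:M)^t* *m V *m (j *t 1%:M) *m ((iQ *t 1%:M)^t* *m Y *m (iQ *t 1%:M)))
  + (\tr (((1%:M : op (a + 1)) *t slice2 V (rshift a' 0) (rshift a' 0)) *m Y)
     - \tr (((1%:M : op a') *t slice2 V (rshift a' 0) (rshift a' 0)) *m ((iQ *t 1%:M)^t* *m Y *m (iQ *t 1%:M)))).
Proof.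
have -> : on1 tag_check Y = (j *m iQ^t* *t 1%:M) *m Y *m (j *m iQ^t* *t 1%:M)^t*
    + bot R a' *t trl (((1%:M - iQ *m iQ^t*) *t 1%:M) *m Y).
  rewrite -on1_conj -on1_trace /on1 -big_split; apply: eq_bigr => l _ /=.
  rewrite -big_split; apply: eq_bigr => l' _ /=; by rewrite -tensDl.
rewrite mulmxDr mxtraceD; congr (_ + _).
  have -> : j *m iQ^t* *t (1%:M : op b') = (j *t 1%:M) *m (iQ *t 1%:M)^t*.
    by rewrite adj_tens adjC1 tensmx_mul mul1mx.
  rewrite adjM trmxCK; move: (j *t 1%:M) (iQ *t 1%:M) => j1 q1.
  by rewrite -!mulmxA [RHS]mxtrace_mulC !mulmxA.
rewrite botE trace_mul_delta_tens trace_trl; move: (slice2 V _ _) => B.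
rewrite mulmxA tensmx_mul mul1mx mulmx1 tensBl mulmxBl raddfB /=; congr (_ - _).
have -> : iQ *m iQ^t* *t B = (iQ *t 1%:M) *m (1%:M *t B) *m (iQ *t 1%:M)^t*.
  by rewrite adj_tens adjC1 !tensmx_mul !mulmx1 mul1mx.
move: (iQ *t 1%:M) (1%:M *t B) => q1 B1.
by rewrite -!mulmxA [LHS]mxtrace_mulC !mulmxA.
Qed.

Lemma trace_ideal (V : op ((a' + 1) * b')) (Z : op (a' * b')) (r : op b') :
  \tr (V *m (on1 (@dsum0 R a') Z + bot R a' *t r)) =
  \tr ((j *t 1%:M)^t* *m V *m (j *t 1%:M) *m Z) + \tr (slice2 V (rshift a' 0) (rshift a' 0) *m r).
Proof.
rewrite mulmxDr mxtraceD botE trace_mul_delta_tens; congr (_ + _).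
have -> : on1 (@dsum0 R a') Z = (j *t 1%:M) *m Z *m (j *t 1%:M)^t*.
  by rewrite -on1_conj; apply: eq_on1 => Y; exact: dsum0E.
move: (j *t 1%:M) => q1.
by rewrite -!mulmxA [RHS]mxtrace_mulC !mulmxA.
Qed.

(** [accept] is used twice, for accepted outputs and inside rejection, and [reject_test] once: 21 =
    10 + 1 + 10. *)
Lemma tag_test (V : op ((a' + 1) * b')) p (y : 'M[C]_(a' * b, p)) : contr V -> hs y = 1 ->
  abs (\tr (V *m (on1 tag_check (eff e d (kraus W) (((Q *t 1%:M) *m y) *m ((Q *t 1%:M) *m y)^t*))
    - (on1 (@dsum0 R a') (on2 (kraus (fun n => avg (W n))) (y *m y^t*))
       + bot R a' *t kraus (rej_ops W) (trl (y *m y^t*)))))) <=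
  2 * reject_weight d eps Q + 21 * slack a eps.
Proof.
move=> cV y1; rewrite mulmxBr raddfB /= trace_tag_check trace_ideal.
have jj : (j *t (1%:M : op b'))^t* *m (j *t 1%:M) = 1%:M.
  by rewrite adj_tens tensmx_mul inj_botK adjC1 mul1mx tens11.
have QQ1 : (Q *t (1%:M : op b))^t* *m (Q *t 1%:M) = 1%:M.
  by rewrite adj_tens tensmx_mul QQ adjC1 mul1mx tens11.
have cT : contr ((j *t (1%:M : op b'))^t* *m V *m (j *t 1%:M)).
  by apply: contrM; [apply: contrM => //; apply: contr_adj|]; exact: contr_isometry.
have cB := contr_slice2 (rshift a' 0) cV.
have cB1 := contr_tens (@contr1 R a') cB.
move: (slice2 V _ _) ((j *t 1%:M)^t* *m V *m (j *t 1%:M)) cT cB cB1 => B T cT cB cB1.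
have x1 : hs ((Q *t (1%:M : op b)) *m y) = 1 by rewrite hs_isometry.
have h1 := accept k0 a0 c1 e1 d1 de eps0 nm small W1 QQ cT y1.
have h2 := accept k0 a0 c1 e1 d1 de eps0 nm small W1 QQ cB1 y1.
have h3 := reject_test k0 a0 c1 e1 d1 de eps0 nm small W1 cB x1.
apply: le_trans (abs_two_tests h1 h3 h2 _) _.
  rewrite (mixed_test W B _ (ltnW c1)).
  have -> : trl (((Q *t 1%:M) *m y) *m ((Q *t 1%:M) *m y)^t*) = trl (y *m y^t*).
    have lQ := linear_kraus (fun _ : 'I_1 => Q).
    have tQ : trace_preserving (kraus (fun _ : 'I_1 => Q)) by apply/kraus_tp; rewrite big_ord1.
    rewrite -(trl_on1_tp (y *m y^t*) lQ tQ) on1_kraus /kraus big_ord1 [X in _ *m X]adjM.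
    by rewrite !mulmxA.
  congr (_ + _); rewrite -trace_trl; congr (\tr (_ *m _)).
  by rewrite trl_on2; last exact: linear_kraus.
rewrite -/(slack a eps); move: (reject_weight _ _ _) (slack _ _) => r s; lra.
Qed.

End Scheme.
End TagTest.

(** * The tagged scheme *)

Section TagScheme.
Variable R : realType.
Local Notation C := R[i].
Local Notation op n := 'M[C]_n%N.

Section Tag.
Variables (a t a' : nat) (U : 'M[C]_(a, t * a')) (psi : 'cV[C]_t).
Hypothesis UU : U^t* *m U = 1%:M.
Hypothesis psi1 : psi^t* *m psi = 1%:M.

Local Notation Q := (ket_tag U psi).
Local Notation B := (castmx (erefl (t * a')%N, mul1n a') (psi *t (1%:M : op a'))).

Lemma ket_entry x y z : B (mxtens_index (x, y)) z = psi x 0 * (y == z)%:R.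
Proof.
rewrite castmxE /= mxE cast_ord_id mxtens_indexK /= !mxE.
congr (_ * _); first by congr (psi _ _); rewrite [LHS]ord1.
by rewrite (_ : Ordinal _ = z) //; apply: val_inj => /=; rewrite modn_small.
Qed.

Lemma ket_conj Z : U *m ((psi *m psi^t*) *t Z) *m U^t* = Q *m Z *m Q^t*.
Proof.
have -> : (psi *m psi^t*) *t Z = B *m Z *m B^t*.
  apply/matrixP => i j; case: (mxtens_indexP i) => x y; case: (mxtens_indexP j) => x' y'.
  rewrite tensmxE !mxE big_ord1 (bigD1 y') //= [X in _ + X]big1 ?addr0 => [|z zy]; last first.
    by rewrite adjE ket_entry eq_sym (negbTE zy) mulr0 rmorph0 mulr0.
  rewrite !mxE (bigD1 y) //= [X in _ + X]big1 ?addr0 => [|z zy]; last first.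
    by rewrite ket_entry eq_sym (negbTE zy) mulr0 mul0r.
  rewrite !ket_entry !eqxx !mulr1.
  by rewrite mulrAC.
by rewrite /ket_tag adjM !mulmxA.
Qed.

Lemma ket_iso : Q^t* *m Q = 1%:M.
Proof.
rewrite /ket_tag adjM -mulmxA (mulmxA (U^t*)) UU mul1mx.
apply/matrixP => i j; rewrite !mxE sum_mxtens.
transitivity ((psi^t* *m psi) 0 0 * (i == j)%:R); last by rewrite psi1 !mxE eqxx mul1r.
rewrite !mxE mulr_suml; apply: eq_bigr => x _.
rewrite (bigD1 i) //= [X in _ + X]big1 ?addr0 => [|z zi]; last first.
  by rewrite adjE ket_entry (negbTE zi) mulr0 rmorph0 mul0r.
by rewrite !adjE !ket_entry eqxx mulr1 mulrA.
Qed.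

Lemma tag_projE : tag_proj U psi = Q *m Q^t*.
Proof. by rewrite /tag_proj ket_conj mulmx1. Qed.

Lemma ulsubmxE (Z : op (a + 1)) : ulsubmx Z = (inj_bot R a)^t* *m Z *m inj_bot R a.
Proof.
rewrite -[in RHS](submxK Z) /inj_bot tr_col_mx map_row_mx adjC1 trmx0 map_mx0.
by rewrite mul_row_block mul_row_col !mul1mx !mul0mx !addr0 mulmx1 mulmx0 addr0.
Qed.

Lemma tag_checkE (Z : op (a + 1)) :
  tag_check Q Z = tag_accept U psi Z + \tr ((1%:M - dsum0 (tag_proj U psi)) *m Z) *: bot R a'.
Proof.
rewrite /tag_check /tag_accept tag_projE !dsum0E ulsubmxE; congr (_ + _).
  by rewrite !adjM !trmxCK !mulmxA.
by congr (\tr ((_ - _) *m _) *: _); rewrite adjM !mulmxA.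
Qed.

Lemma tag_decE k c (D : op (c * k) -> op ((a + 1) * k)) Y :
  tag_dec U psi D Y = on1 (tag_check Q) (D Y).
Proof.
rewrite /tag_dec -on1_trace /on1 -big_split; apply: eq_bigr => l _ /=.
rewrite -big_split; apply: eq_bigr => l' _ /=.
by rewrite tag_checkE tensDl.
Qed.

Lemma tag_encE k c (E : op (a * k) -> op (c * k)) Y :
  tag_enc U psi E Y = E (on1 (fun Z => Q *m Z *m Q^t*) Y).
Proof. by rewrite /tag_enc; congr E; apply: eq_on1 => Z; exact: ket_conj. Qed.

Variables (k c : nat) (I J : finType).
Variables (e : 'I_k -> I -> 'M[C]_(c, a)) (d : 'I_k -> J -> 'M[C]_(a + 1, c)).
Variables (E : op (a * k) -> op (c * k)) (D : op (c * k) -> op ((a + 1) * k)).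
Hypothesis lE : linear E.
Hypothesis lD : linear D.
Hypothesis EE : forall X i, E (X *t ketbra R i) = kraus (e i) X *t ketbra R i.
Hypothesis DE : forall X i, D (X *t ketbra R i) = kraus (d i) X *t ketbra R i.

Lemma linear_conj m n (K : 'M[C]_(m, n)) : linear (fun Z => K *m Z *m K^t*).
Proof. by move=> z X Y; rewrite mulmxDr mulmxDl -scalemxAr -scalemxAl. Qed.

Lemma effective_tag b b' (L : op (c * b) -> op (c * b')) X : linear L ->
  effective (tag_enc U psi E) (tag_dec U psi D) L X =
  on1 (tag_check Q) (eff e d L ((Q *t 1%:M) *m X *m (Q *t 1%:M)^t*)).
Proof.
move=> lL; have lT := linear_tag_check Q; have lQ := linear_conj Q.
rewrite (@effective_keyed R _ _ _ _ _ (fun i => kraus (e i) \o (fun Z => Q *m Z *m Q^t*))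
   (fun i => tag_check Q \o kraus (d i)) _ _ L).
- rewrite effE (lin_Z (linear_on1 lT)) (lin_sum (linear_on1 lT)); congr (_ *: _).
  apply: eq_bigr => i _; apply: etrans (on1_comp _ lT (linear_kraus (d i))) _.
  congr (on1 _ (on1 _ (L _))); apply: etrans (on1_comp X (linear_kraus (e i)) lQ) _.
  by congr (on1 _ _); exact: on1_conj.
- have lQ1 : linear (fun Y : op (a' * k) => on1 (fun Z => Q *m Z *m Q^t*) Y) by exact: linear_on1.
  by move=> z Y Z; rewrite !tag_encE lQ1 lE.
- by move=> z Y Z; rewrite !tag_decE lD (linear_on1 lT).
- exact: lL.
- by move=> i; apply: linear_comp => //; exact: linear_kraus.
- by move=> i; apply: linear_comp => //; exact: linear_kraus.
- by move=> Y i; rewrite tag_encE on1_tens // EE.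
- by move=> Y i; rewrite tag_decE DE on1_tens.
Qed.

End Tag.
End TagScheme.

(** * Choice of the tag and final constants *)

Section Main.
Variable R : realType.
Local Notation C := R[i].
Local Notation op n := 'M[C]_n%N.

Lemma pigeonhole_le n (w : 'I_n -> R) (s : R) : (0 < n)%N -> \sum_t w t <= s ->
  exists t, w t <= s / n%:R.
Proof.
move=> n0 ws; apply/existsP; rewrite -[X in is_true X]negbK; apply/negP; rewrite negb_exists => /forallP h.
have np : 0 < (n%:R : R) by rewrite ltr0n.
have : \sum_(t < n) s / n%:R < \sum_t w t.
  apply: ltr_sum => [|t _]; last by rewrite ltNge.
  by apply/hasP; exists (Ordinal n0) => //; rewrite mem_index_enum.
rewrite sumr_const card_ord -[_ *+ n]mulr_natl mulrC divfK ?gt_eqF // => /lt_le_trans/(_ ws).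
by rewrite ltxx.
Qed.

(** 3485 = 2 * (4 / 3) * 36 + 2 * 256 + 21 * 128 + 21 * 9. *)
Lemma bound_arith (x w n v u : R) : 0 < x -> w <= n -> w <= 1 -> v <= x -> u <= x ->
  2 * (4 / 3 * w * (1 + 36 * x) + 256 * v) + 21 * (128 * u + 9 * x) <= 8 / 3 * n + 3485 * x.
Proof.
move=> x0 wn w1 vx ux; have : w * x <= x by rewrite ler_piMl // ltW.
lra.
Qed.

Lemma tag_bound_le a (eps w n : R) : (0 < a)%N -> a%:R ^+ 6 * eta eps <= 1 -> w <= n -> w <= 1 ->
  2 * (4 / 3 * w * (1 + 36 / a%:R) + 256 * (a%:R ^+ 2 * eta eps)) + 21 * slack a eps <=
  8 / 3 * n + 3485 / a%:R.
Proof.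
move=> a0 small wn w1; have ap : 0 < (a%:R : R) by rewrite ltr0n.
have h m : (m < 6)%N -> a%:R ^+ m * eta eps <= a%:R^-1.
  move=> m6; rewrite -[leRHS]mul1r ler_pdivlMr // mulrAC -exprSr.
  apply: le_trans small; apply: ler_wpM2r; first exact: eta_ge0.
  by apply: ler_weXn2l => //; rewrite ler1n.
have x0 : 0 < (a%:R^-1 : R) by rewrite invr_gt0.
exact: (bound_arith x0 wn w1 (h 2 isT) (h 3 isT)).
Qed.

Section Scheme.
Variables (k a c : nat) (I J : finType).
Variables (e : 'I_k -> I -> 'M[C]_(c, a)) (d : 'I_k -> J -> 'M[C]_(a + 1, c)).
Variables (E : op (a * k) -> op (c * k)) (D : op (c * k) -> op ((a + 1) * k)).
Hypothesis lE : linear E.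
Hypothesis lD : linear D.
Hypothesis EE : forall X i, E (X *t ketbra R i) = kraus (e i) X *t ketbra R i.
Hypothesis DE : forall X i, D (X *t ketbra R i) = kraus (d i) X *t ketbra R i.
Hypothesis k0 : (0 < k)%N.
Hypothesis a1 : (1 < a)%N.
Hypothesis e1 : forall i, \sum_j (e i j)^t* *m e i j = 1%:M.
Hypothesis d1 : forall i, \sum_j (d i j)^t* *m d i j = 1%:M.
Hypothesis de : forall i X, kraus (d i) (kraus (e i) X) = inj_bot R a *m X *m (inj_bot R a)^t*.
Variable eps : R.
Hypothesis eps0 : 0 <= eps.
Hypothesis nmE : non_malleable eps E D.
Hypothesis small : a%:R ^+ 6 * eta eps <= 1.

(** Some coefficient of [coef_exists] is nonzero, so that e i j has a left inverse and c >= a. *)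
Lemma cipher_gt1 : (1 < c)%N.
Proof.
have a0 := ltnW a1; have [z [ze z1]] := coef_exists a0 de.
apply: leq_trans a1 _; pose i := Ordinal k0.
have [j [l zn0]] : exists j l, z i j l != 0.
  have : \sum_j \sum_l abs (z i j l) ^+ 2 != 0 by rewrite z1 oner_eq0.
  rewrite psumr_neq0; last by move=> j _; apply: sumr_ge0 => l _; exact: sqr_ge0.
  move=> /hasP[j _ /= /lt0r_neq0]; rewrite psumr_neq0; last by move=> l _; exact: sqr_ge0.
  move=> /hasP[l _ /=] h; exists j, l; apply: contraTneq h => ->.
  by rewrite abs0 expr0n ltxx.
apply: (@mulmx1_min _ _ _ ((inj_bot R a)^t* *m ((z i j l)^-1 *: d i l)) (e i j)).
by rewrite -scalemxAr -scalemxAl -mulmxA ze -scalemxAr scalerA mulVf // scale1r inj_botK.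
Qed.

Lemma nm_prod_scheme : nm_prod e d eps.
Proof.
move=> b b' L rho V s s' cL pL srho cV.
have ED u v (F : op (c * u) -> op (c * v)) X : linear F -> effective E D F X = eff e d F X.
  by move=> lF; exact: effective_eff.
exact: (nm_product k0 e1 d1 s s' (ltnW a1) ED nmE cL pL srho cV).
Qed.

Section Dns.
Variables (t a' : nat) (U : 'M[C]_(a, t * a')) (psi : 'cV[C]_t).
Hypothesis UU : U^t* *m U = 1%:M.
Hypothesis psi1 : psi^t* *m psi = 1%:M.

Lemma tag_dns : dns_authenticating (2 * reject_weight d eps (ket_tag U psi) + 21 * slack a eps)
  (tag_enc U psi E) (tag_dec U psi D).
Proof.
move=> b b' L cL; have [[lL cpL] tpL] := cL.
have c1 := cipher_gt1; have a0 := ltnW a1.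
have [N [W LW]] := cp_krausP (conj lL cpL).
have WW : \sum_j (W j)^t* *m W j = 1%:M by apply/kraus_tp => X; rewrite -LW tpL.
have W1 p (X : 'M[C]_(c * b, p)) : \sum_j hs (W j *m X) <= hs X by rewrite kraus_tp_hs.
exists (kraus (fun n => avg (W n))), (kraus (rej_ops W)); split.
- exact: cp_kraus.
- exact: cp_kraus.
- move=> X; have := mixed_test W 1%:M X (ltnW c1); rewrite tens11 !mul1mx -LW tpL trace_tens.
  by case: (state_mixed R (ltnW c1)) => _ ->; rewrite mul1r mxtraceD addrC.
(* All estimates were made for inputs y *m y^t* with y of several columns; a factor of rho puts a
   mixed state into this form. *)
move=> rho [psd_rho tr_rho]; have [S rhoE] := psd_factor psd_rho.
have y1 : hs (S^t*) = 1 by apply: complexI; rewrite -trace_mul_adj trmxCK -rhoE tr_rho.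
apply: norm1_le => V cV; apply: le_trans (Re_le_abs _) _.
have := tag_test k0 a0 c1 e1 d1 de eps0 nm_prod_scheme small W1 (ket_iso UU psi1) cV y1.
have -> : effective (tag_enc U psi E) (tag_dec U psi D) L rho =
   on1 (tag_check (ket_tag U psi)) (eff e d (kraus W)
     (((ket_tag U psi *t 1%:M) *m S^t*) *m ((ket_tag U psi *t 1%:M) *m S^t*)^t*)).
  have h := effective_tag U psi lE lD EE DE rho lL.
  apply: (etrans h); apply: (f_equal (on1 (tag_check (ket_tag U psi)))).
  apply: (etrans (eq_eff e d _ LW)); apply: (f_equal (eff e d (kraus W))).
  by rewrite rhoE [in RHS]adjM trmxCK !mulmxA.
by rewrite trmxCK -rhoE.
Qed.

End Dns.
End Scheme.

(** [omega] depends on the scheme alone, so the tag can be fixed before the attack is known. The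
    projections onto the tag spaces sum to 1, hence the weights of [omega] in them to at most 1. The
    bound w <= 1 serves the correction w * 36 / a. *)
Lemma exists_tag a dd a' k c (E : op (a * k) -> op (c * k)) (D : op (c * k) -> op ((a + 1) * k)) (eps : R) :
  a = (dd * a')%N -> (1 < a)%N -> qes E D -> 0 <= eps -> non_malleable eps E D ->
  a%:R ^+ 6 * eta eps <= 1 ->
  exists (U : 'M[C]_(a, dd * a')) (psi : 'cV[C]_dd),
    [/\ U \is unitarymx, U^t* \is unitarymx, psi^t* *m psi = 1%:M &
        exists w : R, [/\ w <= dd%:R^-1, w <= 1 &
          dns_authenticating (2 * (4 / 3 * w * (1 + 36 / a%:R) + 256 * (a%:R ^+ 2 * eta eps)) + 21 * slack a eps)
          (tag_enc U psi E) (tag_dec U psi D)]].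
Proof.
move=> aE a1 qED eps0 nmE small; subst a.
have dd0 : (0 < dd)%N by case: (dd) a1.
have [k0 cE cD keyE keyD corr] := qED.
have [I [e [EE e1]]] := block_kraus cE keyE.
have [J [d [DE d1]]] := block_kraus cD keyD.
have lE : linear E by case: cE => -[].
have lD : linear D by case: cD => -[].
have de i X : kraus (d i) (kraus (e i) X) = inj_bot R _ *m X *m (inj_bot R _)^t*.
  by rewrite -dsum0E -(trr_ketbra (dsum0 X) i) -corr EE DE trr_ketbra.
have c1 := cipher_gt1 k0 a1 de.
have [om0 om1] : psd (omega d) /\ \tr (omega d) = 1 by split; [exact: psd_omega | exact: (tr_omega k0 c1 d1)].
have UU : (1%:M : op (dd * a'))^t* *m 1%:M = 1%:M by rewrite adjC1 mulmx1.
pose psi (t : 'I_dd) : 'cV[C]_dd := delta_mx t 0.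
have psi1 t : (psi t)^t* *m psi t = 1%:M.
  by rewrite /psi adj_delta mul_delta_mx; apply/matrixP => i j; rewrite !mxE !ord1 !eqxx.
pose Q t := ket_tag (1%:M : op (dd * a')) (psi t).
pose w t := complex.Re (\tr (inj_bot R _ *m Q t *m (inj_bot R _ *m Q t)^t* *m omega d)).
have QQ1 : \sum_t Q t *m (Q t)^t* = 1%:M.
  have QE t : Q t *m (Q t)^t* = delta_mx t t *t 1%:M.
    rewrite /Q -tag_projE /tag_proj adjC1 mulmx1 mul1mx; congr (_ *t _).
    by rewrite /psi adj_delta mul_delta_mx.
  under eq_bigr => t _ do rewrite QE.
  by rewrite -tens_suml sum_delta1 tens11.
have wle V : contr V -> complex.Re (\tr (V *m omega d)) <= 1.
  move=> cV; apply: le_trans (Re_le_abs _) _; apply: le_trans (abs_tr_psd cV om0) _.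
  by rewrite om1.
have ci := contr_isometry (inj_botK R (dd * a')).
have ws : \sum_t w t <= 1.
  have -> : \sum_t w t = complex.Re (\tr (inj_bot R _ *m (inj_bot R _)^t* *m omega d)).
    rewrite -Re_sum -raddf_sum /= -mulmx_suml; congr (complex.Re (\tr (_ *m _))).
    under eq_bigr => t _ do rewrite adjM mulmxA -[X in X *m _]mulmxA.
    by rewrite -mulmx_suml -mulmx_sumr QQ1 mulmx1.
  by apply: wle; apply: contrM => //; exact: contr_adj.
have [t wt] := pigeonhole_le dd0 ws; rewrite div1r in wt.
exists 1%:M, (psi t); split=> //.
- by apply/unitarymxP; rewrite adjC1 mulmx1.
- by apply/unitarymxP; rewrite trmxCK mulmx1 adjC1.
exists (w t); split=> //.
  have iQ : contr (inj_bot R _ *m Q t) by apply: contrM => //; apply: contr_isometry; exact: ket_iso.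
  by apply: wle; apply: contrM => //; exact: contr_adj.
exact: (tag_dns lE lD EE DE k0 a1 e1 d1 de eps0 nmE small UU (psi1 t)).
Qed.

Lemma dns_le a k c (E : op (a * k) -> op (c * k)) (D : op (c * k) -> op ((a + 1) * k)) (x y : R) :
  x <= y -> dns_authenticating x E D -> dns_authenticating y E D.
Proof.
move=> xy h b b' L cL; have [A [B [cA cB tAB hAB]]] := h b b' L cL.
by exists A, B; split=> // rho srho; apply: le_trans (hAB rho srho) xy.
Qed.

(** eta is the square root of eps, so r >= 12 gives eta <= 2^(-6 n) = a^-6. *)
Lemma eta_small (r : R) n : 12 <= r -> (2 ^ n)%:R ^+ 6 * eta (2 `^ (- (r * n%:R))) <= 1 :> R.
Proof.
move=> r12; rewrite /eta.
have a0 : 0 < ((2 ^ n)%:R : R) by rewrite ltr0n expn_gt0.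
have le1 : 2 `^ (- (r * n%:R)) <= ((2 ^ n)%:R ^- 6) ^+ 2 :> R.
  apply: (@le_trans _ _ (2 `^ (- (12 * n%:R)))).
    by apply: ler_powR; rewrite ?ler1n // lerN2 ler_wpM2r.
  rewrite powRN -natrM powR_mulrn // natrX exprVn -!exprM.
  by rewrite mulnC.
apply: (@le_trans _ _ ((2 ^ n)%:R ^+ 6 * Num.sqrt (((2 ^ n)%:R ^- 6) ^+ 2))).
  by apply: ler_wpM2l; [rewrite exprn_ge0 // ltW | exact: ler_wsqrtr].
rewrite sqrtr_sqr ger0_norm ?mulfV ?expf_neq0 ?gt_eqF // invr_ge0 exprn_ge0 // ltW //.
Qed.

(** With s = 2^(n / 2) the claim on the second terms is 3485 <= s, and n >= 24 gives s >= 2^12 =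
    4096. *)
Lemma total_le n (x : R) : (24 <= n)%N -> 0 <= x ->
  8 / 3 * x + 3485 / (2 ^ n)%:R <= 4 * x + 2 `^ (- (2^-1 * n%:R)).
Proof.
move=> n24 x0; apply: lerD; first by apply: ler_wpM2r => //; lra.
set s : R := 2 `^ (2^-1 * n%:R).
have s0 : 0 < s by rewrite powR_gt0.
have ss : (2 ^ n)%:R = s ^+ 2.
  rewrite -powR_mulrn ?ltW // -powRrM natrX -powR_mulrn //; congr (_ `^ _).
  by rewrite mulrAC mulVf ?mul1r // pnatr_eq0.
have s1 : 4096 <= s.
  have -> : 4096 = 2 `^ 12%:R :> R by rewrite powR_mulrn // -natrX.
  apply: ler_powR; rewrite ?ler1n //.
  rewrite -(@ler_pM2l _ 2) // mulrA mulfV ?pnatr_eq0 // mul1r -natrM ler_nat //.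
rewrite powRN -/s ss ler_pdivrMr ?exprn_gt0 // expr2 mulrA mulVf ?gt_eqF // mul1r.
by apply: le_trans s1; rewrite ler_nat.
Qed.

End Main.

Theorem theorem5p38 (R : realType) :
  exists r0 : R, forall r : R, r0 <= r ->
  exists (e : R) (n0 : nat), 0 < e /\
  forall (n k c d : nat)
    (E : 'M[R[i]]_(2 ^ n * k)%N -> 'M[R[i]]_(c * k)%N)
    (D : 'M[R[i]]_(c * k)%N -> 'M[R[i]]_((2 ^ n + 1) * k)%N),
  (n0 <= n)%N ->
  qes E D ->
  non_malleable (2 `^ (- (r * n%:R))) E D ->
  (d %| 2 ^ n)%N ->
  exists (a' : nat) (U : 'M[R[i]]_((2 ^ n)%N, (d * a')%N)) (psi : 'cV[R[i]]_d),
    [/\ U \is unitarymx, U^t* \is unitarymx,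
        psi^t* *m psi = 1%:M &
        dns_authenticating (4 / d%:R + 2 `^ (- (e * n%:R)))
          (tag_enc U psi E) (tag_dec U psi D)].
Proof.
(* 12 is the threshold of [eta_small]; the exponent 1 / 2 and n0 = 24 are those of [total_le], where
   half of the decay 2^-n is spent on the constant. *)
exists 12 => r r12; exists 2^-1, 24; split=> [|n k c d E D n24 qED nmE dn]; first by rewrite invr_gt0.
have aE : (2 ^ n = d * (2 ^ n %/ d))%N by rewrite mulnC divnK.
have a1 : (1 < 2 ^ n)%N by rewrite -{1}(expn0 2) ltn_exp2l // (leq_trans _ n24).
have eps0 : 0 <= 2 `^ (- (r * n%:R)) :> R by exact: powR_ge0.
have small := eta_small n r12.
have [U [psi [hU hU' psi1 [w [wd w1 hw]]]]] := exists_tag aE a1 qED eps0 nmE small.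
exists (2 ^ n %/ d)%N, U, psi; split=> //.
apply: dns_le hw; apply: le_trans (tag_bound_le (ltnW a1) small wd w1) _.
by apply: total_le; rewrite ?invr_ge0.
Qed.
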